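(* Let $k\ge1$ be an integer and let $\nu\in\mathcal{D}_c(k)$. Then for every $t>0$, $$\Phi(\nu\boxplus\gamma_t)=\mathbb{B}_t(\Phi(\nu))\in\mathcal{D}_c(k).$$ Here $\gamma_t$ is the joint distribution of a free family $x_1,\ldots,x_k$ in which every $x_i$ has the centered semicircular distribution of variance $t$; $\mathbb{B}_t(\mu)=\bigl(\mu^{\boxplus(1+t)}\bigr)^{\uplus(1/(1+t))}$; and $\Phi(\sigma)$ is the unique element of $\mathcal{D}_{\mathrm{alg}}(k)$ with $\eta_{\Phi(\sigma)}=\sum_{i=1}^k z_i(1+M_\sigma)z_i$.
   Context: Let $\mathbb{C}\langle X_1,\ldots,X_k\rangle$ be the algebra of non-commutative polynomials, and let $\mathcal{D}_{\mathrm{alg}}(k)$ be the set of linear functionals $\mu:\mathbb{C}\langle X_1,\ldots,X_k\rangle\to\mathbb{C}$ with $\mu(1)=1$. For elements $x_1,\ldots,x_k$ of a non-commutative probability space $(\mathcal{A},\varphi)$ (unital complex algebra with a linear functional, $\varphi(1)=1$), their joint distribution is the $\mu\in\mathcal{D}_{\mathrm{alg}}(k)$ with $\mu(X_{i_1}\cdots X_{i_n})=\varphi(x_{i_1}\cdots x_{i_n})$. $\mathcal{D}_c(k)\subseteq\mathcal{D}_{\mathrm{alg}}(k)$ is the set of joint distributions of $k$-tuples of selfadjoint elements in $C^*$-probability spaces (unital $C^*$-algebra $\mathcal{A}$ with a positive linear functional $\varphi$, $\varphi(1)=1$). Let $\mathbb{C}_0\langle\langle z_1,\ldots,z_k\rangle\rangle$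 be the space of formal power series with zero constant term in non-commuting indeterminates $z_1,\ldots,z_k$. For $\mu\in\mathcal{D}_{\mathrm{alg}}(k)$: - the moment series is $M_\mu=\sum_{n\ge1}\sum_{i_1,\ldots,i_n=1}^k\mu(X_{i_1}\cdots X_{i_n})z_{i_1}\cdots z_{i_n}$; - the $\eta$-series is $\eta_\mu=M_\mu(1+M_\mu)^{-1}$; - the $R$-transform $R_\mu\in\mathbb{C}_0\langle\langle z_1,\ldots,z_k\rangle\rangle$ is the unique series with $R_\mu\bigl(z_1(1+M_\mu),\ldots,z_k(1+M_\mu)\bigr)=M_\mu$. Both $\mu\mapsto\eta_\mu$ and $\mu\mapsto R_\mu$ are bijections from $\mathcal{D}_{\mathrm{alg}}(k)$ onto $\mathbb{C}_0\langle\langle z_1,\ldots,z_k\rangle\rangle$. For $t>0$, $\mu^{\boxplus t}$ is the unique element of $\mathcal{D}_{\mathrm{alg}}(k)$ with $R_{\mu^{\boxplus t}}=tR_\mu$, and $\mu^{\uplus t}$ is the unique element with $\eta_{\mu^{\uplus t}}=t\eta_\mu$. The free additive convolution $\mu\boxplus\nu$ is the joint distribution of $x_1+y_1,\ldots,x_k+y_k$, where $x_1,\ldots,x_k$ have joint distribution $\mu$, $y_1,\ldots,y_k$ have joint distribution $\nu$, and the two families are freely independent; equivalently $R_{\mu\boxplus\nu}=R_\mu+R_\nu$. *)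

(* Defs.v *)
From HB Require Import structures.
From mathcomp Require Import all_boot all_order all_algebra.
From mathcomp Require Import complex monalg.
From mathcomp Require Import all_classical all_reals all_analysis.

Set Implicit Arguments.
Unset Strict Implicit.
Unset Printing Implicit Defensive.

Import Order.TTheory GRing.Theory Num.Theory.
Import numFieldNormedType.Exports.

Local Open Scope classical_set_scope.
Local Open Scope ring_scope.
Local Open Scope complex_scope.

(* A series is its family of coefficients, indexed by words.  The type is
   wrapped so that it does not inherit the pointwise product of functions. *)
Definition ncseries (K : fieldType) (k : nat) : Type := seq 'I_k -> K.

Section NCSeries.
Variables (K : fieldType) (k : nat).
Implicit Types f g h : ncseries K k.

HB.instance Definition _ := Choice.copy (ncseries K k) (seq 'I_k -> K).
HB.instance Definition _ := GRing.Zmodule.copy (ncseries K k) (seq 'I_k -> K).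

Definition ncs_scale (c : K) f : ncseries K k := fun w => c * f w.

Let scaleA a b f : ncs_scale a (ncs_scale b f) = ncs_scale (a * b) f.
Proof. by apply/funext => w; rewrite /ncs_scale mulrA. Qed.

Let scale1 : left_id 1 ncs_scale.
Proof. by move=> f; apply/funext => w; rewrite /ncs_scale mul1r. Qed.

Let scaleDr : right_distributive ncs_scale +%R.
Proof. by move=> c f g; apply/funext => w; rewrite /ncs_scale mulrDr. Qed.

Let scaleDl f : {morph ncs_scale^~ f : a b / a + b}.
Proof. by move=> a b; apply/funext => w; rewrite /ncs_scale mulrDl. Qed.

HB.instance Definition _ := GRing.Zmodule_isLmodule.Build K (ncseries K k)
  scaleA scale1 scaleDr scaleDl.

Definition ncs_one : ncseries K k := fun w => (w == [::])%:R.

Definition ncs_mul f g : ncseries K k := fun w =>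
  \sum_(j < (size w).+1) f (take j w) * g (drop j w).

Let shift (a : 'I_k) f : ncseries K k := fun w => f (a :: w).

Let mul_nil f g : ncs_mul f g [::] = f [::] * g [::].
Proof. by rewrite /ncs_mul big_ord1. Qed.

Let mul_cons f g a w :
  ncs_mul f g (a :: w) = f [::] * g (a :: w) + ncs_mul (shift a f) g w.
Proof. by rewrite /ncs_mul big_ord_recl. Qed.

Let mulDl : left_distributive ncs_mul +%R.
Proof.
move=> f g h; apply/funext => w.
transitivity (ncs_mul f h w + ncs_mul g h w) => //.
rewrite /ncs_mul -big_split /=.
by apply: eq_bigr => i _; rewrite -mulrDl.
Qed.

Let mulDr : right_distributive ncs_mul +%R.
Proof.
move=> f g h; apply/funext => w.
transitivity (ncs_mul f g w + ncs_mul f h w) => //.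
rewrite /ncs_mul -big_split /=.
by apply: eq_bigr => i _; rewrite -mulrDr.
Qed.

Let mulZl c f g w : ncs_mul (c *: f) g w = c * ncs_mul f g w.
Proof.
by rewrite /ncs_mul mulr_sumr; apply: eq_bigr => i _; rewrite mulrA.
Qed.

Let mulA : associative ncs_mul.
Proof.
move=> f g h; apply/funext => w.
elim: w f g h => [|a w IH] f g h; first by rewrite !mul_nil mulrA.
rewrite !mul_cons IH mul_nil mulrDr mulrA -addrA; congr (_ + _).
have -> : shift a (ncs_mul f g)
        = f [::] *: shift a g + ncs_mul (shift a f) g.
  by apply/funext => u; rewrite /shift mul_cons.
by rewrite mulDl -mulZl.
Qed.

Let mul1 : left_id ncs_one ncs_mul.
Proof.
move=> f; apply/funext => w.
rewrite /ncs_mul big_ord_recl /= take0 drop0 mul1r big1 ?addr0 // => i _.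
by case: w i => [|a w] i; [case: i | rewrite /ncs_one /= mul0r].
Qed.

Let mul_1 : right_id ncs_one ncs_mul.
Proof.
move=> f; apply/funext => w.
rewrite /ncs_mul big_ord_recr /= take_size drop_size mulr1.
rewrite big1 ?add0r // => i _; rewrite /ncs_one.
by rewrite -size_eq0 size_drop subn_eq0 leqNgt ltn_ord mulr0.
Qed.

Let one_neq0 : ncs_one != 0.
Proof.
apply/eqP => /(congr1 (fun f : ncseries K k => f [::])) /eqP.
by rewrite /= oner_eq0.
Qed.

HB.instance Definition _ := GRing.Zmodule_isNzRing.Build (ncseries K k)
  mulA mul1 mul_1 mulDl mulDr one_neq0.

Definition ncs_unit : pred (ncseries K k) :=
  fun f => `[< exists g, g * f = 1 /\ f * g = 1 >].

Definition ncs_inv f : ncseries K k :=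
  if f \in ncs_unit then xget f [set g | g * f = 1 /\ f * g = 1] else f.

Let invP f : f \in ncs_unit -> ncs_inv f * f = 1 /\ f * ncs_inv f = 1.
Proof.
move=> fu; rewrite /ncs_inv fu.
by case: xgetP => [//|none]; move/asboolP: fu => [g /none].
Qed.

Let inv_mull : {in ncs_unit, left_inverse 1 ncs_inv *%R}.
Proof. by move=> f /invP[]. Qed.

Let inv_mulr : {in ncs_unit, right_inverse 1 ncs_inv *%R}.
Proof. by move=> f /invP[]. Qed.

Let unitP f g : g * f = 1 /\ f * g = 1 -> f \in ncs_unit.
Proof. by move=> fg; apply/asboolP; exists g. Qed.

Let inv_out : {in [predC ncs_unit], ncs_inv =1 id}.
Proof. by move=> f /negbTE fN; rewrite /ncs_inv fN. Qed.

HB.instance Definition _ := GRing.NzRing_hasMulInverse.Build (ncseries K k)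
  inv_mull inv_mulr unitP inv_out.

Definition ncs_var (i : 'I_k) : ncseries K k := fun w => (w == [:: i])%:R.

(* f(g_1, ..., g_k).  The formula is the usual one when every g_i has zero
   constant term: g_{i_1} ... g_{i_n} then only contributes to words of length
   at least n, which is why the sum can be cut at n = size w. *)
Definition ncs_subst f (g : 'I_k -> ncseries K k) : ncseries K k := fun w =>
  \sum_(n < (size w).+1) \sum_(i : n.-tuple 'I_k)
    f i * (\prod_(j <- i) g j : ncseries K k) w.

Lemma ncs_unitE f : (f \is a GRing.unit) = (f [::] != 0).
Proof.
apply/idP/idP => [/mulrV /(congr1 (fun h : ncseries K k => h [::]))|f0].
  rewrite [LHS]mul_nil [RHS]/((_ == _)%:R) eqxx => E.
  by apply: contra_eq_neq E => ->; rewrite mul0r eq_sym oner_eq0.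
have rinv (h : ncseries K k) : h [::] != 0 -> exists g, h * g = 1.
  move=> h0; pose u := (h [::])^-1.
  pose fix G (n : nat) (w : seq 'I_k) : K :=
    if n is n'.+1 then
      if w is a :: w' then
        - u * \sum_(j < (size w').+1) h (a :: take j w') * G n' (drop j w')
      else u
    else 0.
  have Gn n m w : (size w < n)%N -> (size w < m)%N -> G n w = G m w.
    elim: n m w => [|n IH] [|m] [|a w] //=; rewrite !ltnS => wn wm.
    congr (_ * _); apply: eq_bigr => j _; congr (_ * _).
    by apply: IH; rewrite size_drop; apply: leq_ltn_trans (leq_subr _ _) _.
  exists (fun w => G (size w).+1 w); apply/funext => -[|a w].
    by rewrite [LHS]mul_nil /= mulfV // /GRing.one.
  rewrite [LHS]mul_cons [X in h [::] * X]/= mulrA mulrN mulfV // mulN1r.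
  rewrite /ncs_mul [RHS](_ : _ = 0) //.
  apply/eqP; rewrite addrC subr_eq0; apply/eqP; apply: eq_bigr => j _.
  congr (_ * _); apply: Gn => //.
  by rewrite ltnS size_drop leq_subr.
have [g fg] := rinv f f0.
have g0 : g [::] != 0.
  move/(congr1 (fun h : ncseries K k => h [::])): fg.
  rewrite [LHS]mul_nil [RHS]/((_ == _)%:R) eqxx => E.
  by apply: contra_eq_neq E => ->; rewrite mulr0 eq_sym oner_eq0.
have [h gh] := rinv g g0.
have hf : h = f by rewrite -[h]mul1r -fg -mulrA gh mulr1.
by apply/asboolP; exists g; split=> //; rewrite -hf.
Qed.

End NCSeries.

Record ncps (R : realType) := NCPS {
  ncps_alg :> algType R[i];
  ncps_state : {scalar ncps_alg};
  ncps_state1 : ncps_state 1 = 1 }.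

(* The norm and its completeness are fields, rather than inherited from
   completeNormedModType, because that hierarchy cannot be joined with algType:
   numDomainType already inherits from both a ring and a normed Zmodule, and
   no intermediate structure is declared. *)
HB.mixin Record isCStarAlgebra (R : realType) A & GRing.Algebra R[i] A := {
  star : A -> A;
  starK : involutive star;
  starD : {morph star : a b / a + b};
  starZ : forall (c : R[i]) (a : A), star (c *: a) = Num.conj c *: star a;
  starM : forall a b : A, star (a * b) = star b * star a;
  cnorm : A -> R;
  cnorm_eq0 : forall a, cnorm a = 0 -> a = 0;
  cnormD : forall a b, cnorm (a + b) <= cnorm a + cnorm b;
  cnormZ : forall (c : R[i]) (a : A),
    cnorm (c *: a) = ComplexField.Normc.normc c * cnorm a;
  cnormM : forall a b, cnorm (a * b) <= cnorm a * cnorm b;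
  cnorm_star : forall a, cnorm (star a * a) = cnorm a ^+ 2;
  cnorm_complete : forall u : nat -> A,
    (forall e : R, 0 < e -> exists N : nat, forall m n : nat,
       (N <= m)%N -> (N <= n)%N -> cnorm (u m - u n) < e) ->
    exists l : A, forall e : R, 0 < e -> exists N : nat, forall n : nat,
       (N <= n)%N -> cnorm (u n - l) < e }.

#[short(type="cstarAlgType")]
HB.structure Definition CStarAlgebra (R : realType) :=
  {A of GRing.Algebra R[i] A & isCStarAlgebra R A}.

Section Freeness.
Variables (R : realType) (A : ncps R).

Definition gen_subalg (S : set A) : set A :=
  smallest (fun B : set A => GRing.subalg_closed (mem B)) S.

(* Free independence of the unital subalgebras generated by the sets S i: the
   state vanishes on every alternating product of centered elements. *)
Definition freely_independent (I : eqType) (S : I -> set A) : Prop :=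
  forall s : seq (I * A), s != [::] ->
    sorted (fun p q => p.1 != q.1) s ->
    (forall p, p \in s -> gen_subalg (S p.1) p.2 /\ ncps_state A p.2 = 0) ->
  ncps_state A (\prod_(p <- s) p.2) = 0.

Definition semicircle_density (t s : R) : R :=
  Num.sqrt (4 * t - s ^+ 2) / (2 * pi * t).

Definition semicircular (t : R) (a : A) : Prop :=
  forall n : nat, ncps_state A (a ^+ n) =
    (\int[lebesgue_measure]_(s in `[- (2 * Num.sqrt t), 2 * Num.sqrt t])
       (s ^+ n * semicircle_density t s))%:C.

End Freeness.

(* C<X_1, ..., X_k>, as the algebra of the free monoid on k letters. *)
Notation ncpoly R k := {malg R[i][{fmonom 'I_k}]}.

Definition ncX (R : realType) (k : nat) (i : 'I_k) : ncpoly R k := << fmu i >>.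

Record dalg (R : realType) (k : nat) := DAlg {
  dalg_fun :> {scalar ncpoly R k};
  dalg1 : dalg_fun 1 = 1 }.

HB.instance Definition _ R k := gen_eqMixin (dalg R k).
HB.instance Definition _ R k := gen_choiceMixin (dalg R k).

Section Distributions.
Variables (R : realType) (k : nat).
Local Notation dalg := (dalg R k).
Implicit Types (mu nu sigma : dalg) (t : R).

Definition joint_dist (A : algType R[i]) (phi : A -> R[i])
    (x : 'I_k -> A) mu : Prop :=
  forall s : seq 'I_k, mu (\prod_(i <- s) ncX R i) = phi (\prod_(i <- s) x i).

Definition in_Dc mu : Prop :=
  exists (A : cstarAlgType R) (phi : {scalar A}) (x : 'I_k -> A),
    [/\ phi 1 = 1, forall a, 0 <= phi (star a * a),
        forall i, star (x i) = x i & joint_dist phi x mu].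

Definition moment_series mu : ncseries R[i] k := fun w =>
  if w is [::] then 0 else mu (\prod_(i <- w) ncX R i).

Definition eta_series mu : ncseries R[i] k :=
  moment_series mu * (1 + moment_series mu)^-1.

(* From here on, "the unique object such that ..." is rendered by [xget]; its
   first argument is the (irrelevant) value taken when there is none. *)

Definition R_transform mu : ncseries R[i] k :=
  xget 0 [set r : ncseries R[i] k | r [::] = 0 /\
    ncs_subst r (fun i => ncs_var _ i * (1 + moment_series mu))
      = moment_series mu].

Definition free_power mu t : dalg :=
  xget mu [set rho : dalg | R_transform rho = t%:C *: R_transform mu].

Definition boolean_power mu t : dalg :=
  xget mu [set rho : dalg | eta_series rho = t%:C *: eta_series mu].

Definition free_add mu nu : dalg :=
  xget mu [set rho : dalg | exists (A : ncps R) (x y : 'I_k -> A),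
    [/\ joint_dist (ncps_state A) x mu, joint_dist (ncps_state A) y nu,
        freely_independent
          (fun b : bool => if b then range x else range y)
      & joint_dist (ncps_state A) (fun i => x i + y i) rho]].

(* The joint distribution of (0, ..., 0), only used as a default value. *)
Definition dalg0 : dalg :=
  @DAlg R k (mcoeff (mone : {fmonom 'I_k})) (rmorph1 _).

Definition semicircular_family t : dalg :=
  xget dalg0 [set mu : dalg | exists (A : ncps R) (x : 'I_k -> A),
    [/\ freely_independent (fun i : 'I_k => [set x i]),
        forall i, semicircular t (x i)
      & joint_dist (ncps_state A) x mu]].

Definition BB t mu : dalg :=
  boolean_power (free_power mu (1 + t)) (1 / (1 + t)).

Definition Phi sigma : dalg :=
  xget sigma [set rho : dalg | eta_series rho =
    \sum_(i < k) ncs_var _ i * (1 + moment_series sigma) * ncs_var _ i].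

End Distributions.

(* Main.v *)
Require Import Defs.
From HB Require Import structures.
From mathcomp Require Import all_boot all_order all_algebra.
From mathcomp Require Import finmap complex monalg all_classical all_reals all_analysis.
From mathcomp Require Import ring lra zify.

Set Implicit Arguments.
Unset Strict Implicit.
Unset Printing Implicit Defensive.

Import Order.TTheory GRing.Theory Num.Theory.
Import numFieldNormedType.Exports.

Local Open Scope ring_scope.

(* The free convolution is realized on series in 2k letters: the variables of [nu]
   act by left derivatives, the semicircular ones by a left derivative plus [t]
   times a left multiplication, and the joint moments of the sums form a series [G]
   with [G = H * (G_nu \o (z H))], where [H = (1 - t \sum_i z_i G z_i)^-1].
   Substituting this subordination equation into the definition of the R-transform
   identifies [Phi] of the convolution with [BB t (Phi nu)].
   A functional lies in D_c iff the kernel [rho (u^* v)] on words is positive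
   semidefinite and [rho w] grows at most geometrically; for the converse, the
   polynomial algebra is completed in its GNS operator norm.  For the convolution
   and for [Phi], positivity comes from recursions that write the kernels as sums
   of Schur products of positive kernels. *)

(** [free_add] and [semicircular_family] pick a distribution satisfying an existential statement, so
    each needs a model for existence and the fact that freeness determines joint moments for
    uniqueness. An [ncps] carries no positivity, so the model can be purely algebraic: operators on
    series, with the state read off at the empty word. Positivity is recovered afterwards from
    recursions for the moments, not from a Hilbert space. Membership in D_c is proved for [Phi] of
    the convolution and transported along the equality. The free power by 1 + t inside [BB] is
    treated only algebraically, through its eta-series. The substitution z_i H has the
    noncommutative order of factors built in: G = H G_nu(z H) makes Phi_eta(G_nu) evaluated at z H
    collapse to Phi_eta(G) H, which is the reason why [Phi] linearizes the subordination. *)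

(** * Noncommutative power series: left derivatives and contractive fixed points *)

Section SeriesAlgebra.
Variables (K : fieldType) (k : nat).
Local Notation S := (ncseries K k).
Implicit Types (f g h : S) (a : 'I_k) (w : seq 'I_k) (c : K).

Definition lder a f : S := fun w => f (a :: w).

Lemma ncs_addE f g w : (f + g) w = f w + g w. Proof. by []. Qed.
Lemma ncs_oppE f w : (- f) w = - f w. Proof. by []. Qed.
Lemma ncs_scaleE c f w : (c *: f) w = c * f w. Proof. by []. Qed.
Lemma ncs_zeroE w : (0 : S) w = 0. Proof. by []. Qed.
Lemma ncs_oneE w : (1 : S) w = (w == [::])%:R. Proof. by []. Qed.

Lemma ncs_sumE (I : Type) (r : seq I) (P : pred I) (F : I -> S) w :
  (\sum_(i <- r | P i) F i) w = \sum_(i <- r | P i) F i w.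
Proof.
apply: (big_ind2 (fun (x : S) y => x w = y)) => // x1 x2 y1 y2 <- <-.
exact: ncs_addE.
Qed.

Lemma ncs_mulE f g w :
  (f * g) w = \sum_(j < (size w).+1) f (take j w) * g (drop j w).
Proof. by []. Qed.

Lemma ncs_mul_nil f g : (f * g) [::] = f [::] * g [::].
Proof. by rewrite ncs_mulE big_ord1. Qed.

Lemma ncs_mul_cons f g a w :
  (f * g) (a :: w) = f [::] * g (a :: w) + (lder a f * g) w.
Proof. by rewrite !ncs_mulE big_ord_recl. Qed.

Lemma ncs_scaleAl c f g : c *: (f * g) = (c *: f) * g.
Proof.
apply/funext => w; rewrite ncs_scaleE !ncs_mulE mulr_sumr.
by apply: eq_bigr => i _; rewrite ncs_scaleE mulrA.
Qed.

Lemma ncs_scaleAr c f g : c *: (f * g) = f * (c *: g).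
Proof.
apply/funext => w; rewrite ncs_scaleE !ncs_mulE mulr_sumr.
by apply: eq_bigr => i _; rewrite ncs_scaleE mulrCA.
Qed.

HB.instance Definition _ := GRing.Lmodule_isLalgebra.Build K (ncseries K k)
  ncs_scaleAl.
HB.instance Definition _ := GRing.Lalgebra_isAlgebra.Build K (ncseries K k)
  ncs_scaleAr.

Lemma lderE a f w : lder a f w = f (a :: w). Proof. by []. Qed.

Lemma lderD a f g : lder a (f + g) = lder a f + lder a g. Proof. by []. Qed.

Lemma lderZ a c f : lder a (c *: f) = c *: lder a f. Proof. by []. Qed.

Lemma lder1 a : lder a 1 = 0. Proof. by []. Qed.

Lemma lder0 a : lder a 0 = 0. Proof. by []. Qed.

(** The Leibniz rule is twisted: the letter can be taken from [g] only where [f] contributes its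
    constant term. *)
Lemma lderM a f g : lder a (f * g) = f [::] *: lder a g + lder a f * g.
Proof. by apply/funext => w; rewrite lderE ncs_mul_cons. Qed.

Lemma lder_var a b : lder a (ncs_var K b) = (a == b)%:R.
Proof.
apply/funext => w; rewrite /lder /ncs_var eqseq_cons.
by case: (a == b); rewrite ?ncs_oneE.
Qed.

Lemma lder_varM a b f : lder a (ncs_var K b * f) = (a == b)%:R *: f.
Proof.
rewrite lderM [ncs_var _ _ [::]](_ : _ = 0) // scale0r add0r lder_var.
by case: eqP; rewrite ?mul1r ?scale1r ?mul0r ?scale0r.
Qed.

Lemma ncs_ext f g : f [::] = g [::] -> (forall a, lder a f = lder a g) -> f = g.
Proof.
move=> fg0 fg; apply/funext => -[//|a w].
by have /(congr1 (fun h : S => h w)) := fg a.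
Qed.

Lemma lder_sum (I : Type) (r : seq I) (P : pred I) (F : I -> S) a :
  lder a (\sum_(i <- r | P i) F i) = \sum_(i <- r | P i) lder a (F i).
Proof. exact: (big_morph (lder a) (lderD a) (lder0 a)). Qed.

Lemma lder_sum_varM (F : 'I_k -> S) a :
  lder a (\sum_i ncs_var K i * F i) = F a.
Proof.
rewrite lder_sum (bigD1 a) //= lder_varM eqxx scale1r big1 ?addr0 // => i ia.
by rewrite lder_varM eq_sym (negbTE ia) scale0r.
Qed.

Lemma ncs_expand f : f = (f [::])%:A + \sum_i ncs_var K i * lder i f.
Proof.
apply: ncs_ext => [|a].
  rewrite ncs_addE ncs_scaleE ncs_oneE eqxx mulr1 ncs_sumE big1 ?addr0 //.
  by move=> i _; rewrite ncs_mul_nil [ncs_var _ _ [::]](_ : _ = 0) // mul0r.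
by rewrite lderD lderZ lder1 scaler0 add0r lder_sum_varM.
Qed.

(** Congruence modulo words of length at least n. A map that gains one degree for this relation is a
    contraction, which is how series equations are solved below. *)
Definition agree n f g := forall w, (size w < n)%N -> f w = g w.

Lemma agree_refl n f : agree n f f. Proof. by []. Qed.

Lemma agree_le m n f g : (m <= n)%N -> agree n f g -> agree m f g.
Proof. by move=> mn fg w wm; apply: fg; apply: leq_trans mn. Qed.

Lemma agree_eq f g : (forall n, agree n f g) -> f = g.
Proof. by move=> fg; apply/funext => w; apply: (fg (size w).+1). Qed.

Lemma agreeD n f f' g g' :
  agree n f f' -> agree n g g' -> agree n (f + g) (f' + g').
Proof. by move=> ff gg w wn; rewrite !ncs_addE ff ?gg. Qed.

Lemma agreeN n f f' : agree n f f' -> agree n (- f) (- f').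
Proof. by move=> ff w wn; rewrite !ncs_oppE ff. Qed.

Lemma agreeM n f f' g g' :
  agree n f f' -> agree n g g' -> agree n (f * g) (f' * g').
Proof.
move=> ff gg w wn; rewrite !ncs_mulE; apply: eq_bigr => j _.
rewrite ff ?gg //; last by rewrite size_take_min (leq_ltn_trans (geq_minr _ _)).
by rewrite size_drop (leq_ltn_trans (leq_subr _ _)).
Qed.

Lemma agree_sum n (I : Type) (r : seq I) (P : pred I) (F G : I -> S) :
  (forall i, P i -> agree n (F i) (G i)) ->
  agree n (\sum_(i <- r | P i) F i) (\sum_(i <- r | P i) G i).
Proof.
by move=> FG w wn; rewrite !ncs_sumE; apply: eq_bigr => i Pi; apply: FG.
Qed.

Lemma agreeMl n f g g' : f [::] = 0 ->
  agree n g g' -> agree n.+1 (f * g) (f * g').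
Proof.
move=> f0 gg [|a w] wn; first by rewrite !ncs_mul_nil f0 !mul0r.
rewrite !ncs_mul_cons f0 !mul0r !add0r.
exact: (agreeM (@agree_refl n _) gg).
Qed.

Lemma var_nil (i : 'I_k) : ncs_var K i [::] = 0. Proof. by []. Qed.

Lemma contraction_fix (F : S -> S) :
  (forall n f g, agree n f g -> agree n.+1 (F f) (F g)) -> exists f, F f = f.
Proof.
move=> Fc; have it m n : (n <= m)%N -> agree n (iter n F 0) (iter m F 0).
  by elim: m n => [|m IH] [|n] // nm; apply/Fc/IH.
(* The coefficient at [w] no longer changes from the iterate of index [size w + 1] on. *)
exists (fun w => iter (size w).+1 F 0 w); apply/funext => w.
by apply: (Fc (size w) _ (iter (size w) F 0)) => // v vw; apply: it.
Qed.

Lemma contraction_unique (F : S -> S) f g :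
  (forall n f g, agree n f g -> agree n.+1 (F f) (F g)) ->
  F f = f -> F g = g -> f = g.
Proof.
move=> Fc Ff Fg; apply: agree_eq; elim=> [//|n IH].
by rewrite -Ff -Fg; apply: Fc.
Qed.

Lemma mulVs f : f [::] != 0 -> f^-1 * f = 1.
Proof. by move=> f0; rewrite mulVr // ncs_unitE. Qed.

Lemma mulsV f : f [::] != 0 -> f * f^-1 = 1.
Proof. by move=> f0; rewrite mulrV // ncs_unitE. Qed.

Lemma invs_nil f : f [::] != 0 -> f^-1 [::] = (f [::])^-1.
Proof.
move=> f0; apply: (mulfI f0); by rewrite -ncs_mul_nil mulsV // mulfV.
Qed.

(** A right inverse is enough: it forces a nonzero constant term, hence a two-sided inverse. *)
Lemma invs_unique f g : f * g = 1 -> g = f^-1.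
Proof.
move=> fg; have f0 : f [::] != 0.
  have /(congr1 (fun h : S => h [::])) := fg.
  rewrite ncs_mul_nil ncs_oneE eqxx => E.
  by apply: contra_eq_neq E => ->; rewrite mul0r eq_sym oner_eq0.
by rewrite -[LHS]mul1r -(mulVs f0) -mulrA fg mulr1.
Qed.

End SeriesAlgebra.

(** * Substitution of series without constant term *)

Section Substitution.
Variables (K : fieldType) (k : nat).
Local Notation S := (ncseries K k).
Implicit Types (f G : S) (g h : 'I_k -> S) (a : 'I_k) (w : seq 'I_k) (c : K).

Lemma prod_low_degree g (s : seq 'I_k) w : (forall i, g i [::] = 0) ->
  (size w < size s)%N -> (\prod_(j <- s) g j) w = 0.
Proof.
move=> g0; elim: s w => [//|a s IH] w ws.
rewrite big_cons ncs_mulE big1 // => -[[|j] jw] _ /=; first by rewrite take0 g0 mul0r.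
rewrite IH ?mulr0 // size_drop; move: ws jw => /=; lia.
Qed.

Lemma ncs_substE f g w m : (forall i, g i [::] = 0) -> (size w <= m)%N ->
  ncs_subst f g w = \sum_(n < m.+1) \sum_(i : n.-tuple 'I_k)
    f i * (\prod_(j <- i) g j : S) w.
Proof.
move=> g0 wm; pose F n := \sum_(i : n.-tuple 'I_k) f i * (\prod_(j <- i) g j : S) w.
rewrite -[LHS]/(\sum_(n < (size w).+1) F n) -[RHS]/(\sum_(n < m.+1) F n).
rewrite -!(big_mkord xpredT F) (@big_cat_nat _ _ _ (size w).+1 0 m.+1) //=.
rewrite [X in _ = _ + X]big_nat_cond [X in _ = _ + X]big1 ?addr0 //.
move=> n /andP[/andP[wn _] _]; rewrite /F big1 // => s _.
by rewrite prod_low_degree ?mulr0 // size_tuple.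
Qed.

Lemma sum_tupleS (V : nmodType) n (F : seq 'I_k -> V) :
  \sum_(i : n.+1.-tuple 'I_k) F i
  = \sum_(a : 'I_k) \sum_(i : n.-tuple 'I_k) F (a :: i).
Proof.
rewrite pair_big /=.
rewrite (reindex (fun p : 'I_k * n.-tuple 'I_k => [tuple of p.1 :: p.2])) //=.
exists (fun t : n.+1.-tuple 'I_k => (thead t, [tuple of behead t])) => [[a i] _|t _] /=.
  by congr pair; apply/val_inj.
by rewrite -tuple_eta.
Qed.

(** Horner form of substitution. With [subst_rec_unique] it replaces the sum over tuples in the
    proofs of multiplicativity and of composition. *)
Lemma ncs_subst_rec f g : (forall i, g i [::] = 0) ->
  ncs_subst f g = (f [::])%:A + \sum_i g i * ncs_subst (lder i f) g.
Proof.
move=> g0; apply/funext => w.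
rewrite (ncs_substE f g0 (leqnn _)) big_ord_recl.
rewrite ncs_addE ncs_scaleE; congr (_ + _).
  rewrite (bigD1 [tuple]) //= [X in _ + X = _]big1 ?addr0 ?big_nil // => t.
  by rewrite [t]tuple0 => /eqP.
pose F (s : seq 'I_k) := f s * (\prod_(j <- s) g j : S) w.
transitivity (\sum_(n < size w) \sum_(a < k) \sum_(t : n.-tuple 'I_k) F (a :: t)).
  by apply: eq_bigr => n _; exact: (sum_tupleS n F).
rewrite ncs_sumE exchange_big; apply: eq_bigr => a _ /=; rewrite /F.
transitivity (\sum_(n < size w) \sum_(j < (size w).+1) \sum_(t : n.-tuple 'I_k)
    g a (take j w) * (lder a f t * (\prod_(l <- t) g l : S) (drop j w))).
  apply: eq_bigr => n _; rewrite exchange_big; apply: eq_bigr => t _ /=.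
  rewrite big_cons ncs_mulE mulr_sumr; apply: eq_bigr => j _.
  by rewrite mulrCA.
rewrite exchange_big ncs_mulE; apply: eq_bigr => j _ /=.
(* The term j = 0 vanishes because [g a] has no constant term. For j > 0 the remaining suffix is
   shorter than [w], so cutting the degree at [size w] loses nothing. *)
case: j => -[|j] jw /=; first by rewrite take0 g0 mul0r big1 // => n _; rewrite big1 // => t _; rewrite mul0r.
case: w @F jw => [//|b w] _ jw.
rewrite (@ncs_substE _ _ _ (size w)) // ?mulr_sumr.
  by apply: eq_bigr => n _; rewrite mulr_sumr.
by rewrite /= size_drop leq_subr.
Qed.

(** Each [g i] raises the degree by one, so the recursion determines the operator, even though
    [lder i f] is no smaller than [f]. *)
Lemma subst_rec_unique g (C : S -> S) (U V : S -> S) : (forall i, g i [::] = 0) ->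
  (forall f, U f = C f + \sum_i g i * U (lder i f)) ->
  (forall f, V f = C f + \sum_i g i * V (lder i f)) ->
  forall f, U f = V f.
Proof.
move=> g0 UE VE f; apply: agree_eq => n; elim: n f => [//|n IH] f.
rewrite UE VE; apply: agreeD => //; apply: agree_sum => i _.
exact: agreeMl.
Qed.

Lemma ncs_subst_nil f g : (forall i, g i [::] = 0) -> ncs_subst f g [::] = f [::].
Proof.
move=> g0; rewrite ncs_subst_rec // ncs_addE ncs_scaleE ncs_oneE mulr1 ncs_sumE.
by rewrite big1 ?addr0 // => i _; rewrite ncs_mul_nil g0 mul0r.
Qed.

Lemma ncs_substD f f' g : (forall i, g i [::] = 0) ->
  ncs_subst (f + f') g = ncs_subst f g + ncs_subst f' g.
Proof.
move=> g0; apply/funext => w; rewrite ncs_addE /ncs_subst -big_split.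
apply: eq_bigr => n _; rewrite -big_split; apply: eq_bigr => t _ /=.
by rewrite ncs_addE mulrDl.
Qed.

Lemma ncs_substZ c f g : ncs_subst (c *: f) g = c *: ncs_subst f g.
Proof.
apply/funext => w; rewrite ncs_scaleE /ncs_subst mulr_sumr.
apply: eq_bigr => n _; rewrite mulr_sumr; apply: eq_bigr => t _ /=.
by rewrite ncs_scaleE mulrA.
Qed.

Lemma ncs_subst0 g : ncs_subst 0 g = 0.
Proof. by rewrite -(scale0r (0 : S)) ncs_substZ !scale0r. Qed.

Lemma ncs_substN f g : ncs_subst (- f) g = - ncs_subst f g.
Proof. by rewrite -scaleN1r ncs_substZ scaleN1r. Qed.

Lemma ncs_subst_sum (I : Type) (r : seq I) (P : pred I) (F : I -> S) g :
  (forall i, g i [::] = 0) ->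
  ncs_subst (\sum_(i <- r | P i) F i) g = \sum_(i <- r | P i) ncs_subst (F i) g.
Proof.
move=> g0; apply: (big_morph (fun f => ncs_subst f g)) => [f f'|].
  exact: ncs_substD.
exact: ncs_subst0.
Qed.

Lemma ncs_subst1 g : (forall i, g i [::] = 0) -> ncs_subst 1 g = 1.
Proof.
move=> g0; rewrite ncs_subst_rec // big1 ?addr0 => [|i _].
  by rewrite ncs_oneE eqxx scale1r.
by rewrite lder1 ncs_subst0 mulr0.
Qed.

Lemma ncs_substM f f' g : (forall i, g i [::] = 0) ->
  ncs_subst (f * f') g = ncs_subst f g * ncs_subst f' g.
Proof.
move=> g0; move: f.
apply: (@subst_rec_unique g (fun f : S => f [::] *: ncs_subst f' g)) => // f; last first.
  rewrite {1}(ncs_subst_rec f) // mulrDl -scalerAl mul1r mulr_suml.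
  by congr (_ + _); apply: eq_bigr => i _; rewrite mulrA.
rewrite ncs_subst_rec // ncs_mul_nil.
under eq_bigr do rewrite lderM ncs_substD // ncs_substZ mulrDr -scalerAr.
rewrite big_split /= addrA -scaler_sumr -scalerA -scalerDr.
by rewrite -(ncs_subst_rec f').
Qed.

Lemma ncs_subst_var g a : (forall i, g i [::] = 0) ->
  ncs_subst (ncs_var K a) g = g a.
Proof.
move=> g0; rewrite ncs_subst_rec // var_nil scale0r add0r (bigD1 a) //=.
rewrite lder_var eqxx ncs_subst1 // mulr1 big1 ?addr0 // => i ia.
by rewrite lder_var (negbTE ia) ncs_subst0 mulr0.
Qed.

Lemma ncs_subst_inv f g : (forall i, g i [::] = 0) -> f [::] != 0 ->
  ncs_subst f^-1 g = (ncs_subst f g)^-1.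
Proof.
by move=> g0 f0; apply: invs_unique; rewrite -ncs_substM // mulsV // ncs_subst1.
Qed.

Lemma ncs_subst_comp f g h : (forall i, g i [::] = 0) -> (forall i, h i [::] = 0) ->
  ncs_subst (ncs_subst f g) h = ncs_subst f (fun i => ncs_subst (g i) h).
Proof.
move=> g0 h0; have gh0 i : ncs_subst (g i) h [::] = 0 by rewrite ncs_subst_nil.
move: f; apply: (subst_rec_unique (g := fun i => ncs_subst (g i) h)
    (C := fun f : S => (f [::])%:A)) => // f; last exact: ncs_subst_rec.
  rewrite {1}(ncs_subst_rec f) // ncs_substD // ncs_substZ ncs_subst1 // ncs_subst_sum //.
  by congr (_ + _); apply: eq_bigr => i _; rewrite ncs_substM.
Qed.

Definition var_mul (G : S) : 'I_k -> S := fun i => ncs_var K i * G.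

Lemma var_mul_nil G i : var_mul G i [::] = 0.
Proof. by rewrite /var_mul ncs_mul_nil var_nil mul0r. Qed.

Lemma ncs_subst_var_mul_nil f G : ncs_subst f (var_mul G) [::] = f [::].
Proof. by rewrite ncs_subst_nil //; apply: var_mul_nil. Qed.

Lemma lder_subst_var_mul f G a :
  lder a (ncs_subst f (var_mul G)) = G * ncs_subst (lder a f) (var_mul G).
Proof.
rewrite ncs_subst_rec; last exact: var_mul_nil.
rewrite lderD lderZ lder1 scaler0 add0r.
by under eq_bigr do rewrite -mulrA; rewrite lder_sum_varM.
Qed.

Lemma agree_subst_var_mul n f G G' : agree n G G' ->
  agree n.+1 (ncs_subst f (var_mul G)) (ncs_subst f (var_mul G')).
Proof.
elim: n f => [|n IH] f GG [|a w] wn //; rewrite ?ncs_subst_var_mul_nil //.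
rewrite -!lderE !lder_subst_var_mul; apply: (agreeM (n := n.+1)) wn => //.
exact/IH/(agree_le (leqnSn n)).
Qed.

(** As [G] has constant term 1, replacing z_i by z_i G changes a series only above its lowest
    degree. Injectivity and surjectivity of the substitution both rest on this. *)
Lemma agree_subst_id n f G : G [::] = 1 -> agree n f 0 ->
  agree n.+1 (ncs_subst f (var_mul G)) f.
Proof.
move=> G1; elim: n f => [|n IH] f f0 [|a w] wn //; rewrite ?ncs_subst_var_mul_nil //.
rewrite -lderE lder_subst_var_mul -[RHS](lderE a f).
have f0' : agree n (lder a f) 0 by move=> v vn; apply: f0.
rewrite (agreeM (@agree_refl _ _ n.+1 G) (IH _ f0')) //.
rewrite -[G](@subrK S 1) mulrDl mul1r ncs_addE (@agreeMl _ _ n _ _ 0) //.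
  by rewrite mulr0 ncs_zeroE add0r.
by rewrite ncs_addE ncs_oppE G1 ncs_oneE subrr.
Qed.

Lemma ncs_subst_inj G : G [::] = 1 ->
  injective (fun f => ncs_subst f (var_mul G)).
Proof.
move=> G1 f f' ff'; suff E n : agree n (f - f') 0.
  by apply/funext => w; apply/eqP; rewrite -subr_eq0 -ncs_oppE -ncs_addE (E (size w).+1).
elim: n => [//|n IH] w wn; rewrite -(agree_subst_id G1 IH) //.
rewrite ncs_substD; last exact: var_mul_nil.
by rewrite ncs_substN ff' subrr.
Qed.

Lemma ncs_subst_surj G (h : S) : G [::] = 1 ->
  exists f, ncs_subst f (var_mul G) = h.
Proof.
(* A fixed point of this map is a preimage of [h]; the map is contractive because substitution minus
   identity raises the degree. *)
move=> G1; have [|f ff] := @contraction_fix K k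
    (fun f => h - (ncs_subst f (var_mul G) - f)).
  move=> n f g fg; apply: agreeD => //; apply: agreeN => w wn.
  have fg0 : agree n (f - g) 0.
    by move=> v vn; rewrite ncs_addE ncs_oppE fg // subrr.
  have := agree_subst_id G1 fg0 wn.
  rewrite ncs_substD; last exact: var_mul_nil.
  rewrite ncs_substN !ncs_addE !ncs_oppE => E.
  by rewrite -[ncs_subst f _ w](subrK (ncs_subst g (var_mul G) w)) E; ring.
exists f; apply/eqP; rewrite eq_sym -subr_eq0; apply/eqP.
by move: ff; rewrite opprB addrCA addrC => /(canRL (addrK _)); rewrite subrr.
Qed.

End Substitution.

(** * Distributions as series, and the bijections given by the eta-series and the R-transform *)

Section Functionals.
Variables (R : realType) (k : nat).
Local Notation C := R[i].
Local Notation S := (ncseries C k).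
Implicit Types (mu nu rho : dalg R k).

Lemma malgUM (w v : seq 'I_k) :
  << FMonom w >> * << FMonom v >> = << FMonom (w ++ v) >> :> ncpoly R k.
Proof.
rewrite malgM_def fgmulUU mulr1; congr (<< _ *g _ >>).
by apply/val_inj; rewrite /= fmM.
Qed.

Lemma prod_ncX (w : seq 'I_k) :
  \prod_(i <- w) ncX R i = << FMonom w >> :> ncpoly R k.
Proof.
elim: w => [|i w IH].
  rewrite big_nil; congr (<< _ *g _ >>); apply/val_inj.
  by rewrite /= fm1.
by rewrite big_cons IH /ncX fmuE malgUM.
Qed.

Lemma ncpoly_expand (p : ncpoly R k) :
  p = \sum_(m <- msupp p) p@_m *: \prod_(i <- (m : seq 'I_k)) ncX R i.
Proof.
rewrite {1}[p]monalgE; apply: eq_bigr => m _; rewrite prod_ncX.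
apply/malgP => n; rewrite mcoeffZ !mcoeffU fmK.
by case: eqP; rewrite ?mulr1 ?mulr0 ?mulr1n ?mulr0n.
Qed.

Lemma scalar_eq (V : lmodType C) (f g : {scalar V}) : f =1 g -> f = g.
Proof.
case: f g => f [[fp] [fq]] [g [[gp] [gq]]] /= /funext fg.
by move: fp fq gp gq; rewrite fg => *; congr GRing.Linear.Pack; congr GRing.Linear.Class; congr (_ _); apply: Prop_irrelevance.
Qed.

Lemma dalg_eq mu nu :
  (forall w, mu (\prod_(i <- w) ncX R i) = nu (\prod_(i <- w) ncX R i)) -> mu = nu.
Proof.
move=> mn; have E : dalg_fun mu = dalg_fun nu.
  apply: scalar_eq => p; rewrite [p]ncpoly_expand !linear_sum.
  by apply: eq_bigr => m _; rewrite !linearZ mn.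
case: mu nu E {mn} => f f1 [g g1] /= fg; move: f1 g1; rewrite fg => f1 g1.
by congr DAlg; apply: Prop_irrelevance.
Qed.

Definition series_functional (f : S) (p : ncpoly R k) : C :=
  \sum_(m <- msupp p) p@_m * f (m : seq 'I_k).

Lemma series_functionalE (f : S) (p : ncpoly R k) :
  series_functional f p = mmap idfun (fun m : {fmonom 'I_k} => f m) p.
Proof. by []. Qed.

Fact series_functional_linear (f : S) : scalar (series_functional f).
Proof.
move=> c p q; rewrite !series_functionalE raddfD /=; congr (_ + _).
rewrite (mmapEw (msuppZ_le _ _)) mmapE /= mulr_sumr.
by apply: eq_bigr => m _; rewrite mcoeffZ mulrA.
Qed.

HB.instance Definition _ (f : S) := GRing.isLinear.Build C (ncpoly R k) C *%R
  (series_functional f) (series_functional_linear f).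

Lemma series_functional_word (f : S) w :
  series_functional f (\prod_(i <- w) ncX R i) = f w.
Proof.
by rewrite series_functionalE prod_ncX mmapU /= mul1r.
Qed.

Lemma series_functional1 (f : S) : f [::] = 1 -> series_functional f 1 = 1.
Proof.
by move=> f1; have := series_functional_word f [::]; rewrite big_nil f1.
Qed.

(** The moment series including its constant term 1. In these terms the eta-series is one minus an
    inverse, and the R-transform solves R(z G) = G - 1. *)
Definition gser mu : S := fun w => mu (\prod_(i <- w) ncX R i).

Lemma gserE mu : gser mu = 1 + moment_series mu.
Proof.
apply/funext => -[|a w]; rewrite ncs_addE ncs_oneE /gser /=.
  by rewrite big_nil dalg1 addr0.
by rewrite add0r.
Qed.

Lemma gser_nil mu : gser mu [::] = 1.
Proof. by rewrite /gser big_nil dalg1. Qed.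

Lemma gser_inj : injective gser.
Proof.
by move=> mu nu mn; apply: dalg_eq => w; have /(congr1 (fun f : S => f w)) := mn.
Qed.

Lemma gser_surj (f : S) : f [::] = 1 -> exists mu, gser mu = f.
Proof.
move=> f1; exists (@DAlg R k (series_functional f) (series_functional1 f1)).
by apply/funext => w; apply: series_functional_word.
Qed.

Lemma moment_seriesE mu : moment_series mu = gser mu - 1.
Proof. by rewrite gserE addrC addKr. Qed.

Lemma eta_seriesE mu : eta_series mu = 1 - (gser mu)^-1.
Proof.
rewrite /eta_series -gserE moment_seriesE mulrBl mul1r mulsV //.
by rewrite gser_nil oner_eq0.
Qed.

Lemma eta_series_eq mu (e : S) : e [::] = 0 ->
  eta_series mu = e <-> gser mu = (1 - e)^-1.
Proof.
move=> e0; rewrite eta_seriesE; split => [<-|->].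
  by rewrite subKr invrK.
by rewrite invrK subKr.
Qed.

Lemma eta_series_nil mu : eta_series mu [::] = 0.
Proof.
rewrite eta_seriesE ncs_addE ncs_oppE invs_nil ?gser_nil ?oner_eq0 //.
by rewrite invr1 ncs_oneE subrr.
Qed.

Lemma eta_series_inj : injective (@eta_series R k).
Proof.
move=> mu nu /(eta_series_eq _ (eta_series_nil nu)) E; apply: gser_inj.
by rewrite E; apply/esym/eta_series_eq => //; apply: eta_series_nil.
Qed.

Lemma eta_series_surj (e : S) : e [::] = 0 -> exists mu, eta_series mu = e.
Proof.
move=> e0; have E : (1 - e) [::] = 1 by rewrite ncs_addE ncs_oppE e0 subr0.
have [|mu mE] := @gser_surj (1 - e)^-1; first by rewrite invs_nil E ?invr1 ?oner_eq0.
by exists mu; apply/eta_series_eq.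
Qed.

Definition Phi_eta (G : S) : S := \sum_(i < k) ncs_var _ i * G * ncs_var _ i.

Lemma Phi_eta_nil G : Phi_eta G [::] = 0.
Proof.
rewrite /Phi_eta ncs_sumE big1 // => i _; rewrite !ncs_mul_nil.
by rewrite var_nil mulr0.
Qed.

Lemma Phi_unique sigma rho : eta_series rho = Phi_eta (gser sigma) -> Phi sigma = rho.
Proof.
rewrite gserE => rhoE; apply: xget_unique => // y /= yE.
by apply: eta_series_inj; rewrite yE rhoE.
Qed.

Lemma eta_series_Phi sigma : eta_series (Phi sigma) = Phi_eta (gser sigma).
Proof.
have [rho rhoE] := eta_series_surj (Phi_eta_nil (gser sigma)).
by rewrite (Phi_unique rhoE).
Qed.

Lemma boolean_power_unique mu rho (t : R) :
  eta_series rho = t%:C%C *: eta_series mu -> boolean_power mu t = rho.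
Proof.
move=> rhoE; apply: xget_unique => // y /= yE.
by apply: eta_series_inj; rewrite yE rhoE.
Qed.

Lemma R_transform_eq mu r : r [::] = 0 ->
  ncs_subst r (var_mul (gser mu)) = gser mu - 1 -> R_transform mu = r.
Proof.
move=> r0 rE; apply: xget_unique => [|r' [r'0]] /=.
  by rewrite -gserE moment_seriesE.
rewrite -gserE moment_seriesE -rE; exact: ncs_subst_inj (gser_nil mu) _ _.
Qed.

Lemma R_transform_spec mu : R_transform mu [::] = 0 /\
  ncs_subst (R_transform mu) (var_mul (gser mu)) = gser mu - 1.
Proof.
have [r rE] := ncs_subst_surj (gser mu - 1) (gser_nil mu).
have r0 : r [::] = 0.
  have /(congr1 (fun f : S => f [::])) := rE.
  by rewrite ncs_subst_var_mul_nil ncs_addE ncs_oppE gser_nil ncs_oneE subrr.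
by rewrite (R_transform_eq r0 rE).
Qed.

(** For a given R, the series G = 1 + R(z G) is the fixed point of a contraction, so R determines
    the moments. *)
Lemma R_transform_inj : injective (@R_transform R k).
Proof.
move=> mu nu E; apply: gser_inj.
pose F (G : S) := 1 + ncs_subst (R_transform nu) (var_mul G).
apply: (@contraction_unique _ _ F) => [n f g fg||].
- by apply: agreeD => //; apply: agree_subst_var_mul.
- by rewrite /F -E (R_transform_spec mu).2 addrC subrK.
- by rewrite /F (R_transform_spec nu).2 addrC subrK.
Qed.

Lemma free_power_unique mu rho (t : R) :
  R_transform rho = t%:C%C *: R_transform mu -> free_power mu t = rho.
Proof.
move=> rhoE; apply: xget_unique => // y /= yE.
by apply: R_transform_inj; rewrite yE rhoE.
Qed.

End Functionals.

(** * From the subordination equation to the identity for [Phi] *)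

Section Subordination.
Variables (R : realType) (k : nat).
Local Notation C := R[i].
Local Notation S := (ncseries C k).
Implicit Types (mu nu rho sigma : dalg R k) (t : R).

(** Evaluating the R-transform equation of [Phi nu] at z H turns its inner arguments into z P, where
    P is the moment series of the expected free power. It then becomes the R-transform equation of
    that free power, up to the factor 1 + t. *)
Lemma Phi_BB nu sigma t (H : S) : 0 < t ->
  H * (1 - t%:C%C *: Phi_eta (gser sigma)) = 1 ->
  gser sigma = H * ncs_subst (gser nu) (var_mul H) ->
  Phi sigma = BB t (Phi nu).
Proof.
move=> t0 HE GE; set z := Phi_eta (gser sigma) in HE *.
set c := t%:C%C in HE *.
have c1 : (1 + t)%:C%C = 1 + c :> C by rewrite raddfD.
have cn0 : 1 + c != 0.
  by rewrite -c1 -(rmorph0 (real_complex R)) (inj_eq (@complexI _)) gt_eqF // addr_gt0.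
have z0 : z [::] = 0 by apply: Phi_eta_nil.
(* The candidate for the free power is forced: its Boolean power 1 / (1 + t) must have eta-series
   [z]. *)
have [rho rhoE] : exists rho : dalg R k, eta_series rho = (1 + c) *: z.
  by apply: eta_series_surj; rewrite ncs_scaleE z0 mulr0.
have PE := (eta_series_eq rho (_ : ((1 + c) *: z) [::] = 0)).
have zn : ((1 + c) *: z) [::] = 0 by rewrite ncs_scaleE z0 mulr0.
have {PE} PE := (PE zn).1 rhoE; set P := gser rho in PE.
have P0 : P [::] != 0 by rewrite /P gser_nil oner_eq0.
have PV : P^-1 = 1 - (1 + c) *: z by rewrite PE invrK.
have H0 : H [::] != 0.
  have /(congr1 (fun f : S => f [::])) := HE.
  rewrite ncs_mul_nil ncs_addE ncs_oppE ncs_scaleE z0 mulr0 subr0 mulr1.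
  by move=> ->; rewrite ncs_oneE oner_eq0.
have HV : H^-1 = 1 - c *: z by rewrite -(invs_unique HE).
pose w := var_mul H; have w0 : forall i, w i [::] = 0 by apply: var_mul_nil.
have etaE : ncs_subst (Phi_eta (gser nu)) w = z * H.
  rewrite /Phi_eta ncs_subst_sum // /z /Phi_eta mulr_suml; apply: eq_bigr => i _.
  rewrite !ncs_substM // ncs_subst_var // /w /var_mul -!mulrA; congr (_ * _).
  by rewrite mulrA -GE.
have GmuE : ncs_subst (gser (Phi nu)) w = H^-1 * P.
  have -> : gser (Phi nu) = (1 - Phi_eta (gser nu))^-1.
    by apply/eta_series_eq; [apply: Phi_eta_nil | apply: eta_series_Phi].
  rewrite ncs_subst_inv ?ncs_addE ?ncs_oppE ?Phi_eta_nil ?subr0 ?oner_eq0 //.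
  rewrite ncs_substD // ncs_substN ncs_subst1 // etaE.
  apply/esym/invs_unique.
  (* Indeed H^-1 - z = 1 - (1 + c) z = P^-1; multiply by H on the right. *)
  have -> : 1 - z * H = P^-1 * H.
    rewrite -(mulVs H0) HV PV -mulrBl -addrA -opprD; congr ((1 - _) * _).
    by rewrite scalerDl scale1r addrC.
  by rewrite -mulrA (mulrA H) mulsV // mul1r mulVs.
have [r0 rE] := R_transform_spec (Phi nu).
have {rE} := congr1 (fun f => ncs_subst f w) rE.
rewrite /= ncs_subst_comp //; last exact: var_mul_nil.
rewrite ncs_substD // ncs_substN ncs_subst1 // GmuE.
(* Here z_i H H^-1 P = z_i P: the factor H is cancelled in every argument of the R-transform. *)
have -> : (fun i => ncs_subst (var_mul (gser (Phi nu)) i) w) = var_mul P.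
  apply/funext => i; rewrite /var_mul ncs_substM // ncs_subst_var // GmuE.
  by rewrite /w /var_mul -mulrA (mulrA H) mulsV // mul1r.
move=> rE.
have RE : R_transform rho = (1 + c) *: R_transform (Phi nu).
  apply: R_transform_eq; first by rewrite ncs_scaleE r0 mulr0.
  rewrite ncs_substZ rE HV scalerBr scalerAl.
  (* With H^-1 = 1 - c z, this yields (1 + c) (H^-1 P - 1) = (P + c) - (1 + c) = P - 1. *)
  have -> : (1 + c) *: (1 - c *: z) = 1 + c *: P^-1.
    rewrite PV !scalerBr !scalerA (mulrC c) addrA; congr (_ - _).
    by rewrite scalerDl scale1r.
  rewrite mulrDl mul1r -scalerAl mulVs // scalerDl scale1r -/P.
  by rewrite opprD addrA addrAC addrK.
rewrite /BB (free_power_unique (rho := rho)) ?c1 //.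
apply/esym/boolean_power_unique.
rewrite eta_series_Phi -/z rhoE scalerA.
have -> : (1 / (1 + t))%:C%C = (1 + c)^-1 :> C.
  by rewrite div1r fmorphV /= c1.
by rewrite mulVf // scale1r.
Qed.

End Subordination.

(** * The algebra of linear endomorphisms of a space of series *)

Section LinearEndomorphisms.
Variables (K : fieldType) (k : nat).
Local Notation W := (ncseries K k).

(* Composition is in diagrammatic order: [T * U] applies [T] first. *)
Record lend := Lend { lend_fun :> W -> W; lend_linear : linear lend_fun }.

HB.instance Definition _ := gen_eqMixin lend.
HB.instance Definition _ := gen_choiceMixin lend.

Lemma lend_eq (T U : lend) : T =1 U -> T = U.
Proof.
case: T U => [f fl] [g gl] /= /funext E; move: fl gl; rewrite E => fl gl.
by congr Lend; apply: Prop_irrelevance.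
Qed.

Lemma lendD (T : lend) : {morph T : f g / f + g}.
Proof. by move=> f g; have := lend_linear T 1 f g; rewrite !scale1r. Qed.

Lemma lend0 (T : lend) : T 0 = 0.
Proof. by have := lend_linear T (-1) 0 0; rewrite !scaleN1r addNr addNr. Qed.

Lemma lendZ (T : lend) c f : T (c *: f) = c *: T f.
Proof. by have := lend_linear T c f 0; rewrite lend0 !addr0. Qed.

Fact lend_zero_linear : linear (fun _ : W => 0 : W).
Proof. by move=> c f g; rewrite scaler0 addr0. Qed.

Fact lend_opp_linear (T : lend) : linear (fun f => - T f).
Proof. by move=> c f g; rewrite lendD lendZ opprD scalerN. Qed.

Fact lend_add_linear (T U : lend) : linear (fun f => T f + U f).
Proof. by move=> c f g; rewrite !lendD !lendZ scalerDr addrACA. Qed.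

Fact lend_scale_linear (a : K) (T : lend) : linear (fun f => a *: T f).
Proof.
by move=> c f g; rewrite lendD lendZ scalerDr !scalerA [c * a]mulrC.
Qed.

Fact lend_one_linear : linear (fun f : W => f). Proof. by []. Qed.

Fact lend_mul_linear (T U : lend) : linear (fun f => U (T f)).
Proof. by move=> c f g; rewrite !lendD !lendZ. Qed.

Definition lend_zero := Lend lend_zero_linear.
Definition lend_opp T := Lend (lend_opp_linear T).
Definition lend_add T U := Lend (lend_add_linear T U).
Definition lend_scale a T := Lend (lend_scale_linear a T).
Definition lend_one := Lend lend_one_linear.
Definition lend_mul T U := Lend (lend_mul_linear T U).

Fact lend_addA : associative lend_add.
Proof. by move=> T U X; apply: lend_eq => f /=; rewrite addrA. Qed.
Fact lend_addC : commutative lend_add.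
Proof. by move=> T U; apply: lend_eq => f /=; rewrite addrC. Qed.
Fact lend_add0 : left_id lend_zero lend_add.
Proof. by move=> T; apply: lend_eq => f /=; rewrite add0r. Qed.
Fact lend_addN : left_inverse lend_zero lend_opp lend_add.
Proof. by move=> T; apply: lend_eq => f /=; rewrite addNr. Qed.

HB.instance Definition _ := GRing.isZmodule.Build lend
  lend_addA lend_addC lend_add0 lend_addN.

Fact lend_scaleA a b T : lend_scale a (lend_scale b T) = lend_scale (a * b) T.
Proof. by apply: lend_eq => f /=; rewrite scalerA. Qed.
Fact lend_scale1 : left_id 1 lend_scale.
Proof. by move=> T; apply: lend_eq => f /=; rewrite scale1r. Qed.
Fact lend_scaleDr : right_distributive lend_scale +%R.
Proof. by move=> a T U; apply: lend_eq => f /=; rewrite scalerDr. Qed.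
Fact lend_scaleDl T : {morph lend_scale^~ T : a b / a + b}.
Proof. by move=> a b; apply: lend_eq => f /=; rewrite scalerDl. Qed.

HB.instance Definition _ := GRing.Zmodule_isLmodule.Build K lend
  lend_scaleA lend_scale1 lend_scaleDr lend_scaleDl.

Fact lend_mulA : associative lend_mul.
Proof. by move=> T U X; apply: lend_eq. Qed.
Fact lend_mul1 : left_id lend_one lend_mul.
Proof. by move=> T; apply: lend_eq. Qed.
Fact lend_mul_1 : right_id lend_one lend_mul.
Proof. by move=> T; apply: lend_eq. Qed.
Fact lend_mulDl : left_distributive lend_mul +%R.
Proof. by move=> T U X; apply: lend_eq => f /=; rewrite lendD. Qed.
Fact lend_mulDr : right_distributive lend_mul +%R.
Proof. by move=> T U X; apply: lend_eq. Qed.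
Fact lend_one_neq0 : lend_one != 0.
Proof.
apply/eqP => /(congr1 (fun T : lend => T 1)) /= /eqP.
by rewrite oner_eq0.
Qed.

HB.instance Definition _ := GRing.Zmodule_isNzRing.Build lend
  lend_mulA lend_mul1 lend_mul_1 lend_mulDl lend_mulDr lend_one_neq0.

Fact lend_scaleAl a (T U : lend) : a *: (T * U) = (a *: T) * U.
Proof. by apply: lend_eq => f /=; rewrite lendZ. Qed.

HB.instance Definition _ := GRing.Lmodule_isLalgebra.Build K lend lend_scaleAl.

Fact lend_scaleAr a (T U : lend) : a *: (T * U) = T * (a *: U).
Proof. by apply: lend_eq. Qed.

HB.instance Definition _ := GRing.Lalgebra_isAlgebra.Build K lend lend_scaleAr.

Lemma lend_mulE (T U : lend) f : (T * U) f = U (T f). Proof. by []. Qed.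
Lemma lend_oneE f : (1 : lend) f = f. Proof. by []. Qed.
Lemma lend_addE (T U : lend) f : (T + U) f = T f + U f. Proof. by []. Qed.
Lemma lend_scaleE a (T : lend) f : (a *: T) f = a *: T f. Proof. by []. Qed.

End LinearEndomorphisms.
Arguments lend_eq {K k T U}.

(** * Closure and induction for generated unital subalgebras *)

Section GeneratedSubalgebra.
Variables (R : realType) (A : ncps R).
Implicit Types (S P : set A).

Lemma gen_subalg_ind S P : P 1 ->
  (forall c a b, P a -> P b -> P (c *: a + b)) ->
  (forall a b, P a -> P b -> P (a * b)) ->
  (forall a, S a -> P a) -> forall a, gen_subalg S a -> P a.
Proof.
move=> P1 PD PM SP a; apply; split => //; split.
- by rewrite inE.
- by move=> c u v; rewrite !inE; apply: PD.
- by move=> u v; rewrite !inE; apply: PM.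
Qed.

Lemma gen_subalg_sub S a : S a -> gen_subalg S a.
Proof. by move=> Sa B [_]; apply. Qed.

Lemma gen_subalg1 S : gen_subalg S 1.
Proof. by move=> B [[+ _ _] _]; rewrite inE. Qed.

Lemma gen_subalgM S a b : gen_subalg S a -> gen_subalg S b -> gen_subalg S (a * b).
Proof.
move=> Sa Sb B BS; case: (BS) => [[_ _ /(_ a b) +] _].
by rewrite !inE; apply; [apply: Sa | apply: Sb].
Qed.

Lemma gen_subalgD S c a b :
  gen_subalg S a -> gen_subalg S b -> gen_subalg S (c *: a + b).
Proof.
move=> Sa Sb B BS; case: (BS) => [[_ /(_ c a b) + _] _].
by rewrite !inE; apply; [apply: Sa | apply: Sb].
Qed.

End GeneratedSubalgebra.

(** * An algebraic Fock-type model of [nu] together with a free semicircular family *)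

Section Model.
Variables (R : realType) (k : nat) (nu : dalg R k) (t : R).
Local Notation C := R[i].
Local Notation S := (ncseries C k).
Local Notation W := (ncseries C (k + k)).
Local Notation E := (lend C (k + k)).
Implicit Types (g : S) (f h : W) (i j : 'I_k).

(* The letters [xl i] are the variables of [nu]; the letters [el i] are the ones
   that the semicircular operators create and annihilate. *)
Definition xl i : 'I_(k + k) := lshift k i.
Definition el i : 'I_(k + k) := rshift k i.

Lemma eq_el i j : (el i == el j) = (i == j). Proof. exact: eq_rshift. Qed.
Lemma eq_xel i j : (xl i == el j) = false. Proof. exact: eq_lrshift. Qed.
Lemma letterP (l : 'I_(k + k)) : (exists i, l = xl i) \/ (exists i, l = el i).
Proof. by rewrite -(splitK l); case: (fintype.split l) => i; [left|right]; exists i. Qed.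

Fixpoint xword (w : seq 'I_(k + k)) : option (seq 'I_k) :=
  if w is l :: w' then
    if fintype.split l is inl i then omap (cons i) (xword w') else None
  else Some [::].

Definition emb g : W := fun w : seq _ => if xword w is Some v then g v else 0.

Lemma emb_nil g : emb g [::] = g [::]. Proof. by []. Qed.

Lemma lder_x_emb g i : lder (xl i) (emb g) = emb (lder i g).
Proof.
apply/funext => w; rewrite lderE /emb /= /xl (unsplitK (inl i : 'I_k + 'I_k)).
by case: (xword w).
Qed.

Lemma lder_e_emb g i : lder (el i) (emb g) = 0.
Proof.
by apply/funext => w; rewrite lderE /emb /= /el (unsplitK (inr i : 'I_k + 'I_k)).
Qed.

(** The vacuum is the moment series of [nu] itself: deriving along the letters of [w] and reading
    the constant term gives nu(w). *)
Definition model_vac : W := emb (gser nu).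
Local Notation N := model_vac.

Lemma vac_nil : N [::] = 1. Proof. exact: gser_nil. Qed.

Lemma lder_e_vac i : lder (el i) N = 0. Proof. exact: lder_e_emb. Qed.

Local Notation c := (t%:C%C : C).
Local Notation z l := (ncs_var C l).

Lemma lder_eNM i f : lder (el i) (N * f) = lder (el i) f.
Proof. by rewrite lderM vac_nil scale1r lder_e_vac mul0r addr0. Qed.

Fact xop_linear i : linear (lder (xl i) : W -> W).
Proof. by move=> a f h; rewrite lderD lderZ. Qed.

Definition xop i : E := Lend (@xop_linear i).

(** Creation multiplies by [N * z (el i)] instead of [z (el i)]: it puts a fresh copy of the vacuum
    in front, on which the next [xop] act. This is what makes the two families free. *)
Fact sop_linear i : linear (fun f : W => lder (el i) f + c *: (N * z (el i) * f)).
Proof.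
move=> a f h; rewrite lderD lderZ mulrDr -scalerAr !scalerDr !scalerA.
by rewrite [c * a]mulrC addrACA.
Qed.

Definition sop i : E := Lend (@sop_linear i).

Lemma xopE i f : xop i f = lder (xl i) f. Proof. by []. Qed.
Lemma sopE i f : sop i f = lder (el i) f + c *: (N * z (el i) * f).
Proof. by []. Qed.

Definition model_state (T : E) : C := T N [::].

Fact model_state_linear : scalar model_state. Proof. by []. Qed.

HB.instance Definition _ := GRing.isLinear.Build C E C *%R
  model_state model_state_linear.

Lemma model_state1 : model_state 1 = 1. Proof. exact: vac_nil. Qed.

Definition model : ncps R := NCPS model_state1.

Lemma model_stateE (T : E) : ncps_state model T = T N [::]. Proof. by []. Qed.

Lemma lend_prod_cons (I : Type) (F : I -> E) a s f :
  (\prod_(i <- a :: s) F i) f = (\prod_(i <- s) F i) (F a f).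
Proof. by rewrite big_cons. Qed.

Lemma xop_word g w : (\prod_(i <- w) xop i) (emb g) = emb (fun v => g (w ++ v)).
Proof.
elim: w g => [|i w IH] g; first by rewrite big_nil.
by rewrite lend_prod_cons xopE lder_x_emb IH.
Qed.

Lemma model_x_dist : joint_dist (ncps_state model) (xop : 'I_k -> model) nu.
Proof.
by move=> w; rewrite model_stateE xop_word emb_nil cats0.
Qed.

Definition yop i : E := xop i + sop i.

(* At [f = model_vac], the series of the free convolution of [nu] and [gamma_t]. *)
Definition resolvent f : S := fun w => (\prod_(i <- w) yop i) f [::].

Lemma resolvent_nil f : resolvent f [::] = f [::].
Proof. by rewrite /resolvent big_nil. Qed.

Lemma lder_resolvent i f : lder i (resolvent f) = resolvent (yop i f).
Proof. by apply/funext => w; rewrite lderE /resolvent lend_prod_cons. Qed.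

Lemma resolventD f h : resolvent (f + h) = resolvent f + resolvent h.
Proof. by apply/funext => w; rewrite /resolvent lendD. Qed.

Lemma resolventZ a f : resolvent (a *: f) = a *: resolvent f.
Proof. by apply/funext => w; rewrite /resolvent lendZ. Qed.

Lemma resolvent0 : resolvent 0 = 0.
Proof. by apply/funext => w; rewrite /resolvent lend0. Qed.

(* The annihilation half of [sop] is a derivation-like operator, and so is the
   creation half on products that contain a letter [el j]. *)
Lemma sop_split i j f h :
  sop i (f * (z (el j) * h)) = sop i f * (z (el j) * h) + f [::] *: ((i == j)%:R *: h).
Proof.
rewrite !sopE lderM lder_varM eq_el -mulrA mulrDl -scalerAl !mulrA.
by rewrite -!addrA addrC -!addrA.
Qed.

Lemma yop_split i j f h :
  yop i (f * (z (el j) * h)) = yop i f * (z (el j) * h) + f [::] *: ((i == j)%:R *: h).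
Proof.
rewrite /yop !lend_addE sop_split !xopE lderM lder_varM eq_xel scale0r scaler0.
by rewrite [in RHS]mulrDl -[RHS]addrA; congr (_ + _); exact: add0r.
Qed.

(** The letter [el j] separates [f] from [h]: operators act on [f] alone until [f] is reduced to its
    constant term and a [sop j] annihilates the letter, which contributes [z j]; the later ones act
    on [h]. *)
Lemma resolvent_split j f h :
  resolvent (f * (z (el j) * h)) = resolvent f * (z j * resolvent h).
Proof.
apply/funext => w; elim: w f h => [|i w IH] f h.
  by rewrite !(resolvent_nil, ncs_mul_nil) !var_nil mul0r !mulr0.
rewrite -!lderE lder_resolvent yop_split resolventD ncs_addE IH.
rewrite lderM lder_varM lder_resolvent resolvent_nil addrC ncs_addE.
by rewrite !resolventZ.
Qed.

Local Notation G := (resolvent N).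

(** By [resolvent_split], the creation terms add up to c Phi_eta(G) times the unknown itself, so
    they can be moved to the left side. *)
Lemma resolvent_rec f : (1 - c *: Phi_eta G) * resolvent f =
  (f [::])%:A + \sum_i z i * resolvent (lder (xl i) f)
              + \sum_i z i * resolvent (lder (el i) f).
Proof.
rewrite mulrBl mul1r -scalerAl {1}(ncs_expand (resolvent f)) resolvent_nil.
rewrite -!addrA; congr (_ + _); apply/eqP; rewrite subr_eq; apply/eqP.
rewrite -addrA /Phi_eta mulr_suml scaler_sumr -!big_split /=; apply: eq_bigr => i _.
rewrite lder_resolvent /yop lend_addE xopE sopE !resolventD resolventZ.
rewrite -(mulrA N) resolvent_split !mulrDr -scalerAr !mulrA.
by [].
Qed.

Lemma resolvent_unit : (1 - c *: Phi_eta G) [::] != 0.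
Proof.
by rewrite ncs_addE ncs_oppE ncs_scaleE Phi_eta_nil mulr0 subr0 oner_neq0.
Qed.

Definition model_H : S := (1 - c *: Phi_eta G)^-1.

(** An embedded series has no [el] derivative, so [resolvent_rec] closes on embedded series. It
    becomes the Horner recursion for H g(z H), with the factor H shifted from the right of each
    letter to its left. *)
Lemma resolvent_emb g : resolvent (emb g) = model_H * ncs_subst g (var_mul model_H).
Proof.
have H0 : forall i, (model_H * z i) [::] = 0.
  by move=> i; rewrite ncs_mul_nil var_nil mulr0.
move: g; apply: (subst_rec_unique (g := fun i => model_H * z i)
  (C := fun g : S => g [::] *: model_H)) => // g.
  have /(congr1 (fun f : S => model_H * f)) := resolvent_rec (emb g).
  rewrite mulrA mulVs ?resolvent_unit // mul1r => ->.
  rewrite [X in _ + X]big1 => [|i _]; last by rewrite lder_e_emb resolvent0 mulr0.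
  rewrite addr0 mulrDr -scalerAr mulr1 mulr_sumr; congr (_ + _).
  by apply: eq_bigr => i _; rewrite lder_x_emb mulrA.
rewrite {1}ncs_subst_rec; last exact: var_mul_nil.
rewrite mulrDr -scalerAr mulr1 mulr_sumr; congr (_ + _).
by apply: eq_bigr => i _; rewrite /var_mul !mulrA.
Qed.

Lemma resolvent_vac : G = model_H * ncs_subst (gser nu) (var_mul model_H).
Proof. exact: resolvent_emb. Qed.

(* Wick products: [wick w] is the vacuum part of [1 \* sop w_n \* ... \* sop w_1]. *)
Definition wick (w : seq 'I_k) : W := \prod_(j <- w) (N * z (el j)).

Lemma wick_cons j w : wick (j :: w) = N * (z (el j) * wick w).
Proof. by rewrite /wick big_cons mulrA. Qed.

Lemma sop_wick i w : sop i (wick w) = c *: wick (i :: w) +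
  (if w is j :: w' then (i == j)%:R *: wick w' else 0).
Proof.
rewrite sopE addrC [wick (i :: w)]wick_cons mulrA; congr (_ + _).
case: w => [|j w]; first by rewrite /wick big_nil.
by rewrite wick_cons lder_eNM lder_varM eq_el.
Qed.

Section WickSpan.
Variable J : pred 'I_k.

Inductive wick_span : W -> Prop :=
| wick_span0 : wick_span 0
| wick_spanD a w f : all J w -> wick_span f -> wick_span (a *: wick w + f).

Lemma wick_span_add f h : wick_span f -> wick_span h -> wick_span (f + h).
Proof.
move=> Wf Wh; elim: Wf => [|a w f' Jw _ IH]; first by rewrite add0r.
by rewrite -addrA; apply: wick_spanD.
Qed.

Lemma wick_span_scale a f : wick_span f -> wick_span (a *: f).
Proof.
elim=> [|b w f' Jw _ IH]; first by rewrite scaler0; apply: wick_span0.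
by rewrite scalerDr scalerA; apply: wick_spanD.
Qed.

Lemma wick_span_wick w : all J w -> wick_span (wick w).
Proof.
by move=> Jw; rewrite -[wick w]scale1r -[_ *: _]addr0; apply/wick_spanD/wick_span0.
Qed.

Lemma wick_span_sop i f : J i -> wick_span f -> wick_span (sop i f).
Proof.
move=> Ji; elim=> [|a w f' Jw _ IH]; first by rewrite lend0; apply: wick_span0.
rewrite lendD lendZ; apply/wick_span_add/IH/wick_span_scale.
rewrite sop_wick; apply: wick_span_add.
  by apply/wick_span_scale/wick_span_wick; rewrite /= Ji.
case: w Jw => [|j w] /=; first by move=> _; apply: wick_span0.
by case/andP=> _ Jw; apply/wick_span_scale/wick_span_wick.
Qed.

(** All words of [g] are nonempty and start with a letter [el j] for some j in J. *)
Definition only_J (g : W) := g [::] = 0 /\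
  forall l, (forall j, J j -> l != el j) -> lder l g = 0.

Lemma wick_spanP f : wick_span f ->
  exists2 g, only_J g & f = (f [::])%:A + N * g.
Proof.
elim=> [|a w f' Jw _ [g [g0 gJ] fE]].
  by exists 0; rewrite ?mulr0 ?addr0 ?scale0r //; split.
case: w Jw => [|j w] /= Jw.
  exists g => //; rewrite /wick big_nil ncs_addE ncs_scaleE ncs_oneE mulr1.
  by rewrite {1}fE addrA -scalerDl.
have {Jw} /andP[Jj Jw] := Jw.
exists (a *: (z (el j) * wick w) + g); last first.
  rewrite mulrDr -scalerAr wick_cons ncs_addE ncs_scaleE !ncs_mul_nil var_nil.
  by rewrite mul0r !mulr0 add0r {1}fE addrCA.
split; first by rewrite ncs_addE ncs_scaleE ncs_mul_nil var_nil mul0r mulr0 add0r.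
move=> l lJ; rewrite lderD lderZ lder_varM gJ // (negbTE (lJ _ Jj)).
by rewrite scale0r scaler0 addr0.
Qed.

(** Vectors that the annihilation operators indexed by J kill, as they kill the vacuum. *)
Definition J_vacuum f := forall j, J j -> lder (el j) f = 0.

Lemma vac_J_vacuum : J_vacuum N. Proof. by move=> j _; apply: lder_e_vac. Qed.

Lemma sop_J_vacuum i f h : J i -> J_vacuum h -> sop i (f * h) = sop i f * h.
Proof.
move=> Ji hJ; rewrite !sopE lderM hJ // scaler0 add0r mulrDl -scalerAl.
by rewrite !mulrA.
Qed.

(** On a [J_vacuum] vector, an element T of the algebra acts as left multiplication by T 1, which is
    a combination of Wick products. Its constant term is the state of T, so centering leaves only
    terms of the form [N * g]. *)
Lemma centered_sop (X : set model) (T : model) (f : W) :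
  (forall U, X U -> exists2 i, J i & U = sop i) ->
  gen_subalg X T -> ncps_state model T = 0 -> J_vacuum f ->
  exists2 g, only_J g & T f = N * (g * f).
Proof.
move=> XJ XT.
pose P (U : model) := (forall f h : W, J_vacuum h -> U (f * h) = U f * h) /\
    (forall h : W, wick_span h -> wick_span (U h)).
have [TJ TW] : P T.
  apply: (@gen_subalg_ind _ _ X P) XT => //.
  - move=> a U V [UJ UW] [VJ VW]; split=> [h h' h'J|h hW].
      by rewrite !lend_addE !lend_scaleE UJ // VJ // mulrDl scalerAl.
    by apply/wick_span_add/VW/hW/wick_span_scale/UW.
  - move=> U V [UJ UW] [VJ VW]; split=> [h h' h'J|h hW].
      by rewrite !lend_mulE UJ // VJ.
    exact/VW/UW.
  - move=> U /XJ[i Ji ->]; split=> [h h' h'J|h hW].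
      exact: sop_J_vacuum.
    exact: wick_span_sop.
rewrite model_stateE => T0 fJ.
have w1 : wick [::] = 1 by rewrite /wick big_nil.
have [g gJ] := wick_spanP (TW _ (wick_span_wick (isT : all J [::]))).
have -> : T (wick [::]) [::] = 0.
  rewrite -T0 -[N in RHS]mul1r w1 TJ; last exact: vac_J_vacuum.
  by rewrite ncs_mul_nil vac_nil mulr1.
rewrite scale0r add0r w1 => gE; exists g => //.
by rewrite -[f in LHS]mul1r TJ // gE mulrA.
Qed.
End WickSpan.

(** In a vector [N * h] whose second factor has no [xl] derivative, T sees only the fresh vacuum in
    front and treats it as the original one. *)
Lemma centered_xop (T : model) : gen_subalg (range (xop : 'I_k -> model)) T ->
  (exists g, T N = emb g) /\
  (forall f h : W, (forall i, lder (xl i) h = 0) -> T (f * h) = T f * h).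
Proof.
move=> XT; pose P (U : model) := (forall g, exists g', U (emb g) = emb g') /\
  (forall f h : W, (forall i, lder (xl i) h = 0) -> U (f * h) = U f * h).
suff [TP1 TP2] : P T by split=> //; apply: TP1.
apply: (@gen_subalg_ind _ _ _ P) XT => //.
- by split=> // g; exists g.
- move=> a U V [U1 U2] [V1 V2]; split=> [g|f h hx].
    have [g1 E1] := U1 g; have [g2 E2] := V1 g; exists (a *: g1 + g2).
    rewrite lend_addE lend_scaleE E1 E2; apply/funext => w.
    rewrite ncs_addE ncs_scaleE /emb; case: (xword w) => //=.
    by rewrite mulr0 addr0.
  by rewrite !lend_addE !lend_scaleE U2 // V2 // mulrDl scalerAl.
- move=> U V [U1 U2] [V1 V2]; split=> [g|f h hx].
    by have [g1 E1] := U1 g; have [g2 E2] := V1 g1; exists g2; rewrite lend_mulE E1.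
  by rewrite !lend_mulE U2 // V2.
- move=> _ [i _ <-]; split=> [g|f h hx].
    by exists (lder i g); rewrite xopE lder_x_emb.
  by rewrite !xopE lderM hx scaler0 add0r.
Qed.

(* To prove freeness, it is enough to find invariants [Out i] that hold after a
   centered element of the [i]-th algebra has acted. *)
Lemma model_free (I : eqType) (X : I -> set model) (Out : I -> W -> Prop) :
  (forall (i : I) f, Out i f -> f [::] = 0) ->
  (forall (i : I) (T : model) f, gen_subalg (X i) T -> ncps_state model T = 0 ->
     f = N \/ (exists2 j, j != i & Out j f) -> Out i (T f)) ->
  freely_independent X.
Proof.
move=> Out0 step [//|[i T] s] _ /= ps sc; rewrite model_stateE big_cons lend_mulE.
have [TX T0] := sc (i, T) (mem_head _ _).
have {TX T0} := step i T N TX T0 (or_introl erefl); move: (T N : W) => f.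
have {sc} : forall p, p \in s -> gen_subalg (X p.1) p.2 /\ ncps_state model p.2 = 0.
  by move=> p ps'; apply: sc; rewrite in_cons ps' orbT.
elim: s i T f ps => [|[j U] s IH] i T f /=.
  by move=> _ _ /Out0 f0; rewrite big_nil lend_oneE.
case/andP=> ij ps sc fi; rewrite big_cons lend_mulE.
have [UX U0] := sc (j, U) (mem_head _ _).
apply: (IH j U) => //; last by apply: step => //; right; exists i.
by move=> p ps'; apply: sc; rewrite in_cons ps' orbT.
Qed.

(** After a centered x-element no word of the vector starts with an [el] letter; after a centered
    s-element the vector is [N * g] with every word of [g] starting with one. Each invariant lets
    the other algebra act as it does on the vacuum. *)
Lemma model_free_x_s : freely_independent
  (fun b : bool => if b then range (xop : 'I_k -> model) else range (sop : 'I_k -> model)).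
Proof.
apply: (@model_free _ _ (fun b f => if b then f [::] = 0 /\ J_vacuum predT f
  else exists2 g, only_J predT g & f = N * g)) => [[] f|b T f].
- by case.
- by case=> g [g0 _] ->; rewrite ncs_mul_nil g0 mulr0.
case: b => XT T0 fP.
  have [[g TN] TM] := centered_xop XT.
  have g0 : g [::] = 0 by rewrite -emb_nil -TN -T0.
  case: fP => [->|[[//|_] [h [h0 hJ] ->]]].
    by rewrite TN; split=> // j _; apply: lder_e_emb.
  rewrite TM; last by move=> i; apply: hJ => j _; rewrite eq_xel.
  rewrite TN; split=> [|j _]; first by rewrite ncs_mul_nil emb_nil g0 mul0r.
  by rewrite lderM emb_nil g0 scale0r add0r lder_e_emb mul0r.
have fJ : J_vacuum predT f.
  by case: fP => [->|[[_ []//|//]]]; apply: vac_J_vacuum.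
have [|g [g0 gJ] ->] := @centered_sop predT _ T f _ XT T0 fJ.
  by move=> _ [i _ <-]; exists i.
exists (g * f) => //; split; first by rewrite ncs_mul_nil g0 mul0r.
by move=> l lJ; rewrite lderM g0 scale0r add0r gJ ?mul0r.
Qed.

Lemma model_free_s : freely_independent (fun i => [set (sop i : model)]%classic).
Proof.
apply: (@model_free _ _ (fun i f => exists2 g, only_J (pred1 i) g & f = N * g)).
  by move=> i _ [g [g0 _] ->]; rewrite ncs_mul_nil g0 mulr0.
move=> i T f XT T0 fP.
have fJ : J_vacuum (pred1 i) f.
  case: fP => [->|[j ji [g [g0 gJ] ->]]]; first exact: vac_J_vacuum.
  move=> _ /eqP->; rewrite lder_eNM gJ // => _ /eqP->.
  by rewrite eq_el eq_sym.
have [|g [g0 gJ] ->] := @centered_sop (pred1 i) _ T f _ XT T0 fJ.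
  by move=> _ ->; exists i => //=.
exists (g * f) => //; split; first by rewrite ncs_mul_nil g0 mul0r.
move=> l lJ; rewrite lderM g0 scale0r add0r gJ ?mul0r //.
Qed.

(** The index j is the number of operators that act on [f] before the letter [el i] is annihilated,
    as in [resolvent_split]. *)
Lemma sop_power_split i n f h :
  ((sop i : E) ^+ n) (f * (z (el i) * h)) [::] =
  \sum_(j < n) (sop i ^+ j) f [::] * (sop i ^+ (n - j.+1)) h [::].
Proof.
elim: n f => [|n IH] f.
  by rewrite expr0 big_ord0 lend_oneE !ncs_mul_nil var_nil mul0r mulr0.
rewrite exprS lend_mulE sop_split lendD eqxx scale1r lendZ ncs_addE IH big_ord_recl.
rewrite expr0 lend_oneE ncs_scaleE subn1 /= addrC; congr (_ + _).
by apply: eq_bigr => j _; rewrite subSS [sop i ^+ (bump _ _)]exprS.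
Qed.

Lemma sop_momentS i n :
  ncps_state model ((sop i : E) ^+ n.+1) =
  c * \sum_(j < n) ncps_state model ((sop i : E) ^+ j) *
                   ncps_state model ((sop i : E) ^+ (n - j.+1)).
Proof.
rewrite model_stateE exprS lend_mulE sopE lder_e_vac add0r lendZ ncs_scaleE.
by rewrite -mulrA sop_power_split.
Qed.

End Model.

Lemma prod_shift (K : fieldType) (B : algType K) (U : Type) (pr : U -> B)
    (s1 s2 : seq U) (p q : U) (c : K) : pr p = pr q + c *: 1 ->
  \prod_(u <- s1 ++ p :: s2) pr u =
  \prod_(u <- s1 ++ q :: s2) pr u + c *: \prod_(u <- s1 ++ s2) pr u.
Proof.
move=> pq; rewrite !big_cat !big_cons pq /= mulrDl mulrDr -!scalerAl mul1r.
by rewrite -scalerAr.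
Qed.

(** * Freeness and the marginals determine all joint moments *)

Section FreeDetermined.
Variables (R : realType) (A A' : ncps R) (I : eqType) (J : Type).
Variables (X : I -> set A) (X' : I -> set A') (x : I -> J -> A) (x' : I -> J -> A').
Hypothesis Xx : forall i j, X i (x i j).
Hypothesis Xx' : forall i j, X' i (x' i j).
Hypothesis freeX : freely_independent X.
Hypothesis freeX' : freely_independent X'.
Local Notation phi := (ncps_state A).
Local Notation phi' := (ncps_state A').
Hypothesis marginals : forall i (s : seq J),
  phi (\prod_(j <- s) x i j) = phi' (\prod_(j <- s) x' i j).

(* The pairs obtained by evaluating one and the same polynomial at [x i] and
   at [x' i]. *)
Inductive twin (i : I) : A -> A' -> Prop :=
| twin0 : twin i 0 0
| twinS c s a a' : twin i a a' ->
    twin i (c *: \prod_(j <- s) x i j + a) (c *: \prod_(j <- s) x' i j + a').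

Lemma twin_word i s : twin i (\prod_(j <- s) x i j) (\prod_(j <- s) x' i j).
Proof.
have := @twinS i 1 s _ _ (twin0 i).
by rewrite !scale1r !addr0.
Qed.

Lemma twin1 i : twin i 1 1.
Proof. by have := twin_word i [::]; rewrite !big_nil. Qed.

Lemma twinD i a a' b b' : twin i a a' -> twin i b b' -> twin i (a + b) (a' + b').
Proof.
move=> Ta Tb; elim: Ta => [|c s d d' _ IH]; first by rewrite !add0r.
by rewrite -!addrA; apply: twinS.
Qed.

Lemma twinZ i c a a' : twin i a a' -> twin i (c *: a) (c *: a').
Proof.
elim=> [|d s e e' _ IH]; first by rewrite !scaler0; apply: twin0.
by rewrite !scalerDr !scalerA; apply: twinS.
Qed.

Lemma twinM i a a' b b' : twin i a a' -> twin i b b' -> twin i (a * b) (a' * b').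
Proof.
move=> Ta Tb; elim: Ta => [|c s d d' _ IH]; first by rewrite !mul0r; apply: twin0.
rewrite !mulrDl -!scalerAl; apply: twinD IH; apply: twinZ.
elim: Tb => [|e u v v' _ IH]; first by rewrite !mulr0; apply: twin0.
by rewrite !mulrDr -!scalerAr -!big_cat; apply: twinS.
Qed.

Lemma twin_state i a a' : twin i a a' -> phi a = phi' a'.
Proof.
elim=> [|c s d d' _ IH]; first by rewrite !linear0.
by rewrite !linearP IH marginals.
Qed.

Lemma twin_gen i a a' : twin i a a' -> gen_subalg (X i) a.
Proof.
have g0 : gen_subalg (X i) 0.
  by rewrite -(addNr 1) -scaleN1r; apply: gen_subalgD; apply: gen_subalg1.
elim=> [//|c s d d' _ IH]; apply: gen_subalgD IH.
elim: s => [|j s IH]; first by rewrite big_nil; apply: gen_subalg1.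
by rewrite big_cons; apply: gen_subalgM IH; apply: gen_subalg_sub.
Qed.

Lemma twin_gen' i a a' : twin i a a' -> gen_subalg (X' i) a'.
Proof.
have g0 : gen_subalg (X' i) 0.
  by rewrite -(addNr 1) -scaleN1r; apply: gen_subalgD; apply: gen_subalg1.
elim=> [//|c s d d' _ IH]; apply: gen_subalgD IH.
elim: s => [|j s IH]; first by rewrite big_nil; apply: gen_subalg1.
by rewrite big_cons; apply: gen_subalgM IH; apply: gen_subalg_sub.
Qed.

Lemma not_sorted_split (T : Type) (e : rel T) (s : seq T) : ~~ sorted e s ->
  exists u p q v, s = u ++ p :: q :: v /\ ~~ e p q.
Proof.
case: s => [//|p s] /=; elim: s p => [//|q s IH] p /=.
rewrite negb_and => /orP[pq|/IH[u [p' [q' [v [E epq]]]]]].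
  by exists [::], p, q, s.
by exists (p :: u), p', q', v; rewrite E.
Qed.

Local Notation T := (I * (A * A'))%type.

Definition twins (s : seq T) := forall p, List.In p s -> twin p.1 p.2.1 p.2.2.
Definition centered (s : seq T) := forall p, List.In p s -> phi p.2.1 = 0.

Lemma In_cat (U : Type) (s1 s2 : seq U) p :
  List.In p (s1 ++ s2) <-> List.In p s1 \/ List.In p s2.
Proof. exact: List.in_app_iff. Qed.

Lemma In_map_mem (U : Type) (V : eqType) (f : U -> V) s q :
  q \in map f s -> exists2 p, List.In p s & q = f p.
Proof.
elim: s => [//|p s IH]; rewrite in_cons => /orP[/eqP->|/IH[p' ps ->]].
  by exists p => //; left.
by exists p' => //; right.
Qed.

(** Induction on the length. Factors are centered one by one, and the scalar parts give shorter
    products. A fully centered product is either alternating, and then zero on both sides, or has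
    two neighbours in the same algebra, which merge into one factor. *)
Lemma twin_prod n (s : seq T) : (size s <= n)%N -> twins s ->
  phi (\prod_(p <- s) p.2.1) = phi' (\prod_(p <- s) p.2.2).
Proof.
elim: n s => [|n IH] s.
  by rewrite leqn0 size_eq0 => /eqP-> _; rewrite !big_nil !ncps_state1.
(* [s1] is the prefix already centered, [s2] what remains to be centered. *)
suff main s1 s2 : (size (s1 ++ s2) <= n.+1)%N -> twins (s1 ++ s2) -> centered s1 ->
    phi (\prod_(p <- s1 ++ s2) p.2.1) = phi' (\prod_(p <- s1 ++ s2) p.2.2).
  by move=> sn Ts; apply: (main [::] s).
elim: s2 s1 => [|[i [a a']] s2 IH2] s1 sn Ts Cs.
  rewrite cats0 in sn Ts *; case: s1 sn Ts Cs => [|p r]; first by rewrite !big_nil !ncps_state1.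
  set l := p :: r => ln Tl Cl.
  have [srt|/not_sorted_split[u [[i [a a']] [[j [b b']] [v [E /negPn/eqP /= ij]]]]]] :=
    boolP (sorted (fun p q => p.1 != q.1) l).
    pose h (p : T) : I * A := (p.1, p.2.1); pose h' (p : T) : I * A' := (p.1, p.2.2).
    have -> : \prod_(p <- l) p.2.1 = \prod_(p <- map h l) p.2 by rewrite big_map.
    have -> : \prod_(p <- l) p.2.2 = \prod_(p <- map h' l) p.2 by rewrite big_map.
    rewrite freeX ?freeX' //.
    - by rewrite sorted_map.
    - move=> _ /In_map_mem[q ql ->]; split; first exact: twin_gen' (Tl _ ql).
      by rewrite -(twin_state (Tl _ ql)); apply: Cl.
    - by rewrite sorted_map.
    - move=> _ /In_map_mem[q ql ->]; split; first exact: twin_gen (Tl _ ql).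
      exact: Cl.
  rewrite E -ij in ln Tl *; clear E Cl.
  have := IH (u ++ (i, (a * b, a' * b')) :: v).
  rewrite !big_cat !big_cons /= !mulrA; apply.
    by move: ln; rewrite !size_cat /=; lia.
  move=> q /In_cat[qu|[<-|qv]] /=.
  - by apply: Tl; apply/In_cat; left.
  - apply: twinM; [apply: (Tl (i, (a, a')))|apply: (Tl (i, (b, b')))]; apply/In_cat; right.
      by left.
    by right; left.
  - by apply: Tl; apply/In_cat; do 3!right.
have Ta : twin i a a' by apply: (Ts (i, (a, a'))); apply/In_cat; right; left.
pose c := phi a; have c' : phi' a' = c by rewrite -(twin_state Ta).
have Ta0 : twin i (a - c *: 1) (a' - c *: 1).
  by rewrite -!scaleNr; apply: twinD => //; apply/twinZ/twin1.
rewrite (@prod_shift _ A _ (fun p => p.2.1) s1 s2 _ (i, (a - c *: 1, a' - c *: 1)) c) ?subrK //.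
rewrite (@prod_shift _ A' _ (fun p => p.2.2) s1 s2 _ (i, (a - c *: 1, a' - c *: 1)) c) ?subrK //.
rewrite !linearD !linearZ /= !scalerN; congr (_ + _ * _); last first.
  apply: IH; first by move: sn; rewrite !size_cat /=; lia.
  by move=> q /In_cat[q1|q2]; apply: Ts; apply/In_cat; [left|right; right].
rewrite -!cat_rcons; apply: IH2.
- by rewrite cat_rcons; move: sn; rewrite !size_cat.
- rewrite cat_rcons => q /In_cat[q1|[<-|q2]]; last 1 first.
  + by apply: Ts; apply/In_cat; right; right.
  + by apply: Ts; apply/In_cat; left.
  + exact: Ta0.
- move=> q; rewrite -cats1 => /In_cat[/Cs //|[<- /=|//]].
  by rewrite linearB linearZ /= ncps_state1 mulr1 subrr.
Qed.

Lemma free_determined (s : seq (I * J)) :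
  phi (\prod_(p <- s) x p.1 p.2) = phi' (\prod_(p <- s) x' p.1 p.2).
Proof.
pose h (p : I * J) : T := (p.1, (x p.1 p.2, x' p.1 p.2)).
have -> : \prod_(p <- s) x p.1 p.2 = \prod_(p <- map h s) p.2.1 by rewrite big_map.
have -> : \prod_(p <- s) x' p.1 p.2 = \prod_(p <- map h s) p.2.2 by rewrite big_map.
apply: twin_prod (leqnn _) _ => q /List.in_map_iff[p [<- _]] /=.
by have := twin_word p.1 [:: p.2]; rewrite !big_seq1.
Qed.

End FreeDetermined.

(** * The free convolution and the semicircular family computed in the model *)

Section FreeConvolution.
Variables (R : realType) (k : nat).
Implicit Types (mu nu rho : dalg R k) (t : R).

Lemma free_add_unique (A : ncps R) (x y : 'I_k -> A) mu nu rho :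
  joint_dist (ncps_state A) x mu -> joint_dist (ncps_state A) y nu ->
  freely_independent (fun b : bool => if b then range x else range y) ->
  joint_dist (ncps_state A) (fun i => x i + y i) rho ->
  free_add mu nu = rho.
Proof.
move=> xmu ynu free sum_rho; apply: xget_unique; first by exists A, x, y.
move=> rho' [A' [x' [y' [xmu' ynu' free' sum_rho']]]].
pose v (b : bool) := if b then x else y; pose v' (b : bool) := if b then x' else y'.
have H : forall s : seq (bool * 'I_k), ncps_state A (\prod_(p <- s) v p.1 p.2) =
    ncps_state A' (\prod_(p <- s) v' p.1 p.2).
  apply: free_determined free free' _ => [[] j|[] j|[] s] /=; try by exists j.
    by rewrite -xmu -xmu'.
  by rewrite -ynu -ynu'.
(* Generalized so that the sums expand letter by letter: [s] records the summands already chosen. *)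
have {}H w s : ncps_state A ((\prod_(p <- s) v p.1 p.2) * \prod_(i <- w) (x i + y i)) =
    ncps_state A' ((\prod_(p <- s) v' p.1 p.2) * \prod_(i <- w) (x' i + y' i)).
  elim: w s => [|i w IH] s; first by rewrite !big_nil !mulr1 H.
  rewrite !big_cons !mulrA !mulrDr !mulrDl !linearD.
  have := IH (rcons s (true, i)); have := IH (rcons s (false, i)).
  by rewrite !big_rcons /= => -> ->.
apply: dalg_eq => w; rewrite sum_rho sum_rho'.
by have := H w [::]; rewrite !big_nil !mul1r => ->.
Qed.

Lemma semicircular_family_unique (A : ncps R) (x : 'I_k -> A) t mu :
  freely_independent (fun i : 'I_k => [set x i]%classic) ->
  (forall i, semicircular t (x i)) ->
  joint_dist (ncps_state A) x mu -> semicircular_family k t = mu.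
Proof.
move=> free sc xmu; apply: xget_unique; first by exists A, x.
move=> mu' [A' [x' [free' sc' xmu']]]; apply: dalg_eq => w; rewrite xmu xmu'.
(* Each algebra has a single generator, hence the index type [unit], and its marginals are the
   powers of that generator. *)
have H : forall s : seq ('I_k * unit), ncps_state A (\prod_(p <- s) x p.1) =
    ncps_state A' (\prod_(p <- s) x' p.1).
  apply: (free_determined (x := fun i _ => x i) (x' := fun i _ => x' i)) free free' _ => //.
  move=> i s; rewrite !big_const_seq count_predT.
  by rewrite !iter_mulr_1 sc sc'.
have := H [seq (i, tt) | i <- w].
by rewrite !big_map.
Qed.

Lemma free_add_semicircular nu t sigma :
  (forall i, semicircular t (sop nu t i : model nu)) ->
  gser sigma = resolvent nu t (model_vac nu) ->
  free_add nu (semicircular_family k t) = sigma.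
Proof.
move=> sc sE.
have [|gam gamE] := @gser_surj R k (fun w => ncps_state (model nu) (\prod_(i <- w) sop nu t i)).
  by rewrite big_nil ncps_state1.
have gam_dist : joint_dist (ncps_state (model nu)) (sop nu t : _ -> model nu) gam.
  by move=> w; have /(congr1 (fun f : ncseries _ _ => f w)) := gamE.
rewrite (semicircular_family_unique (@model_free_s R k nu t) sc gam_dist).
apply: (free_add_unique (@model_x_dist R k nu) gam_dist (@model_free_x_s R k nu t)).
by move=> w; have /(congr1 (fun f : ncseries _ _ => f w)) := sE.
Qed.

End FreeConvolution.

(** * Moments of the semicircle density *)

Section SemicircleMoments.
Variable R : realType.
Implicit Types (t x : R) (n : nat).
Local Notation mu := (@lebesgue_measure R).
Local Open Scope classical_set_scope.

Lemma FTC2_smooth (f F : R -> R) a b : a < b -> continuous f ->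
  (forall x, is_derive x (1 : R) F (f x)) ->
  \int[mu]_(x in `[a, b]) f x = F b - F a.
Proof.
move=> ab cf dF; have cF : continuous F.
  by move=> x; apply: differentiable_continuous; apply/derivable1_diffP; case: (dF x).
rewrite /Rintegral (@continuous_FTC2 _ f F) //.
- exact: continuous_subspaceT.
- split; first by move=> x _; case: (dF x).
  + by apply: cvg_at_right_filter; apply: cF.
  + by apply: cvg_at_left_filter; apply: cF.
- by move=> x _; rewrite derive1E; case: (dF x).
Qed.

Lemma integrable_smooth (f : R -> R) a b : continuous f ->
  mu.-integrable `[a, b] (EFin \o f).
Proof.
move=> cf; apply: continuous_compact_integrable; first exact: segment_compact.
exact: continuous_subspaceT.
Qed.

Definition trig_moment n := \int[mu]_(x in `[0, pi]) (cos x ^+ n * sin x ^+ 2).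

Lemma continuous_trig n m : continuous (fun x : R => cos x ^+ n * sin x ^+ m).
Proof.
move=> x; apply: cvgM.
  by apply: (@continuous_comp _ _ _ (@cos R) (fun y => y ^+ n)); [exact: continuous_cos | exact: exprn_continuous].
by apply: (@continuous_comp _ _ _ (@sin R) (fun y => y ^+ m)); [exact: continuous_sin | exact: exprn_continuous].
Qed.

Lemma trig_moment0 : trig_moment 0 = pi / 2.
Proof.
pose F (x : R) : R := x / 2 - cos x * sin x / 2.
have dF x : is_derive x (1 : R) F (cos x ^+ 0 * sin x ^+ 2).
  rewrite /F; apply: is_derive_eq; rewrite /GRing.scale /=.
  have -> : cos x ^+ 0 * sin x ^+ 2 = (1 - cos x ^+ 2 + sin x ^+ 2) / 2.
    by rewrite sin2cos2; field.
  by field.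
rewrite /trig_moment (FTC2_smooth (pi_gt0 R) _ dF); last exact: continuous_trig.
by rewrite /F sinpi sin0; field.
Qed.

Lemma trig_moment1 : trig_moment 1 = 0.
Proof.
pose F (x : R) : R := sin x ^+ 3 / 3.
have dF x : is_derive x (1 : R) F (cos x ^+ 1 * sin x ^+ 2).
  rewrite /F; apply: is_derive_eq; rewrite /GRing.scale /=.
  by field.
rewrite /trig_moment (FTC2_smooth (pi_gt0 R) _ dF); last exact: continuous_trig.
by rewrite /F sinpi sin0; field.
Qed.

Lemma trig_momentS n :
  (n + 4)%:R * trig_moment n.+2 = (n + 1)%:R * trig_moment n.
Proof.
(* This primitive vanishes at 0 and pi, so the integral of its derivative gives the relation; sin^2
   = 1 - cos^2 turns the coefficients into n + 1 and n + 1 + 3. *)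
pose F : R -> R := - ((@cos R) ^+ n.+1 * (@sin R) ^+ 3).
pose f (x : R) : R := (n + 1)%:R * (cos x ^+ n * sin x ^+ 2) -
  (n + 4)%:R * (cos x ^+ n.+2 * sin x ^+ 2).
have dF x : is_derive x (1 : R) F (f x).
  rewrite /F /f; apply: is_derive_eq; rewrite /GRing.scale /= !exprfctE.
  move: (sin x) (cos x) (sin2cos2 x) => s c s2.
  rewrite addn1 addn4 [_ ^+ n.+2]exprS [_ ^+ n.+1]exprS.
  transitivity (n.+1%:R * c ^+ n * s ^+ 2 * s ^+ 2 - 3 * c ^+ 2 * c ^+ n * s ^+ 2).
    by ring.
  have -> : n.+4%:R = n.+1%:R + 3 :> R by rewrite -(natrD _ n.+1 3) addn3.
  by rewrite s2; ring.
have : \int[mu]_(x in `[0, pi]) f x = 0.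
  rewrite (FTC2_smooth (pi_gt0 R) _ dF).
    have F0 x : sin x = 0 -> F x = 0.
      move=> s0; rewrite -[F x]/(- ((@cos R ^+ n.+1) x * (@sin R ^+ 3) x)) !exprfctE.
      by rewrite s0 expr0n mulr0 oppr0.
    by rewrite !F0 ?sinpi ?sin0 ?subr0.
  by move=> x; apply: cvgB; apply: cvgM; try exact: cvg_cst; exact: continuous_trig.
rewrite /f RintegralB //; last 2 first.
- apply: integrable_smooth => x; apply: cvgM; [exact: cvg_cst | exact: continuous_trig].
- apply: integrable_smooth => x; apply: cvgM; [exact: cvg_cst | exact: continuous_trig].
rewrite !RintegralZl //; try by apply: integrable_smooth; exact: continuous_trig.
by move/eqP; rewrite subr_eq0 => /eqP.
Qed.

Lemma semicircle_moment_trig n t : 0 < t ->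
  \int[mu]_(s in `[- (2 * Num.sqrt t), 2 * Num.sqrt t])
       (s ^+ n * semicircle_density t s) =
  2 / pi * (2 * Num.sqrt t) ^+ n * trig_moment n.
Proof.
move=> t0; set r : R := 2 * Num.sqrt t.
have r0 : 0 < r by rewrite mulr_gt0 // sqrtr_gt0.
have r2 : r ^+ 2 = 4 * t by rewrite exprMn sqr_sqrtr ?ltW //; ring.
pose F (x : R) : R := r * cos x.
pose G s := s ^+ n * semicircle_density t s.
have dF x : is_derive x (1 : R) F (- (r * sin x)).
  by apply: is_derive_eq; rewrite /GRing.scale /=; ring.
have DF : F^`() = fun x => - (r * sin x).
  by apply/funext => x; rewrite derive1E; case: (dF x).
have cDF : continuous F^`().
  move=> x; rewrite DF; apply: cvgN; apply: cvgM; first exact: cvg_cst.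
  exact: continuous_sin.
have cF : continuous F.
  by move=> x; apply: cvgM; [exact: cvg_cst | exact: continuous_cos].
have cG : continuous G.
  move=> x; apply: cvgM; first exact: exprn_continuous.
  apply: cvgM; last exact: cvg_cst.
  apply: (@continuous_comp _ _ _ (fun s : R => 4 * t - s ^+ 2) (@Num.sqrt R)).
    apply: cvgB; [exact: cvg_cst | exact: exprn_continuous].
  exact: sqrt_continuous.
(* The substitution s = r cos x decreases from r to -r on [0, pi], which accounts for the order of
   the bounds. *)
have -> : - r = F pi by rewrite /F cospi mulrN1.
rewrite -[X in `[_, X]](_ : F 0 = _); last by rewrite /F cos0 mulr1.
rewrite -[LHS]/(fine (\int[mu]_(s in `[F pi, F 0]) (G s)%:E)).
rewrite integration_by_substitution_decreasing; first last.
- exact: continuous_subspaceT.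
- split; first by move=> x _; case: (dF x).
  + by apply: cvg_at_right_filter; apply: cF.
  + by apply: cvg_at_left_filter; apply: cF.
- by apply/cvg_ex; exists (F^`() pi); apply: cvg_at_left_filter; apply: cDF.
- by apply/cvg_ex; exists (F^`() 0); apply: cvg_at_right_filter; apply: cDF.
- by move=> x _; apply: cDF.
- move=> x y x0 y0 xy; rewrite /F ltr_pM2l //.
  by rewrite ltr_cos.
- exact/ltW/pi_gt0.
rewrite -[LHS]/(\int[mu]_(x in `[0, pi]) ((G \o F) * - F^`()%classic) x).
rewrite /trig_moment -RintegralZl //; last by apply: integrable_smooth; exact: continuous_trig.
apply: eq_Rintegral => x; rewrite inE /= in_itv /= => x0.
have s0 : 0 <= sin x by apply: sin_ge0_pi.
rewrite /G /F /semicircle_density DF /= !fctE.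
have -> : 4 * t - (r * cos x) ^+ 2 = (r * sin x) ^+ 2.
  by rewrite -r2 !exprMn sin2cos2; ring.
rewrite sqrtr_sqr ger0_norm; last by rewrite mulr_ge0 // ltW.
have pi0 : pi != 0 :> R by rewrite gt_eqF // pi_gt0.
have E (q c s p : R) : p != 0 -> q ^+ 2 = 4 * t ->
    (q * c) ^+ n * (q * s / (2 * p * t)) * - - (q * s) =
    2 / p * q ^+ n * (c ^+ n * s ^+ 2).
  move=> p0 q2; rewrite opprK exprMn.
  transitivity (q ^+ n * c ^+ n * s ^+ 2 * (q ^+ 2 / (2 * p * t))); first by ring.
  by rewrite q2; field; rewrite p0 gt_eqF.
exact: E.
Qed.

Lemma semicircle_moment0 t : 0 < t ->
  \int[mu]_(s in `[- (2 * Num.sqrt t), 2 * Num.sqrt t])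
       (s ^+ 0 * semicircle_density t s) = 1.
Proof.
move=> t0; rewrite semicircle_moment_trig // trig_moment0 expr0 mulr1.
have pi0 : pi != 0 :> R by rewrite gt_eqF // pi_gt0.
by rewrite mulrA divfK // mulfV.
Qed.

Lemma semicircle_moment1 t : 0 < t ->
  \int[mu]_(s in `[- (2 * Num.sqrt t), 2 * Num.sqrt t])
       (s ^+ 1 * semicircle_density t s) = 0.
Proof. by move=> t0; rewrite semicircle_moment_trig // trig_moment1 mulr0. Qed.

Lemma semicircle_momentS n t : 0 < t ->
  (n + 4)%:R * \int[mu]_(s in `[- (2 * Num.sqrt t), 2 * Num.sqrt t])
       (s ^+ n.+2 * semicircle_density t s) =
  4 * t * (n + 1)%:R * \int[mu]_(s in `[- (2 * Num.sqrt t), 2 * Num.sqrt t])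
       (s ^+ n * semicircle_density t s).
Proof.
move=> t0; rewrite !semicircle_moment_trig //.
have q2 : (2 * Num.sqrt t) ^+ 2 = 4 * t :> R.
  by rewrite exprMn sqr_sqrtr ?ltW //; ring.
have := trig_momentS n; move: (trig_moment n.+2) (trig_moment n) => a b ab.
move: (2 * Num.sqrt t : R) q2 (2 / pi) => q q2 p.
transitivity (p * q ^+ 2 * q ^+ n * ((n + 4)%:R * a)); first by rewrite !exprS; ring.
by rewrite ab q2; ring.
Qed.
End SemicircleMoments.

(* The three-term recursion for the moments yields the Catalan convolution:
   weight the convolution sum by the index and symmetrize. *)
Lemma semicircle_convolution (R : realFieldType) (t : R) (u : nat -> R) :
  u 0 = 1 -> u 1 = 0 ->
  (forall n, (n + 4)%:R * u n.+2 = 4 * t * (n + 1)%:R * u n) ->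
  forall n, u n.+1 = t * \sum_(j < n) u j * u (n - j.+1)%N.
Proof.
move=> u0 u1 uS; pose S n := \sum_(j < n.+1) u j * u (n - j)%N.
suff uE : forall n, u n.+2 = t * S n.
  by case=> [|n]; [rewrite big_ord0 mulr0 | rewrite uE].
(* Added to its reversal, the sum gets the constant weight (j + 2) + (n - j + 2) = n + 4. *)
have sym n : \sum_(j < n.+1) (j + 2)%:R * (u j * u (n - j)%N) = (n + 4)%:R / 2 * S n.
  set T := LHS; suff : T + T = (n + 4)%:R * S n by move=> E; lra.
  rewrite {2}/T (reindex_inj rev_ord_inj) /= -big_split /S mulr_sumr /=.
  apply: eq_bigr => j _; rewrite subSS subKn ?leq_ord // (mulrC (u (n - j)%N)) -mulrDl.
  congr (_ * _); rewrite -natrD; congr (_%:R); have := leq_ord j; lia.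
have nz n : (n + 4)%:R != 0 :> R by rewrite pnatr_eq0 addn4.
move=> n; have [m] := ubnP n; elim: m n => [//|m IH] [_|[_|n nm]].
- apply: (mulfI (nz 0%N)); rewrite uS /S big_ord1 subn0 u0; ring.
- apply: (mulfI (nz 1%N)); rewrite uS /S u1 !big_ord_recl big_ord0 /= u1; ring.
apply: (mulfI (nz n.+2)); rewrite uS mulrCA.
have -> : (n.+2 + 4)%:R * S n.+2 = 2 * ((n.+2 + 4)%:R / 2 * S n.+2) by field.
(* Back to the weighted sum: its term of index 0 is explicit, that of index 1 vanishes, and in the
   others the weight i + 4 is the one that the three-term recursion absorbs. *)
rewrite -sym 2!big_ord_recl /= u1 /bump /= !add1n mul0r mulr0 add0r u0 mul1r.
have -> : \sum_(i < n.+1) (i.+2 + 2)%:R * (u i.+2 * u (n.+2 - i.+2)%N) =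
    4 * t * \sum_(i < n.+1) (i + 1)%:R * (u i * u (n - i)%N).
  rewrite mulr_sumr; apply: eq_bigr => i _; rewrite !subSS.
  have := uS i; rewrite !addnS !addn0 => E; rewrite mulrA E; ring.
have -> : \sum_(i < n.+1) (i + 1)%:R * (u i * u (n - i)%N) = (n + 2)%:R / 2 * S n.
  transitivity (\sum_(i < n.+1) (i + 2)%:R * (u i * u (n - i)%N) - S n).
    rewrite /S -sumrB; apply: eq_bigr => i _; rewrite !natrD; ring.
  by rewrite sym !natrD; field.
have E : t * S n = u n.+2 by rewrite IH // ltnW.
transitivity (t * (4 * u n.+2 + 4 * (n + 2)%:R * (t * S n))); last by rewrite subn0; field.
by rewrite E -addn2 !natrD; ring.
Qed.

Lemma sop_semicircular (R : realType) k (nu : dalg R k) (t : R) i : 0 < t ->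
  semicircular t (sop nu t i : model nu).
Proof.
move=> t0; pose u n : R := (\int[lebesgue_measure]_(s in `[- (2 * Num.sqrt t), 2 * Num.sqrt t]%classic)
       (s ^+ n * semicircle_density t s)).
have uS := @semicircle_convolution R t u (semicircle_moment0 t0)
  (semicircle_moment1 t0) (fun n => semicircle_momentS n t0).
move=> n; rewrite -/(u n); have [m] := ubnP n; elim: m n => [//|m IH] [_|n nm].
  by rewrite expr0 ncps_state1 /u semicircle_moment0.
rewrite sop_momentS uS rmorphM rmorph_sum; congr (_ * _).
apply: eq_bigr => j _; rewrite rmorphM !IH //.
  by have := ltn_ord j; lia.
by have := ltn_ord j; lia.
Qed.

Lemma Phi_free_add_semicircular (R : realType) k (nu : dalg R k) (t : R) : 0 < t ->
  Phi (free_add nu (semicircular_family k t)) = BB t (Phi nu).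
Proof.
move=> t0; pose G := resolvent nu t (model_vac nu).
have [|sigma sE] := @gser_surj R k G; first by rewrite /G resolvent_nil vac_nil.
rewrite (free_add_semicircular _ sE) => [|i]; last exact: sop_semicircular.
apply: (Phi_BB (H := model_H nu t)) => //.
  by rewrite sE mulVs // resolvent_unit.
by rewrite sE /G resolvent_vac.
Qed.

(** * Positive semidefinite kernels and their Schur products *)

Section PositiveKernels.
Variable R : realType.
Local Notation C := R[i].
Implicit Type T : Type.

(** Points may repeat in the list, so combinations of combinations are flattened without collecting
    terms. *)
Definition kform T (K : T -> T -> C) (l : seq (C * T)) : C :=
  \sum_(p <- l) \sum_(q <- l) p.1^* * q.1 * K p.2 q.2.

Definition psd T (K : T -> T -> C) := forall l : seq (C * T), 0 <= kform K l.

Lemma eq_psd T (K K' : T -> T -> C) :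
  (forall u v, K u v = K' u v) -> psd K -> psd K'.
Proof.
move=> KK Kp l; rewrite (_ : kform K' l = kform K l) //.
by apply: eq_bigr => p _; apply: eq_bigr => q _; rewrite KK.
Qed.

Lemma psd_rank1 T (f : T -> C) : psd (fun u v => (f u)^* * f v).
Proof.
move=> l; rewrite (_ : kform _ l = (\sum_(p <- l) p.1 * f p.2)^* * \sum_(p <- l) p.1 * f p.2).
  by rewrite mulrC mul_conjC_ge0.
rewrite rmorph_sum mulr_suml; apply: eq_bigr => p _; rewrite mulr_sumr.
by apply: eq_bigr => q _; rewrite rmorphM; ring.
Qed.

Lemma psd0 T : psd (fun _ _ : T => 0).
Proof. by move=> l; rewrite /kform big1 // => p _; rewrite big1 // => q _; rewrite mulr0. Qed.

Lemma psdD T (K K' : T -> T -> C) : psd K -> psd K' -> psd (fun u v => K u v + K' u v).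
Proof.
move=> Kp Kp' l; rewrite (_ : kform _ l = kform K l + kform K' l).
  by rewrite addr_ge0.
rewrite /kform -big_split; apply: eq_bigr => p _; rewrite -big_split.
by apply: eq_bigr => q _; rewrite mulrDr.
Qed.

Lemma psd_sum T (I : Type) (r : seq I) (K : I -> T -> T -> C) :
  (forall i, psd (K i)) -> psd (fun u v => \sum_(i <- r) K i u v).
Proof.
move=> Kp; elim: r => [|i r IH].
  by apply: eq_psd (@psd0 T) => u v; rewrite big_nil.
by apply: eq_psd (psdD (Kp i) IH) => u v; rewrite big_cons.
Qed.

Lemma psdZ T (a : C) (K : T -> T -> C) : 0 <= a -> psd K -> psd (fun u v => a * K u v).
Proof.
move=> a0 Kp l; rewrite (_ : kform _ l = a * kform K l) ?mulr_ge0 //.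
rewrite /kform mulr_sumr; apply: eq_bigr => p _; rewrite mulr_sumr.
by apply: eq_bigr => q _; ring.
Qed.

Lemma kform_flatten T T' (h : T' -> seq (C * T)) (K : T -> T -> C) (l : seq (C * T')) :
  kform (fun u v => \sum_(p <- h u) \sum_(q <- h v) p.1^* * q.1 * K p.2 q.2) l =
  kform K (flatten [seq [seq (p.1 * q.1, q.2) | q <- h p.2] | p <- l]).
Proof.
rewrite /kform big_flatten big_map; apply: eq_bigr => p _ /=.
rewrite big_map; under [in RHS]eq_bigr do rewrite big_flatten big_map.
rewrite [RHS]exchange_big; apply: eq_bigr => q _ /=.
rewrite mulr_sumr; apply: eq_bigr => p' _; rewrite mulr_sumr big_map.
by apply: eq_bigr => q' _ /=; rewrite rmorphM; ring.
Qed.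

Lemma psd_lin T T' (h : T' -> seq (C * T)) (K : T -> T -> C) : psd K ->
  psd (fun u v => \sum_(p <- h u) \sum_(q <- h v) p.1^* * q.1 * K p.2 q.2).
Proof. by move=> Kp l; rewrite kform_flatten. Qed.

Lemma psd_comp T T' (h : T' -> T) (K : T -> T -> C) : psd K ->
  psd (fun u v => K (h u) (h v)).
Proof.
move=> Kp; apply: eq_psd (psd_lin (fun u => [:: (1, h u)]) Kp) => u v.
by rewrite !big_seq1 /= conjC1 !mul1r.
Qed.

Lemma kform2 T (K : T -> T -> C) a b p q :
  kform K [:: (a, p); (b, q)] =
  a^* * a * K p p + a^* * b * K p q + (b^* * a * K q p + b^* * b * K q q).
Proof. by rewrite /kform !big_cons !big_nil /= !addr0. Qed.

Lemma psd_diag T (K : T -> T -> C) p : psd K -> 0 <= K p p.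
Proof.
by move=> /(_ [:: (1, p)]); rewrite /kform !big_seq1 /= conjC1 !mul1r.
Qed.

(** Polarization: the form is real on the vectors with coefficients (1, 1) and (1, i). *)
Lemma psd_herm T (K : T -> T -> C) p q : psd K -> K q p = (K p q)^*.
Proof.
move=> Kp; have Kpp := geC0_conj (psd_diag p Kp); have Kqq := geC0_conj (psd_diag q Kp).
have := geC0_conj (Kp [:: (1, p); (1, q)]).
have := geC0_conj (Kp [:: (1, p); ('i, q)]).
rewrite !kform2 !(rmorphD, rmorphM) /= !conjCK !conjC1 !conjCi Kpp Kqq !mul1r !mulr1.
set x := K p q; set y := K q p; set a := K p p; set b := K q q => E1 E2.
have {}E2 : x^* + y^* = x + y.
  by apply: (addrI a); apply: (addIr b); rewrite -!addrA !addrA in E2 *; exact: E2.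
have {}E1 : 'i * (y^* - x^*) = 'i * (x - y).
  apply: (addrI (a + - 'i * 'i * b)).
  transitivity (a + - 'i * x^* + ('i * y^* + 'i * - 'i * b)); first by ring.
  by rewrite E1; ring.
have {E1} /(mulfI (neq0Ci C)) E1 := E1.
have E : (2 : C) * y^* = 2 * x.
  have -> : 2 * y^* = (x^* + y^*) + (y^* - x^*) by ring.
  by rewrite E1 E2; ring.
have {E} /mulfI := E; rewrite pnatr_eq0 => /(_ isT) <-.
by rewrite conjCK.
Qed.

Lemma psd_CauchySchwarz T (K : T -> T -> C) p q : psd K ->
  `|K p q| ^+ 2 <= K p p * K q q.
Proof.
move=> Kp; have hqp := psd_herm p q Kp; have hpq := psd_herm q p Kp.
have main p' q' : K q' q' != 0 -> K p' q' * K q' p' <= K p' p' * K q' q'.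
  move=> q0; have Kqq := psd_diag q' Kp.
  (* On this vector the form is [K q' q'] times the 2 x 2 determinant. *)
  have := Kp [:: (K q' q', p'); (- K q' p', q')].
  rewrite kform2 (geC0_conj Kqq) rmorphN /= -(psd_herm q' p' Kp).
  rewrite (_ : _ + _ = K q' q' * (K p' p' * K q' q' - K p' q' * K q' p')); last by ring.
  by rewrite pmulr_rge0 ?subr_ge0 // lt_def q0.
rewrite normCK -hqp; have [q0|/main//] := eqVneq (K q q) 0.
have [p0|/main] := eqVneq (K p p) 0; last by rewrite mulrC (mulrC (K p p)); apply.
(* With both diagonal entries zero, the form on this vector is minus twice the squared modulus of
   [K p q]. *)
have := Kp [:: (1, p); (- K q p, q)].
rewrite kform2 p0 q0 conjC1 rmorphN /= -hpq => E.
have {E} : 0 <= - (2 * (K p q * K q p)) by move: E; congr (0 <= _); ring.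
by rewrite oppr_ge0 pmulr_rle0 ?ltr0n // mulr0.
Qed.

Lemma psd_diag0 T (K : T -> T -> C) p q : psd K -> K p p = 0 -> K p q = 0.
Proof.
move=> Kp p0; have := psd_CauchySchwarz p q Kp; rewrite p0 mul0r => E.
apply/eqP; rewrite -normr_eq0 -sqrf_eq0 eq_le E.
by rewrite exprn_ge0.
Qed.

(* One step of Gaussian elimination. *)
Lemma psd_pivot T (K : T -> T -> C) s : psd K ->
  psd (fun u v => K u v - K u s * K s v / K s s).
Proof.
move=> Kp; have [s0|s0] := eqVneq (K s s) 0.
  by apply: eq_psd Kp => u v; rewrite s0 invr0 mulr0 subr0.
move=> l; pose x := \sum_(q <- l) q.1 * K s q.2; pose a := K s s.
have Ca : a^* = a by apply/geC0_conj/psd_diag.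
(* The coefficient at the pivot that minimizes the form. *)
have := Kp ((- (x / a), s) :: l).
rewrite /kform big_cons big_cons /= -/a.
under [X in _ + X]eq_bigr do rewrite big_cons /=.
rewrite big_split /=; congr (0 <= _).
have xC : x^* = \sum_(p <- l) p.1^* * K p.2 s.
  by rewrite rmorph_sum; apply: eq_bigr => p _; rewrite rmorphM /= -(psd_herm s p.2 Kp).
have -> : \sum_(q <- l) (- (x / a))^* * q.1 * K s q.2 = - (x^* / a) * x.
  rewrite mulr_sumr; apply: eq_bigr => q _.
  by rewrite rmorphN rmorphM /= fmorphV /= Ca mulrA.
have -> : \sum_(p <- l) p.1^* * (- (x / a)) * K p.2 s = - (x / a) * x^*.
  by rewrite xC mulr_sumr; apply: eq_bigr => p _; ring.
under [RHS]eq_bigr do under eq_bigr do rewrite mulrBr.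
under [RHS]eq_bigr do rewrite sumrB.
rewrite sumrB; set A := \sum_(p <- l) \sum_(q <- l) _ * K _ _.
have -> : \sum_(p <- l) \sum_(q <- l) p.1^* * q.1 * (K p.2 s * K s q.2 / K s s) = x^* * x / a.
  rewrite xC mulr_suml mulr_suml; apply: eq_bigr => p _.
  rewrite mulr_sumr mulr_suml; apply: eq_bigr => q _; rewrite /a; ring.
rewrite rmorphN rmorphM /= fmorphV /= Ca; field.
by [].
Qed.

(** Elimination with each point of [l] as pivot in turn. The last clause carries the zero columns
    obtained so far through the later pivots. *)
Lemma psd_decompose T (K : T -> T -> C) (l : seq T) : psd K ->
  exists (fs : seq (T -> C)) (K' : T -> T -> C), [/\ psd K',
    forall u v, K u v = \sum_(f <- fs) (f u)^* * f v + K' u v,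
    forall u v, List.In v l -> K' u v = 0 &
    forall v, (forall u, K u v = 0) -> forall u, K' u v = 0].
Proof.
elim: l K => [|s l IH] K Kp.
  by exists [::], K; split=> // u v; rewrite big_nil add0r.
have Kp1 := psd_pivot s Kp; set K1 := (fun u v => _) in Kp1.
have [fs [K' [K'p KE Kl Kz]]] := IH K1 Kp1.
have K1s u : K1 u s = 0.
  rewrite /K1; have [s0|s0] := eqVneq (K s s) 0; last by rewrite mulfK // subrr.
  have -> : K u s = 0 by rewrite (psd_herm s u Kp) psd_diag0 // conjC0.
  by rewrite !mul0r subrr.
pose f v := K s v / sqrtC (K s s).
exists (f :: fs), K'; split=> // [u v|u v [<-|/Kl//]|v v0 u]; last 2 first.
- exact: Kz.
- by apply: Kz => x; rewrite /K1 !v0 mulr0 mul0r subrr.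
rewrite big_cons -addrA -KE /K1 /f rmorphM fmorphV /= -(psd_herm s u Kp).
have -> : (sqrtC (K s s))^* = sqrtC (K s s).
  by apply: geC0_conj; rewrite sqrtC_ge0 psd_diag.
rewrite addrCA [X in _ = _ + X](_ : _ = 0) ?addr0 //; apply/eqP.
have [s0|s0] := eqVneq (K s s) 0.
  by rewrite s0 sqrtC0 invr0 !mulr0 subrr.
rewrite subr_eq0 mulrACA -invfM -expr2 sqrtCK.
by [].
Qed.

(** On the finitely many points of [l] the first kernel is a sum of rank-one kernels, and
    multiplying by a rank-one kernel only rescales the coefficients of the form. *)
Lemma psdM T (K1 K2 : T -> T -> C) : psd K1 -> psd K2 -> psd (fun u v => K1 u v * K2 u v).
Proof.
move=> Kp1 Kp2 l.
have [fs [K' [_ KE Kl _]]] := psd_decompose [seq p.2 | p <- l] Kp1.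
rewrite (_ : kform _ l = kform (fun u v => \sum_(f <- fs) (f u)^* * f v * K2 u v) l).
  apply: psd_sum => f l2; pose h (p : C * T) := (p.1 * f p.2, p.2).
  rewrite (_ : kform _ l2 = kform K2 (map h l2)) //.
  rewrite /kform big_map; apply: eq_bigr => p _; rewrite big_map.
  by apply: eq_bigr => q _ /=; rewrite rmorphM; ring.
rewrite /kform; apply: eq_bigr => p _; elim: {-2}l (@List.incl_refl _ l) => [|q l' IH] ll.
  by rewrite !big_nil.
rewrite !big_cons IH; last by move=> x xl; apply: ll; right.
congr (_ + _); rewrite KE Kl ?addr0 ?mulr_suml //.
by apply: List.in_map; apply: ll; left.
Qed.

Lemma psd_eq (T : Type) (J : finType) (h : T -> J) :
  psd (fun u v => (h u == h v)%:R).
Proof.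
apply: eq_psd (psd_sum (index_enum J) (fun j => psd_rank1 (fun u => (h u == j)%:R))).
move=> u v; rewrite (bigD1 (h v)) //= eqxx mulr1 big1 ?addr0 => [|j jv].
  by rewrite conjC_nat.
by rewrite [h v == j]eq_sym (negbTE jv) mulr0.
Qed.

(** A form involves finitely many points, so positivity can be proved by induction on a bound for
    their size. *)
Lemma psd_trunc T (size : T -> nat) (K : T -> T -> C) :
  (forall n, psd (fun u v => if (size u < n)%N && (size v < n)%N then K u v else 0)) ->
  psd K.
Proof.
move=> Kn l; have := Kn (\max_(p <- l) (size p.2)).+1 l; congr (0 <= _).
have b p : List.In p l -> (size p.2 < (\max_(p <- l) (size p.2)).+1)%N.
  rewrite ltnS; elim: l {Kn} => [//|q l IH] /= [->|/IH pl]; rewrite big_cons ?leq_maxl //.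
  by apply: leq_trans pl _; apply: leq_maxr.
have In_eq (F G : C * T -> C) : (forall p, List.In p l -> F p = G p) ->
    \sum_(p <- l) F p = \sum_(p <- l) G p.
  move: (l) => l'; elim: l' => [|q l' IH] FG; first by rewrite !big_nil.
  by rewrite !big_cons FG ?IH //; [move=> p pl; apply: FG; right | left].
apply: (In_eq (fun p => _)) => p pl; apply: In_eq => q ql.
by rewrite !b.
Qed.

End PositiveKernels.

(** * Factorizations of a word around one letter *)

Section Splits.
Variable I : Type.
Implicit Types w : seq I.

Fixpoint splits w : seq (seq I * I * seq I) :=
  if w is i :: w' then ([::], i, w') :: [seq (i :: p.1.1, p.1.2, p.2) | p <- splits w']
  else [::].

Lemma sum_splits_cons (V : nmodType) (F : seq I -> I -> seq I -> V) i w :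
  \sum_(p <- splits (i :: w)) F p.1.1 p.1.2 p.2 =
  F [::] i w + \sum_(p <- splits w) F (i :: p.1.1) p.1.2 p.2.
Proof. by rewrite big_cons big_map. Qed.

(** Both sides enumerate the factorizations of [w] around two letters, found from the left or from
    the right. *)
Lemma sum_splits_assoc (V : nmodType) (F : seq I -> I -> seq I -> I -> seq I -> V) w :
  \sum_(p <- splits w) \sum_(q <- splits p.2) F p.1.1 p.1.2 q.1.1 q.1.2 q.2 =
  \sum_(p <- splits w) \sum_(q <- splits p.1.1) F q.1.1 q.1.2 q.2 p.1.2 p.2.
Proof.
elim: w F => [|i w IH] F; first by rewrite !big_nil.
rewrite (sum_splits_cons (fun a j b => \sum_(q <- splits b) F a j q.1.1 q.1.2 q.2)).
rewrite (sum_splits_cons (fun a j b => \sum_(q <- splits a) F q.1.1 q.1.2 q.2 j b)).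
rewrite big_nil add0r (IH (fun a => F (i :: a))) -big_split /=.
by apply: eq_bigr => p _; rewrite big_cons big_map.
Qed.

Lemma splits_size w p : List.In p (splits w) ->
  (size p.1.1 < size w)%N /\ (size p.2 < size w)%N.
Proof.
elim: w p => [//|i w IH] p /= [<-//|/List.in_map_iff[q [<- /IH[q1 q2]]]] /=.
by split; [| apply: ltnW].
Qed.

Lemma eq_sum_splits (V : nmodType) (F G : seq I -> I -> seq I -> V) w :
  (forall a i b, (size a < size w)%N -> (size b < size w)%N -> F a i b = G a i b) ->
  \sum_(p <- splits w) F p.1.1 p.1.2 p.2 = \sum_(p <- splits w) G p.1.1 p.1.2 p.2.
Proof.
move=> FG; have : forall p, List.In p (splits w) -> F p.1.1 p.1.2 p.2 = G p.1.1 p.1.2 p.2.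
  by move=> p /splits_size[a b]; apply: FG.
elim: (splits w) => [|p s IH] FG'; first by rewrite !big_nil.
by rewrite !big_cons FG' ?IH; [| move=> q qs; apply: FG'; right | left].
Qed.

End Splits.

Lemma ncs_mul_var_splits (K : fieldType) k (f h : ncseries K k) i w :
  (f * (ncs_var K i * h)) w =
  \sum_(p <- splits w) (p.1.2 == i)%:R * (f p.1.1 * h p.2).
Proof.
elim: w f => [|j w IH] f; first by rewrite big_nil !ncs_mul_nil var_nil mul0r mulr0.
rewrite (sum_splits_cons (fun a j b => (j == i)%:R * (f a * h b))).
rewrite -lderE lderM lder_varM ncs_addE IH !ncs_scaleE mulrCA; congr (_ + _).
Qed.

(** * Positivity of the free convolution *)

Section WordKernels.
Variables (R : realType) (k : nat) (nu : dalg R k) (t : R).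
Hypothesis t_ge0 : 0 <= t.
Local Notation C := R[i].
Local Notation S := (ncseries C k).
Local Notation word := (seq 'I_k).
Local Notation c := (t%:C%C : C).
Local Notation sigma := (resolvent nu t (model_vac nu)).
Implicit Types (u v w : word) (g : S) (i : 'I_k).
Hypothesis nu_psd : psd (fun u v => gser nu (rev u ++ v)).

Let T g : S := resolvent nu t (emb g).

Lemma c_ge0 : 0 <= c. Proof. by rewrite -[0 <= _]/((real_complex R 0) <= _) lecR. Qed.

Lemma c_conj : c^* = c. Proof. exact/geC0_conj/c_ge0. Qed.

Lemma T_nil g : T g [::] = g [::]. Proof. exact: resolvent_nil. Qed.

Lemma T_cons g i w : T g (i :: w) = T (lder i g) w +
  c * \sum_(p <- splits w) (p.1.2 == i)%:R * (sigma p.1.1 * T g p.2).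
Proof.
rewrite -lderE /T lder_resolvent /yop lend_addE xopE sopE resolventD.
rewrite lder_x_emb lder_e_emb add0r resolventZ -mulrA resolvent_split.
by rewrite ncs_addE ncs_scaleE ncs_mul_var_splits.
Qed.

(** Each coefficient is the pairing of [g] with a fixed polynomial. This makes [kB] a pullback of
    the kernel of [nu], hence positive. *)
Lemma T_finite w : exists l : seq (C * word), forall g, T g w = \sum_(p <- l) p.1 * g p.2.
Proof.
have [n] := ubnP (size w); elim: n w => [//|n IH] [|i w] wn.
  by exists [:: (1, [::])] => g; rewrite T_nil big_seq1 mul1r.
have [l1 E1] := IH w wn.
have [l2 E2] : exists l : seq (C * word), forall g,
    \sum_(p <- splits w) (p.1.2 == i)%:R * (sigma p.1.1 * T g p.2) =
    \sum_(p <- l) p.1 * g p.2.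
  have : forall p, List.In p (splits w) -> (size p.2 < n)%N.
    by move=> p /splits_size[_ pw]; apply: ltn_trans pw wn.
  elim: (splits w) => [|p s IHs] sn; first by exists [::] => g; rewrite !big_nil.
  have [l El] := IHs (fun q qs => sn q (or_intror qs)).
  have [l' El'] := IH p.2 (sn p (or_introl erefl)).
  exists ([seq ((p.1.2 == i)%:R * (sigma p.1.1 * q.1), q.2) | q <- l'] ++ l) => g.
  rewrite big_cons El big_cat big_map El' /=; congr (_ + _).
  by rewrite !mulr_sumr; apply: eq_bigr => q _ /=; ring.
exists ([seq (p.1, i :: p.2) | p <- l1] ++ [seq (c * p.1, p.2) | p <- l2]) => g.
rewrite T_cons E1 E2 big_cat !big_map mulr_sumr /=; congr (_ + _).
by apply: eq_bigr => p _; rewrite mulrA.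
Qed.

Definition coefs w := sval (cid (T_finite w)).

Lemma coefsE w g : T g w = \sum_(p <- coefs w) p.1 * g p.2.
Proof. exact: (svalP (cid (T_finite w))). Qed.

Lemma nu_rev w : gser nu (rev w) = (gser nu w)^*.
Proof. by have := psd_herm [::] w nu_psd; rewrite cats0. Qed.

(* With [E w] the polynomial whose coefficients are [coefs w], [kB u v] is
   [nu (E(u)^* E(v))] and [kD i u v] is [nu (E(u)^* X_i E(v))]. *)
Let gu u : S := fun a => \sum_(p <- coefs u) p.1^* * gser nu (rev p.2 ++ a).
Definition kB u v : C := T (gu u) v.
Definition kD i u v : C := T (lder i (gu u)) v.

Lemma kBE u v : kB u v =
  \sum_(p <- coefs u) \sum_(q <- coefs v) p.1^* * q.1 * gser nu (rev p.2 ++ q.2).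
Proof.
rewrite /kB coefsE exchange_big; apply: eq_bigr => q _ /=.
by rewrite mulr_sumr; apply: eq_bigr => p _; rewrite mulrCA mulrA.
Qed.

Lemma kDE i u v : kD i u v =
  \sum_(p <- coefs u) \sum_(q <- coefs v) p.1^* * q.1 * gser nu (rev p.2 ++ i :: q.2).
Proof.
rewrite /kD coefsE exchange_big; apply: eq_bigr => q _ /=.
by rewrite lderE mulr_sumr; apply: eq_bigr => p _; rewrite mulrCA mulrA.
Qed.

Lemma kB_psd : psd kB.
Proof. by apply: eq_psd (psd_lin coefs nu_psd) => u v; rewrite kBE. Qed.

Lemma kD_herm i u v : kD i v u = (kD i u v)^*.
Proof.
rewrite !kDE rmorph_sum exchange_big; apply: eq_bigr => p _ /=.
rewrite rmorph_sum; apply: eq_bigr => q _ /=.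
rewrite !rmorphM /= conjCK -nu_rev rev_cat rev_cons revK cat_rcons.
by rewrite (mulrC p.1).
Qed.

Lemma kB_cons i u v : kB u (i :: v) = kD i u v +
  c * \sum_(p <- splits v) (p.1.2 == i)%:R * (sigma p.1.1 * kB u p.2).
Proof. exact: T_cons. Qed.

Lemma kB_consl i u v : kB (i :: u) v = kD i u v +
  c * \sum_(p <- splits u) (p.1.2 == i)%:R * ((sigma p.1.1)^* * kB p.2 v).
Proof.
rewrite (psd_herm v _ kB_psd) kB_cons rmorphD rmorphM /= c_conj -kD_herm; congr (_ + _ * _).
rewrite rmorph_sum; apply: eq_bigr => p _.
by rewrite !rmorphM /= conjC_nat -(psd_herm v p.2 kB_psd).
Qed.

Lemma kB_nil v : kB [::] v = sigma v.
Proof.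
rewrite /kB (_ : gu [::] = gser nu) //; apply/funext => a.
(* [coefs [::]] is known only through its pairing with series; pairing with a conjugated series
   reaches the conjugated coefficients. *)
transitivity (\sum_(p <- coefs [::]) p.1 * (gser nu (rev p.2 ++ a))^*)^*.
  by rewrite rmorph_sum; apply: eq_bigr => p _; rewrite rmorphM /= conjCK.
by rewrite -(coefsE [::] (fun b => (gser nu (rev b ++ a))^*)) T_nil /= conjCK.
Qed.

Lemma kB_nilr u : kB u [::] = (sigma u)^*.
Proof. by rewrite (psd_herm [::] u kB_psd) kB_nil. Qed.

Definition kS u v : C := sigma (rev u ++ v).

Lemma kS_consl i u v : kS (i :: u) v = kS u (i :: v).
Proof. by rewrite /kS rev_cons cat_rcons. Qed.

(** In combinatorial terms, the sum runs over the innermost semicircular contraction joining a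
    letter of [u] to one of [v]. Prefixes are next to the cut in [rev u ++ v], so [kB] is the part
    inside the contraction and [kS] the part outside. *)
Definition kS_rhs u v : C := kB u v + c *
  \sum_(p <- splits u) \sum_(q <- splits v)
    (p.1.2 == q.1.2)%:R * (kB p.1.1 q.1.1 * kS p.2 q.2).

Let sym_part i u v : C := kD i u v + c *
  \sum_(p <- splits u) \sum_(q <- splits v)
    (p.1.2 == q.1.2)%:R * (kD i p.1.1 q.1.1 * kS p.2 q.2).

(** The letter i either acts as a variable of [nu] ([sym_part]), or is contracted with a letter of
    [u], or with a letter of [v]. Only the first case is literally the same when i stands in front
    of [u]. *)
Lemma kS_rhs_consr i u v : kS_rhs u (i :: v) = sym_part i u v
  + c * (\sum_(p <- splits u) (p.1.2 == i)%:R * ((sigma p.1.1)^* * kS p.2 v))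
  + c * (\sum_(q <- splits v) (q.1.2 == i)%:R * (sigma q.1.1 * kS_rhs u q.2)).
Proof.
have E (p : word * 'I_k * word) : \sum_(q <- splits (i :: v))
      (p.1.2 == q.1.2)%:R * (kB p.1.1 q.1.1 * kS p.2 q.2) =
    (p.1.2 == i)%:R * ((sigma p.1.1)^* * kS p.2 v) +
    (\sum_(q <- splits v) (p.1.2 == q.1.2)%:R * (kD i p.1.1 q.1.1 * kS p.2 q.2) +
     c * \sum_(q <- splits v) (q.1.2 == i)%:R * (sigma q.1.1 *
       \sum_(r <- splits q.2) (p.1.2 == r.1.2)%:R * (kB p.1.1 r.1.1 * kS p.2 r.2))).
  rewrite (sum_splits_cons (fun a j b => (p.1.2 == j)%:R * (kB p.1.1 a * kS p.2 b))).
  rewrite kB_nilr; congr (_ + _).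
  (* Expanding [kB] splits a prefix of [v] once more; [sum_splits_assoc] turns this into splitting
     the suffix, where [kS_rhs] reappears. *)
  pose F a j b l d : C := (j == i)%:R * (sigma a * ((p.1.2 == l)%:R * (kB p.1.1 b * kS p.2 d))).
  transitivity (\sum_(q <- splits v) (p.1.2 == q.1.2)%:R * (kD i p.1.1 q.1.1 * kS p.2 q.2) +
     c * \sum_(q <- splits v) \sum_(r <- splits q.1.1) F r.1.1 r.1.2 r.2 q.1.2 q.2).
    rewrite mulr_sumr -big_split; apply: eq_bigr => q _ /=.
    rewrite kB_cons mulrDl mulrDr; congr (_ + _).
    rewrite -mulrA mulrCA mulr_suml mulr_sumr; congr (_ * _); apply: eq_bigr => r _.
    by rewrite /F; ring.
  rewrite -sum_splits_assoc; congr (_ + _ * _); apply: eq_bigr => q _.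
  by rewrite /F -!mulr_sumr.
rewrite {1}/kS_rhs /sym_part kB_cons.
under [X in _ + c * X = _]eq_bigr do rewrite E.
rewrite !big_split /=.
set A := \sum_(p <- splits v) _ * (_ * kB u _).
set B := \sum_(p <- splits u) _ * ((sigma _)^* * _).
set D := \sum_(p <- splits u) \sum_(q <- splits v) _ * (kD _ _ _ * _).
have -> : \sum_(q <- splits v) (q.1.2 == i)%:R * (sigma q.1.1 * kS_rhs u q.2) =
   A + \sum_(p <- splits u) c * (\sum_(q <- splits v) (q.1.2 == i)%:R * (sigma q.1.1 *
       \sum_(r <- splits q.2) (p.1.2 == r.1.2)%:R * (kB p.1.1 r.1.1 * kS p.2 r.2))).
  rewrite -mulr_sumr exchange_big mulr_sumr -big_split; apply: eq_bigr => q _ /=.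
  rewrite -!mulr_sumr /kS_rhs; ring.
by ring.
Qed.

Lemma kS_rhs_consl i u v : kS_rhs (i :: u) v = sym_part i u v
  + c * (\sum_(q <- splits v) (q.1.2 == i)%:R * (sigma q.1.1 * kS u q.2))
  + c * (\sum_(p <- splits u) (p.1.2 == i)%:R * ((sigma p.1.1)^* * kS_rhs p.2 v)).
Proof.
have E (q : word * 'I_k * word) : \sum_(p <- splits (i :: u))
      (p.1.2 == q.1.2)%:R * (kB p.1.1 q.1.1 * kS p.2 q.2) =
    (q.1.2 == i)%:R * (sigma q.1.1 * kS u q.2) +
    (\sum_(p <- splits u) (p.1.2 == q.1.2)%:R * (kD i p.1.1 q.1.1 * kS p.2 q.2) +
     c * \sum_(p <- splits u) (p.1.2 == i)%:R * ((sigma p.1.1)^* *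
       \sum_(r <- splits p.2) (r.1.2 == q.1.2)%:R * (kB r.1.1 q.1.1 * kS r.2 q.2))).
  rewrite (sum_splits_cons (fun a j b => (j == q.1.2)%:R * (kB a q.1.1 * kS b q.2))).
  rewrite kB_nil [i == _]eq_sym; congr (_ + _).
  pose F a j b l d : C := (j == i)%:R * ((sigma a)^* * ((l == q.1.2)%:R * (kB b q.1.1 * kS d q.2))).
  transitivity (\sum_(p <- splits u) (p.1.2 == q.1.2)%:R * (kD i p.1.1 q.1.1 * kS p.2 q.2) +
     c * \sum_(p <- splits u) \sum_(r <- splits p.1.1) F r.1.1 r.1.2 r.2 p.1.2 p.2).
    rewrite mulr_sumr -big_split; apply: eq_bigr => p _ /=.
    rewrite kB_consl mulrDl mulrDr; congr (_ + _).
    rewrite -mulrA mulrCA mulr_suml mulr_sumr; congr (_ * _); apply: eq_bigr => r _.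
    by rewrite /F; ring.
  rewrite -sum_splits_assoc; congr (_ + _ * _); apply: eq_bigr => p _.
  by rewrite /F -!mulr_sumr.
rewrite {1}/kS_rhs /sym_part kB_consl exchange_big /=.
under [X in _ + c * X = _]eq_bigr do rewrite E.
rewrite !big_split /= [X in _ = _ + c * X + _ + _]exchange_big /=.
set A := \sum_(p <- splits u) _ * ((sigma _)^* * kB _ v).
set B := \sum_(p <- splits v) _ * (sigma _ * _).
set D := \sum_(p <- splits v) \sum_(q <- splits u) _ * (kD _ _ _ * _).
have -> : \sum_(p <- splits u) (p.1.2 == i)%:R * ((sigma p.1.1)^* * kS_rhs p.2 v) =
   A + \sum_(q <- splits v) c * (\sum_(p <- splits u) (p.1.2 == i)%:R * ((sigma p.1.1)^* *
       \sum_(r <- splits p.2) (r.1.2 == q.1.2)%:R * (kB r.1.1 q.1.1 * kS r.2 q.2))).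
  rewrite -mulr_sumr exchange_big mulr_sumr -big_split; apply: eq_bigr => p _ /=.
  rewrite -!mulr_sumr /kS_rhs [X in _ = _ + _ * (_ * (_ * X))]exchange_big /=; ring.
by ring.
Qed.

(* Both sides are unchanged when a letter moves from [u] to [v]. *)
Lemma kS_rec u v : kS u v = kS_rhs u v.
Proof.
have [n] := ubnP (size u + size v); elim: n u v => [//|n IH] u v.
(* The inner induction moves letters across the cut; the outer one, on the total length, exchanges
   [kS] and [kS_rhs] in the two contraction terms. *)
elim: u v => [|i u IHu] v uvn.
  by rewrite /kS_rhs big_nil mulr0 addr0 kB_nil.
rewrite kS_consl IHu; last by move: uvn => /=; rewrite addnS.
rewrite kS_rhs_consr kS_rhs_consl [LHS]addrAC; congr (_ + _ + _); congr (_ * _).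
  apply: (@eq_sum_splits _ _ (fun a j b => (j == i)%:R * (sigma a * kS_rhs u b))
    (fun a j b => (j == i)%:R * (sigma a * kS u b))) => a j b _ bv.
  by rewrite IH //; move: uvn bv => /=; lia.
apply: (@eq_sum_splits _ _ (fun a j b => (j == i)%:R * ((sigma a)^* * kS b v))
    (fun a j b => (j == i)%:R * ((sigma a)^* * kS_rhs b v))) => a j b _ bu.
by rewrite IH //; move: uvn bu => /=; lia.
Qed.

(** [kS] reappears in its own recursion, but only at strictly shorter words, so its truncations are
    treated by induction on the length. *)
Lemma kS_psd : psd kS.
Proof.
apply: (psd_trunc (size := size)); elim=> [|n IH].
  by apply: eq_psd (@psd0 R word) => u v.
pose Kn u v := if (size u < n)%N && (size v < n)%N then kS u v else 0.
pose K3 (p q : word * 'I_k * word) := (p.1.2 == q.1.2)%:R * (kB p.1.1 q.1.1 * Kn p.2 q.2).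
have K3p : psd K3.
  apply: psdM; first exact: (psd_eq (fun p : word * 'I_k * word => p.1.2)).
  apply: psdM; first exact: (psd_comp (fun p : word * 'I_k * word => p.1.1) kB_psd).
  exact: (psd_comp (fun p : word * 'I_k * word => p.2) IH).
pose h (u : word) := [seq ((1 : C), p) | p <- splits u].
have := psdD kB_psd (psdZ c_ge0 (psd_lin h K3p)); set K' := (fun u v => _) => K'p.
(* Sending long words to the empty combination makes the truncated kernel a pullback. *)
pose h' (u : word) := if (size u < n.+1)%N then [:: ((1 : C), u)] else [::].
apply: eq_psd (psd_lin h' K'p) => u v; rewrite /h'.
case: ifPn => un /=; last by rewrite big_nil.
case: ifPn => vn /=; last by rewrite big_seq1 big_nil.
rewrite !big_seq1 /= conjC1 !mul1r /K' kS_rec /kS_rhs; congr (_ + _ * _).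
transitivity (\sum_(p <- splits u) \sum_(q <- splits v) K3 p q); last first.
  apply/esym/(@eq_sum_splits _ _ (fun a j b => \sum_(q <- splits v) (j == q.1.2)%:R * (kB a q.1.1 * kS b q.2))
    (fun a j b => \sum_(q <- splits v) K3 (a, j, b) q)) => a j b au bu.
  apply: (@eq_sum_splits _ _ (fun a' j' b' => (j == j')%:R * (kB a a' * kS b b'))
    (fun a' j' b' => K3 (a, j, b) (a', j', b'))) => a' j' b' av bv.
  rewrite /K3 /Kn /=.
  by rewrite (leq_trans bu un) (leq_trans bv vn).
rewrite big_map; apply: eq_bigr => p _; rewrite big_map; apply: eq_bigr => q _.
by rewrite /= conjC1 !mul1r.
Qed.

End WordKernels.

(** * Positivity and growth for [Phi] *)

Section PhiKernel.
Variables (R : realType) (k : nat).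
Local Notation C := R[i].
Local Notation S := (ncseries C k).
Local Notation word := (seq 'I_k).
Implicit Types (u v w : word) (i : 'I_k).

Lemma gser_Phi_cons (s : dalg R k) i w : gser (Phi s) (i :: w) =
  \sum_(p <- splits w) (p.1.2 == i)%:R * (gser s p.1.1 * gser (Phi s) p.2).
Proof.
set P := gser (Phi s).
have PE : P = (1 - Phi_eta (gser s))^-1.
  by apply/eta_series_eq; [apply: Phi_eta_nil | apply: eta_series_Phi].
have {PE} PE : P = 1 + Phi_eta (gser s) * P.
  have : (1 - Phi_eta (gser s)) * P = 1.
    by rewrite PE mulsV // ncs_addE ncs_oppE Phi_eta_nil subr0 oner_neq0.
  by rewrite mulrBl mul1r => /(canRL (subrK _)).
have := congr1 (fun f => lder i f w) PE.
rewrite /= lderD lder1 add0r /Phi_eta mulr_suml.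
rewrite (eq_bigr (fun j => ncs_var C j * (gser s * (ncs_var C j * P)))) => [|j _]; last first.
  by rewrite -!mulrA.
by rewrite lder_sum_varM ncs_mul_var_splits lderE.
Qed.

Variable s : dalg R k.
Local Notation G := (gser s).
Local Notation P := (gser (Phi s)).
Hypothesis s_psd : psd (fun u v => G (rev u ++ v)).

Let kS u v := G (rev u ++ v).

(** The series of [Phi s] is a sum of products of blocks z_i G z_i. The cut in [rev u ++ v] falls
    between two blocks, which gives the rank-one term, or inside one block, whose two end letters
    are those singled out in [u] and [v]. *)
Let kP_rhs u v : C := (P u)^* * P v +
  \sum_(p <- splits u) \sum_(q <- splits v)
    (p.1.2 == q.1.2)%:R * ((P p.2)^* * P q.2 * kS p.1.1 q.1.1).

Let kP_rhs_cons i u v : kP_rhs u (i :: v) = kP_rhs (i :: u) v.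
Proof.
rewrite /kP_rhs.
under eq_bigr => p _ do
  rewrite (sum_splits_cons (fun a j b => (p.1.2 == j)%:R * ((P p.2)^* * P b * kS p.1.1 a))).
rewrite (sum_splits_cons (fun a j b => \sum_(q <- splits v) (j == q.1.2)%:R * ((P b)^* * P q.2 * kS a q.1.1))).
rewrite !big_split /= [RHS]addrCA [LHS]addrA [RHS]addrA; congr (_ + _ + _).
- rewrite gser_Phi_cons mulr_sumr; apply: eq_bigr => q _.
  by rewrite [i == _]eq_sym /kS /=; ring.
- rewrite gser_Phi_cons rmorph_sum mulr_suml; apply: eq_bigr => p _ /=.
  rewrite !rmorphM /= conjC_nat /kS (psd_herm [::] p.1.1 s_psd); ring.
- apply: eq_bigr => p _; apply: eq_bigr => q _.
  by rewrite /kS rev_cons cat_rcons.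
Qed.

Lemma gser_Phi_rev u v : P (rev u ++ v) = kP_rhs u v.
Proof.
elim: u v => [|i u IH] v.
  by rewrite /kP_rhs big_nil addr0 gser_nil conjC1 mul1r.
by rewrite rev_cons cat_rcons IH kP_rhs_cons.
Qed.

Lemma Phi_psd : psd (fun u v => P (rev u ++ v)).
Proof.
pose K3 (p q : word * 'I_k * word) :=
  (p.1.2 == q.1.2)%:R * ((P p.2)^* * P q.2 * kS p.1.1 q.1.1).
have K3p : psd K3.
  apply: psdM; first exact: (psd_eq (fun p : word * 'I_k * word => p.1.2)).
  apply: psdM; first exact: (psd_rank1 (fun p : word * 'I_k * word => P p.2)).
  exact: (psd_comp (fun p : word * 'I_k * word => p.1.1) s_psd).
pose h (u : word) := [seq ((1 : C), p) | p <- splits u].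
apply: eq_psd (psdD (psd_rank1 P) (psd_lin h K3p)) => u v.
rewrite gser_Phi_rev; congr (_ + _); rewrite big_map; apply: eq_bigr => p _.
by rewrite big_map; apply: eq_bigr => q _; rewrite /= conjC1 !mul1r.
Qed.

Lemma sum_splits_geometric (D : C) w :
  \sum_(p <- splits w) D ^+ size p.1.1 * (D + 1) ^+ size p.2 + D ^+ size w =
  (D + 1) ^+ size w.
Proof.
elim: w => [|i w IH]; first by rewrite big_nil add0r.
rewrite (sum_splits_cons (fun a j b => D ^+ size a * (D + 1) ^+ size b)) /=.
under eq_bigr do rewrite exprS -mulrA.
by rewrite -mulr_sumr (canRL (addrK _) IH) !exprS; ring.
Qed.

(** With base D + 1 the convolution of D^a and (D + 1)^b telescopes to (D + 1)^n - D^n, so the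
    recursion preserves the bound. *)
Lemma Phi_growth (D : C) : 0 <= D -> (forall w, `|G w| <= D ^+ size w) ->
  forall w, `|P w| <= (D + 1) ^+ size w.
Proof.
move=> D0 GD w; have E0 : 0 <= D + 1 by rewrite addr_ge0.
have [n] := ubnP (size w); elim: n w => [//|n IH] [|i w] wn.
  by rewrite gser_nil normr1.
rewrite gser_Phi_cons; apply: le_trans (ler_norm_sum _ _ _) _.
pose F (a : word) (j : 'I_k) (b : word) := D ^+ size a * (D + 1) ^+ size b.
apply: (@le_trans _ _ (\sum_(p <- splits w) F p.1.1 p.1.2 p.2)).
  have : forall p, List.In p (splits w) -> (size p.2 < n)%N.
    by move=> p /splits_size[_ pw]; apply: ltn_trans pw wn.
  elim: (splits w) => [|p l IHl] ln; first by rewrite !big_nil.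
  rewrite !big_cons lerD ?IHl //; last by move=> q ql; apply: ln; right.
  rewrite !normrM -[X in _ <= X]mul1r ler_pM ?mulr_ge0 //.
    by rewrite normr_nat; case: (_ == _).
  by rewrite ler_pM // IH //; apply: ln; left.
rewrite -[X in X <= _](addrK (D ^+ size w)) sum_splits_geometric.
apply: (@le_trans _ _ ((D + 1) ^+ size w)).
  by rewrite gerBl exprn_ge0.
by rewrite ler_weXn2l // lerDr.
Qed.

End PhiKernel.

(** * Geometric growth of the moments of the convolution *)

Section FreeGrowth.
Variables (R : realType) (k : nat) (nu : dalg R k) (t : R).
Hypothesis t_ge0 : 0 <= t.
Local Notation C := R[i].
Local Notation S := (ncseries C k).
Local Notation W := (ncseries C (k + k)).
Local Notation c := (t%:C%C : C).
Variable M : C.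
Hypothesis M_ge1 : 1 <= M.
Hypothesis nu_growth : forall w, `|gser nu w| <= M ^+ size w.

Let M0 : 0 <= M. Proof. exact: le_trans ler01 M_ge1. Qed.

(** No factor depending on the length of [w] appears: an embedded series vanishes on words with an
    [el] letter, so only the factorization at the first such letter of [w] contributes. *)
Lemma emb_mul_growth (a b : C) (g : S) (f : W) i w : 0 <= a -> 0 <= b ->
  (forall v, `|g v| <= a * M ^+ size v) -> (forall v, `|f v| <= b * M ^+ size v) ->
  `|(emb g * (ncs_var C (el i) * f)) w| <= a * b * M ^+ size w.
Proof.
move=> a0 b0 + fM; elim: w g a a0 => [|l w IH] g a a0 gM.
  by rewrite !ncs_mul_nil var_nil mul0r mulr0 normr0 !mulr_ge0 // exprn_ge0.
rewrite -lderE lderM lder_varM; case: (letterP l) => -[j ->].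
  rewrite eq_xel scale0r scaler0 add0r lder_x_emb /=.
  have -> : a * b * M ^+ (size w).+1 = a * M * b * M ^+ size w by rewrite exprS; ring.
  apply: IH; first by rewrite mulr_ge0.
  by move=> v; rewrite lderE -mulrA -exprS; apply: (gM (j :: v)).
rewrite lder_e_emb mul0r addr0 eq_el !ncs_scaleE emb_nil !normrM.
apply: (@le_trans _ _ (a * b * M ^+ size w)).
  rewrite -mulrA ler_pM ?mulr_ge0 //; first by have := gM [::]; rewrite expr0 mulr1.
  rewrite -[X in _ <= X]mul1r ler_pM //.
  by rewrite normr_nat; case: (_ == _).
by rewrite ler_wpM2l ?mulr_ge0 // /= ler_weXn2l.
Qed.

(** Each of the two derivatives reads a word longer by one letter and costs M; creation costs c. *)
Lemma yop_growth (b : C) (f : W) i : 0 <= b ->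
  (forall v, `|f v| <= b * M ^+ size v) ->
  forall v, `|yop nu t i f v| <= b * (2 * M + c) * M ^+ size v.
Proof.
move=> b0 fM v; rewrite /yop lend_addE xopE sopE !ncs_addE !lderE ncs_scaleE -mulrA.
have NM : forall v, `|gser nu v| <= 1 * M ^+ size v by move=> u; rewrite mul1r.
apply: le_trans (ler_normD _ _) _.
apply: (@le_trans _ _ (b * M ^+ (size v).+1 + (b * M ^+ (size v).+1 + c * (b * M ^+ size v)))).
  apply: lerD; first exact: (fM (xl i :: v)).
  apply: le_trans (ler_normD _ _) _; apply: lerD; first exact: (fM (el i :: v)).
  rewrite normrM (ger0_norm (c_ge0 t_ge0)) ler_wpM2l ?c_ge0 //.
  by rewrite -[b]mul1r; apply: emb_mul_growth.
rewrite exprS le_eqVlt; apply/orP; left; apply/eqP; ring.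
Qed.

Lemma resolvent_growth (b : C) (f : W) w : 0 <= b ->
  (forall v, `|f v| <= b * M ^+ size v) ->
  `|resolvent nu t f w| <= b * (2 * M + c) ^+ size w.
Proof.
elim: w f b => [|i w IH] f b b0 fM; first by rewrite resolvent_nil (fM [::]).
rewrite -lderE lder_resolvent /= exprS mulrA; apply: IH; last exact: yop_growth.
by rewrite mulr_ge0 // addr_ge0 ?mulr_ge0 ?c_ge0.
Qed.

Lemma xword_size (w : seq 'I_(k + k)) (v : seq 'I_k) : xword w = Some v -> size v = size w :> nat.
Proof.
elim: w v => [|l w IH] v /=; first by move=> [<-].
case: (fintype.split l) => // i; case E : (xword w) => [u|] //= [<-] /=.
by rewrite (IH u).
Qed.

Lemma sigma_growth w :
  `|resolvent nu t (model_vac nu) w| <= (2 * M + c) ^+ size w.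
Proof.
rewrite -[X in _ <= X]mul1r; apply: resolvent_growth => // v; rewrite mul1r /model_vac /emb.
case E : (xword v) => [u|]; last by rewrite normr0 exprn_ge0.
by rewrite -(xword_size E).
Qed.

End FreeGrowth.

Lemma half_pow_small (R : realType) (e : R) : 0 < e -> exists n, (2^-1 : R) ^+ n < e.
Proof.
move=> e0; have [n _ ne] := near_infty_natSinv_expn_lt (PosNum e0).
by exists n; have := ne n (leqnn n); rewrite /= div1r exprVn.
Qed.

(** * States of C*-algebras: positivity and growth of the moments *)

Section CStarStates.
Variables (R : realType) (A : cstarAlgType R).
Local Notation C := R[i].
Local Notation N := (@cnorm R A).
Local Notation st := (@star R A).
Implicit Types (a b h : A).

Lemma normc_real (x : R) : ComplexField.Normc.normc (x%:C%C) = `|x|.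
Proof. by rewrite /= expr0n addr0 sqrtr_sqr. Qed.

Lemma conj_realC (x : R) : (x%:C%C : C)^* = x%:C%C.
Proof. exact: conjc_real. Qed.

Lemma cnorm0 : N 0 = 0.
Proof. by rewrite -(scale0r (0 : A)) cnormZ (normc_real 0) normr0 mul0r. Qed.

Lemma cnormN a : N (- a) = N a.
Proof.
rewrite -scaleN1r cnormZ (_ : -1 = (-1)%:C%C) ?normc_real ?normrN1 ?mul1r //.
by rewrite rmorphN1.
Qed.

Lemma cnorm_ge0 a : 0 <= N a.
Proof. by have := cnormD a (- a); rewrite subrr cnorm0 cnormN; lra. Qed.

Lemma cnormB_le a b c : N (a - b) <= N (a - c) + N (b - c).
Proof. by rewrite -[N (b - c)]cnormN opprB; have := cnormD (a - c) (c - b); rewrite addrA subrK. Qed.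

Lemma star_cnorm a : N (st a) = N a.
Proof.
have le b : N b <= N (st b).
  have [->|b0] := eqVneq (N b) 0; first exact: cnorm_ge0.
  have bp : 0 < N b by rewrite lt_def b0 cnorm_ge0.
  by rewrite -(ler_pM2r bp) -expr2 -cnorm_star cnormM.
by apply/le_anti; rewrite le -{2}[a]starK le.
Qed.

Lemma star1 : st 1 = 1.
Proof. by have := starM (st 1) (1 : A); rewrite mulr1 !starK mulr1. Qed.

Lemma star0 : st 0 = 0.
Proof. by apply: (addrI (st 0)); rewrite -starD !addr0. Qed.

Lemma starN a : st (- a) = - st a.
Proof. by apply/eqP; rewrite -addr_eq0 -starD addNr star0. Qed.

Lemma starB a b : st (a - b) = st a - st b.
Proof. by rewrite starD starN. Qed.

Lemma star_sum (I : Type) (r : seq I) (F : I -> A) :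
  st (\sum_(i <- r) F i) = \sum_(i <- r) st (F i).
Proof. exact: (big_morph st starD star0). Qed.

Lemma star_prod (I : Type) (r : seq I) (F : I -> A) :
  st (\prod_(i <- r) F i) = \prod_(i <- rev r) st (F i).
Proof.
elim: r => [|i r IH]; first by rewrite !big_nil star1.
by rewrite big_cons starM IH rev_cons -cats1 big_cat big_seq1.
Qed.

Lemma cnorm1_le1 : N 1 <= 1.
Proof.
have := cnorm_star (1 : A); rewrite star1 mulr1 expr2 => E.
have [->//|n0] := eqVneq (N 1) 0.
by rewrite -[X in _ <= X](mulfV n0) {2}E mulfK.
Qed.

Lemma cnorm_half a : N ((2^-1 : R)%:C%C *: a) = 2^-1 * N a.
Proof. by rewrite cnormZ normc_real ger0_norm // invr_ge0. Qed.

Section SquareRoot.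
Variable h : A.
Hypotheses (h_sa : st h = h) (h_half : N h <= 2^-1).

(* The fixed point [l] of [y |-> (h + y^2) / 2] satisfies [(1 - l)^2 = 1 - h]. *)
Fixpoint sqrt_iter n : A :=
  if n is n'.+1 then (2^-1 : R)%:C%C *: (h + sqrt_iter n' * sqrt_iter n') else 0.
Local Notation y := sqrt_iter.

Lemma sqrt_iter_sa n : st (y n) = y n.
Proof.
elim: n => [|n IH]; first exact: star0.
by rewrite starZ starD starM IH h_sa conj_realC.
Qed.

Lemma sqrt_iter_le n : N (y n) <= 2^-1.
Proof.
elim: n => [|n IH] /=; first by rewrite cnorm0 invr_ge0.
rewrite cnorm_half; have := cnormD h (y n * y n); have := cnormM (y n) (y n).
have := ler_pM (cnorm_ge0 (y n)) (cnorm_ge0 (y n)) IH IH; move: h_half; lra.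
Qed.

Lemma sqrt_iter_step n : N (y n.+1 - y n) <= (2^-1) ^+ n.+1.
Proof.
elim: n => [|n IH].
  rewrite subr0 expr1 /= mul0r addr0 cnorm_half; move: h_half; lra.
have -> : y n.+2 - y n.+1 = (2^-1 : R)%:C%C *:
    (y n.+1 * (y n.+1 - y n) + (y n.+1 - y n) * y n).
  rewrite [y n.+2]/= [X in _ - X]/= -scalerBr; congr (_ *: _).
  rewrite mulrBr mulrBl opprD addrACA subrr add0r.
  by rewrite [RHS]addrA subrK.
rewrite cnorm_half exprS; apply: ler_wpM2l; first by rewrite invr_ge0.
have := cnormD (y n.+1 * (y n.+1 - y n)) ((y n.+1 - y n) * y n).
have := cnormM (y n.+1) (y n.+1 - y n); have := cnormM (y n.+1 - y n) (y n).
have := ler_wpM2r (cnorm_ge0 (y n.+1 - y n)) (sqrt_iter_le n.+1).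
have := ler_wpM2l (cnorm_ge0 (y n.+1 - y n)) (sqrt_iter_le n).
move: IH; lra.
Qed.

Lemma sqrt_iter_dist n m : N (y (n + m)%N - y n) <= (2^-1) ^+ n.
Proof.
suff : N (y (n + m)%N - y n) <= (2^-1) ^+ n - (2^-1) ^+ (n + m)%N.
  by move/le_trans; apply; rewrite gerBl exprn_ge0 ?invr_ge0.
elim: m => [|m IH]; first by rewrite addn0 !subrr cnorm0.
rewrite addnS; have := cnormD (y (n + m).+1 - y (n + m)%N) (y (n + m)%N - y n).
rewrite addrA subrK; have := sqrt_iter_step (n + m).
by rewrite exprS; move: ((2^-1 : R) ^+ (n + m)%N) ((2^-1 : R) ^+ n) IH => p q *; lra.
Qed.

Lemma sqrt_iter_limit : exists2 l, st l = l & (1 - l) * (1 - l) = 1 - h.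
Proof.
have [l lim] : exists l, forall e : R, 0 < e -> exists n0, forall n, (n0 <= n)%N -> N (y n - l) < e.
  apply: cnorm_complete => e e0; have [n0 n0e] := half_pow_small (divr_gt0 e0 (ltr0Sn _ 1)).
  exists n0 => m n /subnKC <- /subnKC <-; apply: le_lt_trans (cnormB_le _ _ (y n0)) _.
  rewrite (splitr e); apply: ltrD.
    exact: le_lt_trans (sqrt_iter_dist n0 (m - n0)) n0e.
  exact: le_lt_trans (sqrt_iter_dist n0 (n - n0)) n0e.
have small a : (forall e : R, 0 < e -> N a <= e) -> a = 0.
  move=> ae; apply: cnorm_eq0; apply/le_anti; rewrite cnorm_ge0 andbT.
  by apply/ler_addgt0Pl => e e0; rewrite addr0; apply: ae.
exists l.
  apply/eqP; rewrite -subr_eq0; apply/eqP; apply: small => e e0.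
  have [n0 /(_ n0 (leqnn _)) n0e] := lim (e / 2) (divr_gt0 e0 (ltr0Sn _ 1)).
  have := cnormB_le (st l) l (y n0).
  rewrite -{1}(sqrt_iter_sa n0) -starB star_cnorm.
  by move: n0e; rewrite -cnormN opprB; lra.
have fixl : (2 : R)%:C%C *: l - (h + l * l) = 0.
  apply: small => e e0.
  (* The error is at most 2d + d/2 + (1/2 + d) d, hence at most 4d as d <= 1. *)
  pose d := Num.min 1 (e / 5).
  have d0 : 0 < d by rewrite lt_min ltr01 divr_gt0.
  have d1 : d <= 1 by rewrite ge_min lexx.
  have de : d <= e / 5 by rewrite ge_min lexx orbT.
  have [n0 n0e] := lim d d0; have e1 := n0e n0 (leqnn _); have e2 := n0e n0.+1 (leqnSn _).
  set u := y n0 in e1; set v := y n0.+1 in e2.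
  have vE : (2 : R)%:C%C *: v = h + u * u.
    by rewrite /v /= scalerA -rmorphM mulfV // scale1r.
  have -> : (2 : R)%:C%C *: l - (h + l * l) =
      (- ((2 : R)%:C%C *: (v - l))) + (u * (u - l) + (u - l) * l).
    rewrite scalerBr vE mulrBr mulrBl opprB -[u * u - _ + _]addrA (addrA (- _)) addNr add0r.
    by rewrite !opprD -!addrA addKr.
  have := cnormD (- ((2 : R)%:C%C *: (v - l))) (u * (u - l) + (u - l) * l).
  rewrite cnormN cnormZ normc_real ger0_norm //.
  have := cnormD (u * (u - l)) ((u - l) * l); have := cnormM u (u - l); have := cnormM (u - l) l.
  have ul : N u <= 2^-1 by apply: sqrt_iter_le.
  have ll : N l <= 2^-1 + d.
    by have := cnormD u (- (u - l)); rewrite cnormN opprB addrC subrK; lra.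
  have := cnorm_ge0 (u - l); have := cnorm_ge0 (v - l); have := cnorm_ge0 l; have := cnorm_ge0 u.
  move: (N u) (N l) (N (u - l)) (N (v - l)) ul ll e1 e2 => p q r s *; nra.
have {}fixl : (2 : R)%:C%C *: l = h + l * l by apply/eqP; rewrite -subr_eq0 fixl.
have l2 : l + l = h + l * l.
  by rewrite -fixl (_ : (2 : R)%:C%C = 1 + 1) ?scalerDl ?scale1r // -[RHS](rmorphD (real_complex R)).
transitivity (1 - (l + l) + l * l); last by rewrite l2 opprD addrA subrK.
by rewrite mulrBr mulr1 mulrBl mul1r opprB opprD -!addrA; congr (_ + (_ + _)); rewrite addrC.
Qed.
End SquareRoot.

Variable phi : {scalar A}.
Hypothesis phi1 : phi 1 = 1.
Hypothesis phi_ge0 : forall a, 0 <= phi (st a * a).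

Lemma state_psd : psd (fun a b : A => phi (st a * b)).
Proof.
move=> l; rewrite (_ : kform _ l = phi (st (\sum_(p <- l) p.1 *: p.2) * \sum_(p <- l) p.1 *: p.2)) //.
rewrite star_sum mulr_suml linear_sum; apply: eq_bigr => p _ /=.
rewrite mulr_sumr linear_sum; apply: eq_bigr => q _ /=.
rewrite starZ -[X in _ = phi X]scalerAl -scalerAr !linearZ /=; ring.
Qed.

(** Positivity on the square 1 - h = (1 - l)^2 bounds the state from the norm, with no continuity
    assumed. *)
Lemma state_sa_le1 h : st h = h -> N h <= 2^-1 -> phi h <= 1.
Proof.
move=> h_sa h_half; have [l l_sa lE] := sqrt_iter_limit h_sa h_half.
have := phi_ge0 (1 - l); rewrite starB star1 l_sa lE linearB /= phi1.
by rewrite subr_ge0.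
Qed.

(** Cauchy-Schwarz against 1, then the previous bound for the rescaled element [st a * a] divided by
    s; the factor 2 brings its norm below 1/2. *)
Lemma state_sq_le a (s : R) : 0 < s -> 2 * N a ^+ 2 <= s -> `|phi a| ^+ 2 <= s%:C%C.
Proof.
move=> s0 as_; have := psd_CauchySchwarz 1 a state_psd.
rewrite star1 mul1r mulr1 phi1 mul1r => /le_trans; apply.
have -> : st a * a = (s%:C%C : C) *: ((s^-1)%:C%C *: (st a * a)).
  by rewrite scalerA -rmorphM /= mulfV ?gt_eqF // scale1r.
rewrite linearZ /= -[X in _ <= X]mulr1 ler_wpM2l //.
  by rewrite -[0 <= _]/((real_complex R 0) <= _) lecR ltW.
apply: state_sa_le1; first by rewrite starZ starM starK conj_realC.
rewrite cnormZ normc_real cnorm_star (@ger0_norm _ s^-1) ?invr_ge0 ?(ltW s0) // ler_pdivrMl //.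
by move: as_; lra.
Qed.

Variables (k : nat) (x : 'I_k -> A) (nu : dalg R k).
Hypothesis x_sa : forall i, st (x i) = x i.
Hypothesis x_dist : joint_dist phi x nu.

Lemma state_word_psd : psd (fun u v => gser nu (rev u ++ v)).
Proof.
apply: eq_psd (psd_comp (fun w => \prod_(i <- w) x i) state_psd) => u v.
rewrite star_prod /gser x_dist big_cat; congr (phi (_ * _)).
by apply: eq_bigr => i _; rewrite x_sa.
Qed.

Lemma state_word_growth : exists2 M : C, 1 <= M & forall w, `|gser nu w| <= M ^+ size w.
Proof.
pose L : R := 1 + \sum_i N (x i).
have L1 : 1 <= L by rewrite lerDl sumr_ge0 // => i _; apply: cnorm_ge0.
have xL i : N (x i) <= L.
  rewrite /L (bigD1 i) //= addrCA lerDl addr_ge0 // sumr_ge0 // => j _; exact: cnorm_ge0.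
have L0 : 0 <= L by apply: le_trans L1.
have wL w : N (\prod_(i <- w) x i) <= L ^+ size w.
  elim: w => [|i w IH]; first by rewrite big_nil cnorm1_le1.
  rewrite big_cons exprS; apply: le_trans (cnormM _ _) _.
  by apply: ler_pM => //; apply: cnorm_ge0.
have M1 : 1 <= 2 * L by lra.
(* Doubling L absorbs the factor 2 of [state_sq_le] for nonempty words, since 2 <= 4^n when n >= 1;
   the empty word is separate. *)
exists (2 * L)%:C%C; first by rewrite -[1]/(real_complex R 1) lecR.
case=> [|i w]; first by rewrite gser_nil normr1 expr0.
set v := i :: w; rewrite /gser x_dist -[_ ^+ size v](rmorphXn (real_complex R)).
have p0 : 0 <= (2 * L) ^+ size v by rewrite exprn_ge0 // (le_trans ler01).
rewrite -(ler_pXn2r (n := 2)) // ?nnegrE ?normr_ge0 //; last first.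
  by rewrite -[0 <= _]/((real_complex R 0) <= _) lecR.
rewrite -[X in _ <= X](rmorphXn (real_complex R)).
apply: state_sq_le; first by rewrite exprn_gt0 // exprn_gt0 // (lt_le_trans ltr01).
have : N (\prod_(i <- v) x i) ^+ 2 <= (L ^+ size v) ^+ 2.
  by rewrite ler_pXn2r ?nnegrE ?cnorm_ge0 ?exprn_ge0.
set a := N _ ^+ 2; rewrite exprMn exprMn => aL.
have : (2 : R) <= (2 ^+ size v) ^+ 2.
  by rewrite -exprM -[X in X <= _]expr1 ler_weXn2l ?ler1n.
have : 0 <= a by rewrite exprn_ge0 // cnorm_ge0.
have := exprn_ge0 2 (exprn_ge0 (size v) L0).
move: ((2 ^+ size v) ^+ 2 : R) ((L ^+ size v) ^+ 2) aL => p q aL q0 a0 p2.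
by apply: ler_pM.
Qed.

End CStarStates.

Lemma in_Dc_psd_growth (R : realType) k (nu : dalg R k) : in_Dc nu ->
  psd (fun u v => gser nu (rev u ++ v)) /\
  exists2 M : R[i], 1 <= M & forall w, `|gser nu w| <= M ^+ size w.
Proof.
move=> [A [phi [x [phi1 phi0 xs xd]]]]; split.
  by apply: (state_word_psd _ _ xd).
by apply: (state_word_growth _ _ xd).
Qed.

(** * Limits of real sequences in epsilon form *)

Section RealSequences.
Variable R : realType.
Local Open Scope classical_set_scope.
Implicit Types (u v : nat -> R) (l : R).

Lemma cvgnP u l : u n @[n --> \oo] --> l <->
  forall e, 0 < e -> exists n0, forall n, (n0 <= n)%N -> `|l - u n| < e.
Proof.
rewrite cvgrPdist_lt; split=> H e e0.
  by have [n0 _ n0e] := H e e0; exists n0 => n; apply: n0e.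
by have [n0 n0e] := H e e0; exists n0.
Qed.

Lemma cauchy_cvgn u : (forall e, 0 < e -> exists n0, forall m n,
    (n0 <= m)%N -> (n0 <= n)%N -> `|u m - u n| < e) ->
  exists l, u n @[n --> \oo] --> l.
Proof.
move=> H; apply/cvg_ex/cauchy_cvgP/cauchy_exP => e e0.
have [n0 n0e] := H e e0; exists (u n0); exists n0 => // n n0n.
exact: n0e.
Qed.

Lemma cvgn_unique u l l' : u n @[n --> \oo] --> l -> u n @[n --> \oo] --> l' -> l = l'.
Proof. by move=> ul ul'; apply: (cvg_unique _ ul ul'). Qed.

Lemma cvgn_le u v l l' : (forall n, u n <= v n) ->
  u n @[n --> \oo] --> l -> v n @[n --> \oo] --> l' -> l <= l'.
Proof. by move=> uv ul vl; apply: (ler_cvg_to ul vl); apply: nearW. Qed.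

End RealSequences.

(* A star algebra with a possibly degenerate and incomplete C*-norm. *)
Record precstar (R : realType) := PreCStar {
  pcA :> lalgType R[i];
  pc_scaleAr : forall (c : R[i]) (a b : pcA), c *: (a * b) = a * (c *: b);
  pcst : pcA -> pcA;
  pcstK : involutive pcst;
  pcstD : {morph pcst : a b / a + b};
  pcstZ : forall (c : R[i]) (a : pcA), pcst (c *: a) = Num.conj c *: pcst a;
  pcstM : forall a b, pcst (a * b) = pcst b * pcst a;
  pcN : pcA -> R;
  pcND : forall a b, pcN (a + b) <= pcN a + pcN b;
  pcNZ : forall (c : R[i]) (a : pcA), pcN (c *: a) = ComplexField.Normc.normc c * pcN a;
  pcNM : forall a b, pcN (a * b) <= pcN a * pcN b;
  pcN_star : forall a, pcN (pcst a * a) = pcN a ^+ 2;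
  pcN1 : 0 < pcN 1 }.

(** * Completion of a seminormed star algebra by Cauchy sequences *)

Section Completion.
Variables (R : realType) (A : precstar R).
Local Notation C := R[i].
Local Notation N := (@pcN R A).
Local Notation st := (@pcst R A).
Implicit Types (a b : A) (u v w : nat -> A) (e : R).
Local Open Scope classical_set_scope.

Lemma pcN0 : N 0 = 0.
Proof. by rewrite -(scale0r (0 : A)) pcNZ (normc_real 0) normr0 mul0r. Qed.

Lemma pcNN a : N (- a) = N a.
Proof.
rewrite -scaleN1r pcNZ (_ : -1 = (-1)%:C%C) ?normc_real ?normrN1 ?mul1r //.
by rewrite rmorphN1.
Qed.

Lemma pcN_ge0 a : 0 <= N a.
Proof. by have := pcND a (- a); rewrite subrr pcN0 pcNN; lra. Qed.

Lemma pcNB a b : N (a - b) = N (b - a).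
Proof. by rewrite -pcNN opprB. Qed.

Lemma pcN_tri a b c : N (a - b) <= N (a - c) + N (c - b).
Proof. by have := pcND (a - c) (c - b); rewrite addrA subrK. Qed.

Lemma pcN_dist a b : `|N a - N b| <= N (a - b).
Proof.
have := pcND (a - b) b; have := pcND (b - a) a; rewrite !subrK [N (b - a)]pcNB.
by rewrite ler_norml; move=> *; apply/andP; split; lra.
Qed.

Lemma pcN_st a : N (st a) = N a.
Proof.
have le b : N b <= N (st b).
  have [->|b0] := eqVneq (N b) 0; first exact: pcN_ge0.
  have bp : 0 < N b by rewrite lt_def b0 pcN_ge0.
  by rewrite -(ler_pM2r bp) -expr2 -pcN_star pcNM.
by apply/le_anti; rewrite le -{2}[a]pcstK le.
Qed.

Lemma pcstB a b : st (a - b) = st a - st b.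
Proof.
by rewrite pcstD -[- b]scaleN1r pcstZ rmorphN1 scaleN1r.
Qed.

Lemma normc_ge0 (c : C) : 0 <= ComplexField.Normc.normc c.
Proof. by case: c => x y; rewrite /= sqrtr_ge0. Qed.

Definition cauchy_in u := forall e, 0 < e -> exists n0, forall m n,
  (n0 <= m)%N -> (n0 <= n)%N -> N (u m - u n) < e.

Definition null_in u := N (u n) @[n --> \oo] --> (0 : R).

Lemma null_inP u : null_in u <->
  forall e, 0 < e -> exists n0, forall n, (n0 <= n)%N -> N (u n) < e.
Proof.
rewrite /null_in cvgnP; split=> H e e0; have [n0 n0e] := H e e0; exists n0 => n /n0e;
  by rewrite sub0r normrN ger0_norm // pcN_ge0.
Qed.

Lemma null_eq u v : (forall n, u n = v n) -> null_in u -> null_in v.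
Proof. by move=> uv; rewrite (_ : v = u) //; apply/funext. Qed.

Lemma null0 u : (forall n, u n = 0) -> null_in u.
Proof. by move=> u0; apply/null_inP => e e0; exists 0 => n _; rewrite u0 pcN0. Qed.

Lemma null_dom u v (M : R) : (forall n, N (u n) <= M * N (v n)) -> null_in v -> null_in u.
Proof.
move=> uv /null_inP v0; apply/null_inP => e e0.
have M1 : 0 < `|M| + 1 by rewrite ltr_wpDl.
have [n0 n0e] := v0 _ (divr_gt0 e0 M1); exists n0 => n /n0e.
rewrite ltr_pdivlMr // => ve; apply: le_lt_trans (uv n) _; apply: le_lt_trans ve.
rewrite mulrC ler_wpM2l ?pcN_ge0 //; have := ler_norm M; lra.
Qed.

Lemma nullD u v w : (forall n, N (w n) <= N (u n) + N (v n)) ->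
  null_in u -> null_in v -> null_in w.
Proof.
move=> wuv /null_inP u0 /null_inP v0; apply/null_inP => e e0.
have e2 : 0 < e / 2 by rewrite divr_gt0.
have [n1 n1e] := u0 _ e2; have [n2 n2e] := v0 _ e2; exists (maxn n1 n2) => n.
by rewrite geq_max => /andP[/n1e ? /n2e ?]; have := wuv n; lra.
Qed.

Lemma null_sym u v : null_in (fun n => u n - v n) -> null_in (fun n => v n - u n).
Proof. by apply: (null_dom (M := 1)) => n; rewrite mul1r pcNB. Qed.

Lemma null_trans u v w : null_in (fun n => u n - v n) -> null_in (fun n => v n - w n) ->
  null_in (fun n => u n - w n).
Proof. by apply: nullD => n; apply: pcN_tri. Qed.

Lemma cauchy_bounded u : cauchy_in u -> exists M, forall n, N (u n) <= M.
Proof.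
move=> uc; have [n0 n0e] := uc 1 ltr01.
have [M0 M0P] : exists M, forall n, (n < n0)%N -> N (u n) <= M.
  elim: n0 {n0e} => [|n0 [M MP]]; first by exists 0.
  exists (Num.max M (N (u n0))) => n; rewrite ltnS leq_eqVlt => /predU1P[->|/MP nM].
    by rewrite le_max lexx orbT.
  by rewrite le_max nM.
exists (Num.max M0 (1 + N (u n0))) => n; rewrite le_max.
have [n0n|/M0P -> //] := leqP n0 n; apply/orP; right.
have := n0e n n0 n0n (leqnn _); have := pcND (u n - u n0) (u n0); rewrite subrK; lra.
Qed.

Lemma cauchy_cst a : cauchy_in (fun=> a).
Proof. by move=> e e0; exists 0 => m n _ _; rewrite subrr pcN0. Qed.

Lemma cauchy_dom u v (M : R) : (forall m n, N (u m - u n) <= M * N (v m - v n)) ->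
  cauchy_in v -> cauchy_in u.
Proof.
move=> uv vc e e0; have M1 : 0 < `|M| + 1 by rewrite ltr_wpDl.
have [n0 n0e] := vc _ (divr_gt0 e0 M1); exists n0 => m n mn0 nn0.
have := n0e m n mn0 nn0; rewrite ltr_pdivlMr // => ve.
apply: le_lt_trans (uv m n) _; apply: le_lt_trans ve.
rewrite mulrC ler_wpM2l ?pcN_ge0 //; have := ler_norm M; lra.
Qed.

Lemma cauchyD_dom u v w : (forall m n, N (w m - w n) <= N (u m - u n) + N (v m - v n)) ->
  cauchy_in u -> cauchy_in v -> cauchy_in w.
Proof.
move=> wuv uc vc e e0; have e2 : 0 < e / 2 by rewrite divr_gt0.
have [n1 n1e] := uc _ e2; have [n2 n2e] := vc _ e2; exists (maxn n1 n2) => m n.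
rewrite !geq_max => /andP[m1 m2] /andP[n1' n2'].
by have := n1e _ _ m1 n1'; have := n2e _ _ m2 n2'; have := wuv m n; lra.
Qed.

Lemma cauchyD u v : cauchy_in u -> cauchy_in v -> cauchy_in (fun n => u n + v n).
Proof. by apply: cauchyD_dom => m n; rewrite opprD addrACA pcND. Qed.

Lemma cauchyN u : cauchy_in u -> cauchy_in (fun n => - u n).
Proof. by apply: (cauchy_dom (M := 1)) => m n; rewrite -opprD pcNN mul1r. Qed.

Lemma cauchyZ c u : cauchy_in u -> cauchy_in (fun n => c *: u n).
Proof.
by apply: (cauchy_dom (M := ComplexField.Normc.normc c)) => m n; rewrite -scalerBr pcNZ.
Qed.

Lemma cauchyS u : cauchy_in u -> cauchy_in (fun n => st (u n)).
Proof. by apply: (cauchy_dom (M := 1)) => m n; rewrite -pcstB pcN_st mul1r. Qed.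

Lemma pcNM_dist a b c d (M M' : R) : N b <= M -> N c <= M' ->
  N (a * b - c * d) <= M * N (a - c) + M' * N (b - d).
Proof.
move=> bM cM; have -> : a * b - c * d = (a - c) * b + c * (b - d).
  by rewrite mulrBl mulrBr addrA subrK.
apply: le_trans (pcND _ _) _; apply: lerD.
  by apply: le_trans (pcNM _ _) _; rewrite mulrC ler_wpM2r ?pcN_ge0.
by apply: le_trans (pcNM _ _) _; rewrite ler_wpM2r ?pcN_ge0.
Qed.

Lemma cauchyM u v : cauchy_in u -> cauchy_in v -> cauchy_in (fun n => u n * v n).
Proof.
move=> uc vc; have [M uM] := cauchy_bounded uc; have [M' vM] := cauchy_bounded vc.
have M0 : 0 <= M by apply: le_trans (pcN_ge0 _) (uM 0%N).
have M0' : 0 <= M' by apply: le_trans (pcN_ge0 _) (vM 0%N).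
(* Scaling the sequences by the two bounds turns the product estimate into a sum of two
   distances. *)
apply: (@cauchyD_dom (fun n => M'%:C%C *: u n) (fun n => M%:C%C *: v n)).
- move=> m n; rewrite -!scalerBr !pcNZ !normc_real !ger0_norm //.
  exact: pcNM_dist.
- exact: cauchyZ.
- exact: cauchyZ.
Qed.

Lemma nullM_dist u v u' v' : cauchy_in v -> cauchy_in u' ->
  null_in (fun n => u n - u' n) -> null_in (fun n => v n - v' n) ->
  null_in (fun n => u n * v n - u' n * v' n).
Proof.
move=> vc uc' nu nv; have [M vM] := cauchy_bounded vc; have [M' uM] := cauchy_bounded uc'.
have M0 : 0 <= M by apply: le_trans (pcN_ge0 _) (vM 0%N).
have M0' : 0 <= M' by apply: le_trans (pcN_ge0 _) (uM 0%N).
apply: (@nullD (fun n => M%:C%C *: (u n - u' n)) (fun n => M'%:C%C *: (v n - v' n))).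
- move=> n; rewrite !pcNZ !normc_real !ger0_norm //; exact: pcNM_dist.
- by apply: (null_dom (M := M)) nu => n; rewrite pcNZ normc_real ger0_norm.
- by apply: (null_dom (M := M')) nv => n; rewrite pcNZ normc_real ger0_norm.
Qed.

Definition canon u : nat -> A :=
  xget (fun=> 0) [set v | cauchy_in v /\ null_in (fun n => u n - v n)].

Lemma canonP u : cauchy_in u -> cauchy_in (canon u) /\ null_in (fun n => u n - canon u n).
Proof.
move=> uc; rewrite /canon; case: xgetP => [v -> //|/(_ u)[]].
by split=> //; apply: null0 => n; rewrite subrr.
Qed.

Lemma canon_eq u v : null_in (fun n => u n - v n) -> canon u = canon v.
Proof.
move=> uv; rewrite /canon; congr xget; apply/seteqP; split=> w /= [wc nw]; split=> //.
  by apply: null_trans nw; apply: null_sym.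
exact: null_trans nw.
Qed.

(* A point of the completion is a Cauchy sequence that is its own chosen
   representative modulo null sequences. *)
Record cplt := Cplt { crep : nat -> A;
  crep_cauchy : cauchy_in crep; crep_canon : canon crep = crep }.

HB.instance Definition _ := gen_eqMixin cplt.
HB.instance Definition _ := gen_choiceMixin cplt.

Lemma cplt_eq (x y : cplt) : crep x = crep y -> x = y.
Proof.
case: x y => [u uc un] [v vc vn] /= uv; move: uc un vc vn; rewrite uv => *.
by congr Cplt; apply: Prop_irrelevance.
Qed.

Lemma cplt_exists u : cauchy_in u -> exists x : cplt, crep x = canon u.
Proof.
move=> uc; have [cc nc] := canonP uc.
by exists (Cplt cc (esym (canon_eq nc))).
Qed.

Definition cpt0 : cplt := sval (cid (cplt_exists (cauchy_cst 0))).

Definition lim_of u : cplt := xget cpt0 [set x | crep x = canon u].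

Lemma crep_lim_of u : cauchy_in u -> crep (lim_of u) = canon u.
Proof.
move=> uc; rewrite /lim_of; case: xgetP => [x -> //|no].
by have [x xE] := cplt_exists uc; case: (no x).
Qed.

Lemma crepK x : lim_of (crep x) = x.
Proof. by apply: cplt_eq; rewrite crep_lim_of ?crep_canon //; apply: crep_cauchy. Qed.

Lemma lim_of_eq u v : cauchy_in u -> cauchy_in v -> null_in (fun n => u n - v n) ->
  lim_of u = lim_of v.
Proof. by move=> uc vc uv; apply: cplt_eq; rewrite !crep_lim_of // (canon_eq uv). Qed.

Lemma crep_near u : cauchy_in u -> null_in (fun n => u n - crep (lim_of u) n).
Proof. by move=> uc; rewrite crep_lim_of //; case: (canonP uc). Qed.

Lemma cpltP (P : cplt -> Prop) : (forall u, cauchy_in u -> P (lim_of u)) -> forall x, P x.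
Proof. by move=> H x; rewrite -[x]crepK; apply/H/crep_cauchy. Qed.

Definition cplt_opp x := lim_of (fun n => - crep x n).
Definition cplt_add x y := lim_of (fun n => crep x n + crep y n).
Definition cplt_scale c x := lim_of (fun n => c *: crep x n).
Definition cplt_mul x y := lim_of (fun n => crep x n * crep y n).
Definition cplt_star x := lim_of (fun n => st (crep x n)).
Local Notation cst a := (fun _ : nat => a : A).

Lemma cplt_addE u v : cauchy_in u -> cauchy_in v ->
  cplt_add (lim_of u) (lim_of v) = lim_of (fun n => u n + v n).
Proof.
move=> uc vc; apply/esym/lim_of_eq; [exact: cauchyD|apply: cauchyD; exact: crep_cauchy|].
apply: nullD (crep_near uc) (crep_near vc) => n.
by rewrite opprD addrACA pcND.
Qed.

Lemma cplt_oppE u : cauchy_in u -> cplt_opp (lim_of u) = lim_of (fun n => - u n).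
Proof.
move=> uc; apply/esym/lim_of_eq; [exact: cauchyN|apply: cauchyN; exact: crep_cauchy|].
by apply: (null_dom (M := 1)) (crep_near uc) => n; rewrite -opprD pcNN mul1r.
Qed.

Lemma cplt_scaleE c u : cauchy_in u -> cplt_scale c (lim_of u) = lim_of (fun n => c *: u n).
Proof.
move=> uc; apply/esym/lim_of_eq; [exact: cauchyZ|apply: cauchyZ; exact: crep_cauchy|].
apply: (null_dom (M := ComplexField.Normc.normc c)) (crep_near uc) => n.
by rewrite -scalerBr pcNZ.
Qed.

Lemma cplt_mulE u v : cauchy_in u -> cauchy_in v ->
  cplt_mul (lim_of u) (lim_of v) = lim_of (fun n => u n * v n).
Proof.
move=> uc vc; apply/esym/lim_of_eq; [exact: cauchyM|apply: cauchyM; exact: crep_cauchy|].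
by apply: nullM_dist => //; [exact: crep_cauchy|exact: crep_near|exact: crep_near].
Qed.

Lemma cplt_starE u : cauchy_in u -> cplt_star (lim_of u) = lim_of (fun n => st (u n)).
Proof.
move=> uc; apply/esym/lim_of_eq; [exact: cauchyS|apply: cauchyS; exact: crep_cauchy|].
by apply: (null_dom (M := 1)) (crep_near uc) => n; rewrite -pcstB pcN_st mul1r.
Qed.

Let cE := (cplt_addE, cplt_oppE, cplt_scaleE, cplt_mulE, cplt_starE).
Hint Resolve cauchyD cauchyN cauchyZ cauchyM cauchyS cauchy_cst : core.

Definition cplt0 := lim_of (cst 0).
Definition cplt1 := lim_of (cst 1).

Lemma lim_ext u v : (forall n, u n = v n) -> lim_of u = lim_of v.
Proof. by move=> uv; congr lim_of; apply/funext. Qed.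

Fact cplt_addA : associative cplt_add.
Proof.
elim/cpltP => u uc; elim/cpltP => v vc; elim/cpltP => w wc; rewrite !cE //; auto.
by apply: lim_ext => n; rewrite addrA.
Qed.
Fact cplt_addC : commutative cplt_add.
Proof.
elim/cpltP => u uc; elim/cpltP => v vc; rewrite !cE //.
by apply: lim_ext => n; rewrite addrC.
Qed.
Fact cplt_add0 : left_id cplt0 cplt_add.
Proof.
by elim/cpltP => u uc; rewrite !cE //; apply: lim_ext => n; rewrite add0r.
Qed.
Fact cplt_addN : left_inverse cplt0 cplt_opp cplt_add.
Proof.
by elim/cpltP => u uc; rewrite !cE //; auto; apply: lim_ext => n; rewrite addNr.
Qed.

HB.instance Definition _ := GRing.isZmodule.Build cplt
  cplt_addA cplt_addC cplt_add0 cplt_addN.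

Fact cplt_scaleA c d x : cplt_scale c (cplt_scale d x) = cplt_scale (c * d) x.
Proof.
by move: x; elim/cpltP => u uc; rewrite !cE //; auto; apply: lim_ext => n; rewrite scalerA.
Qed.
Fact cplt_scale1 : left_id 1 cplt_scale.
Proof. by elim/cpltP => u uc; rewrite !cE //; apply: lim_ext => n; rewrite scale1r. Qed.
Fact cplt_scaleDr : right_distributive cplt_scale +%R.
Proof.
move=> c; elim/cpltP => u uc; elim/cpltP => v vc; rewrite /GRing.add /= !cE //; auto.
by apply: lim_ext => n; rewrite scalerDr.
Qed.
Fact cplt_scaleDl x : {morph cplt_scale^~ x : c d / c + d}.
Proof.
move: x; elim/cpltP => u uc c d; rewrite [X in _ = X]/GRing.add /= !cE //; auto.
by apply: lim_ext => n; rewrite scalerDl.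
Qed.

HB.instance Definition _ := GRing.Zmodule_isLmodule.Build C cplt
  cplt_scaleA cplt_scale1 cplt_scaleDr cplt_scaleDl.

Definition cplt_norm x : R := lim (N (crep x n) @[n --> \oo]).

Lemma cauchy_norm u : cauchy_in u -> exists l : R, N (u n) @[n --> \oo] --> l.
Proof.
move=> uc; apply: cauchy_cvgn => e e0; have [n0 n0e] := uc e e0; exists n0 => m n mn nn.
by apply: le_lt_trans (pcN_dist _ _) _; apply: n0e.
Qed.

Lemma cplt_norm_cvg u : cauchy_in u -> N (u n) @[n --> \oo] --> cplt_norm (lim_of u).
Proof.
move=> uc; have [l lP] := cauchy_norm (crep_cauchy (lim_of u)).
have -> : cplt_norm (lim_of u) = l by apply: cvg_lim.
have /null_inP n0 := crep_near uc; move/cvgnP in lP; apply/cvgnP => e e0.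
have e2 : 0 < e / 2 by rewrite divr_gt0.
have [n1 n1e] := lP _ e2; have [n2 n2e] := n0 _ e2; exists (maxn n1 n2) => n.
rewrite geq_max => /andP[/n1e E1 /n2e E2].
have := pcN_dist (u n) (crep (lim_of u) n); move: E1 E2.
rewrite !ltr_norml !ler_norml => /andP[? ?] ? /andP[? ?]; apply/andP; split; lra.
Qed.

Fact cplt_mulA : associative cplt_mul.
Proof.
elim/cpltP => u uc; elim/cpltP => v vc; elim/cpltP => w wc; rewrite !cE //; auto.
by apply: lim_ext => n; rewrite mulrA.
Qed.
Fact cplt_mul1 : left_id cplt1 cplt_mul.
Proof. by elim/cpltP => u uc; rewrite !cE //; apply: lim_ext => n; rewrite mul1r. Qed.
Fact cplt_mul_1 : right_id cplt1 cplt_mul.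
Proof. by elim/cpltP => u uc; rewrite !cE //; apply: lim_ext => n; rewrite mulr1. Qed.
Fact cplt_mulDl : left_distributive cplt_mul +%R.
Proof.
elim/cpltP => u uc; elim/cpltP => v vc; elim/cpltP => w wc.
rewrite /GRing.add /= !cE //; auto.
by apply: lim_ext => n; rewrite mulrDl.
Qed.
Fact cplt_mulDr : right_distributive cplt_mul +%R.
Proof.
elim/cpltP => u uc; elim/cpltP => v vc; elim/cpltP => w wc.
rewrite /GRing.add /= !cE //; auto.
by apply: lim_ext => n; rewrite mulrDr.
Qed.

Lemma cplt_norm_cst a : cplt_norm (lim_of (cst a)) = N a.
Proof. exact: (cvgn_unique (cplt_norm_cvg (cauchy_cst a)) (cvg_cst _)). Qed.

Fact cplt1_neq0 : cplt1 != 0.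
Proof.
apply/eqP => E; have := pcN1 A.
by rewrite -cplt_norm_cst -/cplt1 E cplt_norm_cst pcN0 ltxx.
Qed.

HB.instance Definition _ := GRing.Zmodule_isNzRing.Build cplt
  cplt_mulA cplt_mul1 cplt_mul_1 cplt_mulDl cplt_mulDr cplt1_neq0.

Fact cplt_scaleAl c (x y : cplt) : c *: (x * y) = (c *: x) * y.
Proof.
move: x y; elim/cpltP => u uc; elim/cpltP => v vc.
rewrite /GRing.mul /GRing.scale /= !cE //; auto.
by apply: lim_ext => n; rewrite scalerAl.
Qed.

HB.instance Definition _ := GRing.Lmodule_isLalgebra.Build C cplt cplt_scaleAl.

Fact cplt_scaleAr c (x y : cplt) : c *: (x * y) = x * (c *: y).
Proof.
move: x y; elim/cpltP => u uc; elim/cpltP => v vc.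
rewrite /GRing.mul /GRing.scale /= !cE //; auto.
by apply: lim_ext => n; rewrite pc_scaleAr.
Qed.

HB.instance Definition _ := GRing.Lalgebra_isAlgebra.Build C cplt cplt_scaleAr.

End Completion.

#[global] Opaque cplt_opp cplt_add cplt_scale cplt_mul cplt_star cplt_norm.

(** Approximating x_m within 2^-m by a point of the dense image reduces completeness to Cauchy
    sequences inside that image. *)
Lemma complete_of_dense (R : realType) (V : zmodType) (nm : V -> R) (T : Type) (D : T -> V) :
  (forall y, nm (- y) = nm y) -> (forall y z, nm (y + z) <= nm y + nm z) ->
  (forall x e, 0 < e -> exists a, nm (x - D a) < e) ->
  (forall a : nat -> T,
    (forall e, 0 < e -> exists n0, forall m n, (n0 <= m)%N -> (n0 <= n)%N ->
       nm (D (a m) - D (a n)) < e) ->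
    exists l, forall e, 0 < e -> exists n0, forall n, (n0 <= n)%N -> nm (D (a n) - l) < e) ->
  forall x : nat -> V,
    (forall e, 0 < e -> exists n0, forall m n, (n0 <= m)%N -> (n0 <= n)%N ->
       nm (x m - x n) < e) ->
    exists l, forall e, 0 < e -> exists n0, forall n, (n0 <= n)%N -> nm (x n - l) < e.
Proof.
move=> nmN nmD dense compl x xc.
have adense m : exists a, nm (x m - D a) < (2^-1) ^+ m.
  by apply: dense; rewrite exprn_gt0 // invr_gt0.
pose a m := sval (cid (adense m)).
have aP m : nm (x m - D (a m)) < (2^-1) ^+ m by exact: (svalP (cid (adense m))).
have sym y z : nm (y - z) = nm (z - y) by rewrite -nmN opprB.
have tri y z u : nm (y - z) <= nm (y - u) + nm (u - z).
  by rewrite -[y - z](subrKA u); apply: nmD.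
have small e : 0 < e -> exists n0, forall n, (n0 <= n)%N -> nm (x n - D (a n)) < e.
  move=> e0; have [n0 n0e] := half_pow_small e0; exists n0 => n n0n.
  apply: lt_trans (aP n) _; apply: le_lt_trans n0e.
  by rewrite ler_wiXn2l // ?invr_ge0 // invf_le1 // ler1n.
have [l lP] : exists l, forall e, 0 < e -> exists n0, forall n, (n0 <= n)%N -> nm (D (a n) - l) < e.
  apply: compl => e e0; have e3 : 0 < e / 3 by rewrite divr_gt0.
  have [n1 n1e] := small _ e3; have [n2 n2e] := xc _ e3; exists (maxn n1 n2) => m n.
  rewrite !geq_max => /andP[/n1e + m2] /andP[/n1e + n2'].
  rewrite [nm (x m - _)]sym; have := n2e m n m2 n2'.
  have := tri (D (a m)) (D (a n)) (x m); have := tri (x m) (D (a n)) (x n).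
  by lra.
exists l => e e0; have e2 : 0 < e / 2 by rewrite divr_gt0.
have [n1 n1e] := small _ e2; have [n2 n2e] := lP _ e2; exists (maxn n1 n2) => n.
rewrite geq_max => /andP[/n1e + /n2e +]; have := tri (x n) l (D (a n)); lra.
Qed.

(** * The C*-structure and the extended state on the completion *)

Section CompletionCStar.
Variables (R : realType) (A : precstar R).
Local Notation C := R[i].
Local Notation N := (@pcN R A).
Local Notation st := (@pcst R A).
Local Notation Q := (cplt A).
Implicit Types (a b : A) (u v w : nat -> A) (e : R) (x y : Q).
Local Open Scope classical_set_scope.

Let addE u v : cauchy_in u -> cauchy_in v ->
  lim_of u + lim_of v = lim_of (fun n => u n + v n).
Proof. exact: cplt_addE. Qed.
Let oppE u : cauchy_in u -> - lim_of u = lim_of (fun n => - u n).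
Proof. exact: cplt_oppE. Qed.
Let scaleE c u : cauchy_in u -> c *: lim_of u = lim_of (fun n => c *: u n).
Proof. exact: cplt_scaleE. Qed.
Let mulE u v : cauchy_in u -> cauchy_in v ->
  lim_of u * lim_of v = lim_of (fun n => u n * v n).
Proof. exact: cplt_mulE. Qed.
Let sE := @cplt_starE R A.

Lemma cplt_zeroE : 0 = lim_of (fun=> 0) :> Q. Proof. by []. Qed.
Lemma cplt_oneE : 1 = lim_of (fun=> 1) :> Q. Proof. by []. Qed.

Lemma cplt_subE u v : cauchy_in u -> cauchy_in v ->
  lim_of u - lim_of v = lim_of (fun n => u n - v n).
Proof. by move=> uc vc; rewrite oppE // addE //; apply: cauchyN. Qed.

Fact cplt_starK : involutive (@cplt_star R A).
Proof.
elim/cpltP => u uc; rewrite !sE //; last exact: cauchyS.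
by apply: lim_ext => n; rewrite pcstK.
Qed.

Fact cplt_starD : {morph (@cplt_star R A) : x y / x + y}.
Proof.
elim/cpltP => u uc; elim/cpltP => v vc; rewrite addE // !sE //; last exact: cauchyD.
by rewrite addE; [apply: lim_ext => n; rewrite pcstD | apply: cauchyS..].
Qed.

Fact cplt_starZ (c : C) x : cplt_star (c *: x) = Num.conj c *: cplt_star x.
Proof.
move: x; elim/cpltP => u uc; rewrite scaleE // !sE //; last exact: cauchyZ.
by rewrite scaleE; [apply: lim_ext => n; rewrite pcstZ | apply: cauchyS].
Qed.

Fact cplt_starM x y : cplt_star (x * y) = cplt_star y * cplt_star x.
Proof.
move: x y; elim/cpltP => u uc; elim/cpltP => v vc; rewrite mulE // !sE //; last exact: cauchyM.
by rewrite mulE; [apply: lim_ext => n; rewrite pcstM | apply: cauchyS..].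
Qed.

Fact cplt_norm_eq0 x : cplt_norm x = 0 -> x = 0.
Proof.
move: x; elim/cpltP => u uc u0; have := cplt_norm_cvg uc; rewrite u0 => un.
rewrite cplt_zeroE; apply: lim_of_eq => //; first exact: cauchy_cst.
by apply: null_eq un => n; rewrite subr0.
Qed.

Fact cplt_normD x y : cplt_norm (x + y) <= cplt_norm x + cplt_norm y.
Proof.
move: x y; elim/cpltP => u uc; elim/cpltP => v vc; rewrite addE //.
apply: cvgn_le (cplt_norm_cvg (cauchyD uc vc)) (cvgD (cplt_norm_cvg uc) (cplt_norm_cvg vc)).
by move=> n; apply: pcND.
Qed.

Fact cplt_normZ (c : C) x :
  cplt_norm (c *: x) = ComplexField.Normc.normc c * cplt_norm x.
Proof.
move: x; elim/cpltP => u uc; rewrite scaleE //.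
apply: (cvgn_unique (cplt_norm_cvg (cauchyZ c uc))).
under eq_fun do rewrite pcNZ.
by apply: cvgM; [exact: cvg_cst | exact: cplt_norm_cvg].
Qed.

Fact cplt_normM x y : cplt_norm (x * y) <= cplt_norm x * cplt_norm y.
Proof.
move: x y; elim/cpltP => u uc; elim/cpltP => v vc; rewrite mulE //.
apply: cvgn_le (cplt_norm_cvg (cauchyM uc vc)) (cvgM (cplt_norm_cvg uc) (cplt_norm_cvg vc)).
by move=> n; apply: pcNM.
Qed.

Fact cplt_norm_star x : cplt_norm (cplt_star x * x) = cplt_norm x ^+ 2.
Proof.
move: x; elim/cpltP => u uc; rewrite sE // mulE //; last exact: cauchyS.
apply: (cvgn_unique (cplt_norm_cvg (cauchyM (cauchyS uc) uc))).
under eq_fun do rewrite pcN_star expr2.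
by rewrite expr2; apply: cvgM; exact: cplt_norm_cvg.
Qed.

Lemma cplt_dense x e : 0 < e -> exists a, cplt_norm (x - lim_of (fun=> a)) < e.
Proof.
move: x; elim/cpltP => u uc e0.
have [n0 n0e] := uc _ (divr_gt0 e0 (ltr0Sn R 1)); exists (u n0).
have := cplt_norm_cvg (cauchyD uc (cauchyN (cauchy_cst (u n0)))).
rewrite -cplt_subE //; last exact: cauchy_cst.
move=> /cvgnP/(_ _ (divr_gt0 e0 (ltr0Sn R 1)))[n1 n1e].
have := n1e (maxn n0 n1) (leq_maxr _ _); have := n0e (maxn n0 n1) n0 (leq_maxl _ _) (leqnn _).
by rewrite ltr_norml => ? /andP[? ?]; lra.
Qed.

Fact cplt_complete (x : nat -> Q) :
  (forall e : R, 0 < e -> exists n0 : nat, forall m n : nat,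
     (n0 <= m)%N -> (n0 <= n)%N -> cplt_norm (x m - x n) < e) ->
  exists l : Q, forall e : R, 0 < e -> exists n0 : nat, forall n : nat,
     (n0 <= n)%N -> cplt_norm (x n - l) < e.
Proof.
move: x; apply: (complete_of_dense (D := fun a : A => lim_of (fun=> a))) => [x|x y|x e|a ac].
- move: x; elim/cpltP => u uc; rewrite oppE //.
  apply: cvgn_unique (cplt_norm_cvg (cauchyN uc)) _.
  by under eq_fun do rewrite pcNN; exact: cplt_norm_cvg.
- exact: cplt_normD.
- exact: cplt_dense.
have dist b c : cplt_norm (lim_of (fun=> b) - lim_of (fun=> c) : Q) = N (b - c).
  by rewrite cplt_subE ?cplt_norm_cst //; apply: cauchy_cst.
have {}ac : cauchy_in a.
  by move=> e e0; have [n0 n0e] := ac e e0; exists n0 => m n mn nn; rewrite -dist n0e.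
exists (lim_of a) => e e0; have e2 : 0 < e / 2 by rewrite divr_gt0.
have [n2 n2e] := ac _ e2; exists n2 => n n2n.
rewrite cplt_subE //; last exact: cauchy_cst.
have /cvgnP lc := cplt_norm_cvg (cauchyD (cauchy_cst (a n)) (cauchyN ac)).
have [n3 n3d] := lc _ e2.
have := n3d (maxn n2 n3) (leq_maxr _ _); have := n2e n (maxn n2 n3) n2n (leq_maxl _ _).
by rewrite ltr_norml => ? /andP[? ?]; lra.
Qed.

HB.instance Definition _ := isCStarAlgebra.Build R (cplt A)
  cplt_starK cplt_starD cplt_starZ cplt_starM cplt_norm_eq0 cplt_normD
  cplt_normZ cplt_normM cplt_norm_star cplt_complete.

Variable phi : {scalar A}.
Hypothesis phi_le : forall a, `|phi a| <= (N a)%:C%C.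

Definition extend (F : A -> R) x : R := lim (F (crep x n) @[n --> \oo]).

Lemma extend_cvg F u : (forall a b, `|F a - F b| <= N (a - b)) -> cauchy_in u ->
  F (u n) @[n --> \oo] --> extend F (lim_of u).
Proof.
move=> FN uc; have [l lP] : exists l : R, F (crep (lim_of u) n) @[n --> \oo] --> l.
  apply: cauchy_cvgn => e e0; have [n0 n0e] := crep_cauchy (lim_of u) e0.
  by exists n0 => m n mn nn; apply: le_lt_trans (FN _ _) _; apply: n0e.
have -> : extend F (lim_of u) = l by apply: cvg_lim.
have /null_inP n0 := crep_near uc; move/cvgnP in lP; apply/cvgnP => e e0.
have e2 : 0 < e / 2 by rewrite divr_gt0.
have [n1 n1e] := lP _ e2; have [n2 n2e] := n0 _ e2; exists (maxn n1 n2) => n.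
rewrite geq_max => /andP[/n1e E1 /n2e E2].
have := FN (u n) (crep (lim_of u) n); move: E1 E2.
rewrite !ltr_norml !ler_norml => /andP[? ?] ? /andP[? ?]; apply/andP; split; lra.
Qed.

Lemma normc_Re_le (z : C) (r : R) : `|z| <= r%:C%C -> `|complex.Re z| <= r.
Proof. by move=> zr; rewrite -lecR; apply: le_trans (normc_ge_Re z) zr. Qed.

Lemma normc_Im_le (z : C) (r : R) : `|z| <= r%:C%C -> `|complex.Im z| <= r.
Proof.
rewrite normc_def lecR => /(le_trans _); apply.
by rewrite -sqrtr_sqr ler_wsqrtr // lerDr sqr_ge0.
Qed.

Let FR a : R := complex.Re (phi a).
Let FI a : R := complex.Im (phi a).

Let FR_lip a b : `|FR a - FR b| <= N (a - b).
Proof.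
rewrite /FR -raddfB -linearB; apply: normc_Re_le; exact: phi_le.
Qed.

Let FI_lip a b : `|FI a - FI b| <= N (a - b).
Proof.
rewrite /FI -raddfB -linearB; apply: normc_Im_le; exact: phi_le.
Qed.

(** [extend] takes limits of real sequences, so the real and imaginary parts, each Lipschitz, are
    extended separately. *)
Definition cplt_state x : C := Complex (extend FR x) (extend FI x).

Fact cplt_state_linear : scalar cplt_state.
Proof.
move=> c; elim/cpltP => u uc; elim/cpltP => v vc.
rewrite scaleE // addE //; last exact: cauchyZ.
have cuv := cauchyD (cauchyZ c uc) vc.
apply/eqP; rewrite eq_complex; apply/andP; split; apply/eqP.
  apply: (cvgn_unique (extend_cvg FR_lip cuv)).
  rewrite (_ : complex.Re _ = complex.Re c * extend FR (lim_of u) - complex.Im c * extend FI (lim_of u) + extend FR (lim_of v)); last by case: c {cuv}.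
  rewrite (_ : (fun n => _) = fun n => complex.Re c * FR (u n) - complex.Im c * FI (u n) + FR (v n)); last first.
    by apply/funext => n; rewrite /FR /FI linearD linearZ /=; case: c {cuv} (phi (u n)) (phi (v n)) => [? ?] [? ?] [? ?].
  apply: cvgD; last exact: extend_cvg.
  by apply: cvgB; apply: cvgM; try exact: cvg_cst; exact: extend_cvg.
apply: (cvgn_unique (extend_cvg FI_lip cuv)).
rewrite (_ : complex.Im _ = complex.Re c * extend FI (lim_of u) + complex.Im c * extend FR (lim_of u) + extend FI (lim_of v)); last by case: c {cuv}.
rewrite (_ : (fun n => _) = fun n => complex.Re c * FI (u n) + complex.Im c * FR (u n) + FI (v n)); last first.
  by apply/funext => n; rewrite /FR /FI linearD linearZ /=; case: c {cuv} (phi (u n)) (phi (v n)) => [? ?] [? ?] [? ?].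
apply: cvgD; last exact: extend_cvg.
by apply: cvgD; apply: cvgM; try exact: cvg_cst; exact: extend_cvg.
Qed.

Definition cplt_functional : {scalar Q} :=
  HB.pack cplt_state (GRing.isLinear.Build C Q C *%R cplt_state cplt_state_linear).

Lemma cplt_state_cst a : cplt_state (lim_of (fun=> a)) = phi a.
Proof.
apply/eqP; rewrite eq_complex; apply/andP; split; apply/eqP.
  exact: (cvgn_unique (extend_cvg FR_lip (cauchy_cst a)) (cvg_cst _)).
exact: (cvgn_unique (extend_cvg FI_lip (cauchy_cst a)) (cvg_cst _)).
Qed.

Lemma cplt_state_ge0 : (forall a, 0 <= phi (st a * a)) ->
  forall x, 0 <= cplt_state (cplt_star x * x).
Proof.
move=> phi0; elim/cpltP => u uc; rewrite sE // mulE //; last exact: cauchyS.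
have suc := cauchyM (cauchyS uc) uc.
rewrite lecE /=; apply/andP; split.
  apply/eqP; apply: (cvgn_unique (extend_cvg FI_lip suc)).
  rewrite (_ : (fun n => _) = fun=> 0); first exact: cvg_cst.
  apply/funext => n; have := phi0 (u n); rewrite lecE => /andP[/eqP E _].
  by rewrite /FI E.
apply: cvgn_le (cvg_cst (0 : R)) (extend_cvg FR_lip suc) => n.
by have := phi0 (u n); rewrite lecE => /andP[].
Qed.

Lemma cplt_prod_cst (I : Type) (r : seq I) (F : I -> A) :
  \prod_(i <- r) lim_of (fun=> F i) = lim_of (fun=> \prod_(i <- r) F i) :> Q.
Proof.
elim: r => [|i r IH]; first by rewrite !big_nil.
by rewrite !big_cons IH mulE //; apply: cauchy_cst.
Qed.

End CompletionCStar.

(** * The operator norm of left multiplication in the GNS seminorm *)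

Section GNSNorm.
Variable R : realType.
Local Notation C := R[i].
Variables (A : lalgType C) (st : A -> A) (phi : {scalar A}).
Hypothesis scaleAr : forall (c : C) (a b : A), c *: (a * b) = a * (c *: b).
Hypothesis stK : involutive st.
Hypothesis stD : {morph st : a b / a + b}.
Hypothesis stZ : forall (c : C) a, st (c *: a) = Num.conj c *: st a.
Hypothesis stM : forall a b, st (a * b) = st b * st a.
Hypothesis phi1 : phi 1 = 1.
Hypothesis phi_ge0 : forall a, 0 <= phi (st a * a).
Implicit Types a b : A.

(** Only a seminorm. No quotient is taken: [precstar] allows a degenerate norm, and the completion
    identifies elements at distance zero. *)
Definition gns_seminorm b : R := Num.sqrt (complex.Re (phi (st b * b))).
Local Notation nrm := gns_seminorm.

Lemma nrm_ge0 b : 0 <= nrm b. Proof. exact: sqrtr_ge0. Qed.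

Lemma nrm_sq b : phi (st b * b) = (nrm b ^+ 2)%:C%C.
Proof.
have := phi_ge0 b; rewrite lecE /= => /andP[/eqP Im0 Re0].
by rewrite sqr_sqrtr //; apply/eqP; rewrite eq_complex /= eqxx Im0 eqxx.
Qed.

Lemma gns_st0 : st 0 = 0.
Proof. by apply: (addrI (st 0)); rewrite -stD !addr0. Qed.

Lemma gns_st1 : st 1 = 1.
Proof. by have := stM (st 1) 1; rewrite mulr1 !stK mulr1. Qed.

Lemma gns_psd : psd (fun a b => phi (st a * b)).
Proof.
move=> l; rewrite (_ : kform _ l = phi (st (\sum_(p <- l) p.1 *: p.2) * \sum_(p <- l) p.1 *: p.2)) //.
rewrite (big_morph st stD gns_st0) mulr_suml linear_sum; apply: eq_bigr => p _ /=.
rewrite mulr_sumr linear_sum; apply: eq_bigr => q _ /=.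
rewrite stZ -[X in _ = phi X]scalerAl -scaleAr !linearZ /=; ring.
Qed.

Lemma gns_CS a b : `|phi (st a * b)| <= (nrm a * nrm b)%:C%C.
Proof.
rewrite -(ler_pXn2r (n := 2)) // ?nnegrE ?normr_ge0 //; last first.
  by rewrite -[0 <= _]/((real_complex R 0) <= _) lecR mulr_ge0 ?nrm_ge0.
apply: le_trans (psd_CauchySchwarz a b gns_psd) _.
by rewrite !nrm_sq -rmorphM -[X in _ <= X](rmorphXn (real_complex R)) exprMn.
Qed.

Lemma nrmD a b : nrm (a + b) <= nrm a + nrm b.
Proof.
rewrite -(ler_pXn2r (n := 2)) ?nnegrE ?nrm_ge0 ?addr_ge0 ?nrm_ge0 //.
have := normc_Re_le (gns_CS a b); have := normc_Re_le (gns_CS b a).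
have := nrm_sq (a + b); rewrite stD mulrDl !mulrDr !linearD /= !nrm_sq.
move: (phi (st a * b)) (phi (st b * a)) => [x1 y1] [x2 y2].
move=> /(congr1 (@complex.Re R)) /= E; rewrite !ler_norml => /andP[_ x2l] /andP[_ x1l].
by rewrite -E sqrrD [nrm b * nrm a]mulrC mulr2n in x1l x2l *; lra.
Qed.

Lemma nrmZ (c : C) a : nrm (c *: a) = ComplexField.Normc.normc c * nrm a.
Proof.
apply/eqP; rewrite -(eqrXn2 (n := 2)) ?nrm_ge0 ?mulr_ge0 ?normc_ge0 ?nrm_ge0 //.
apply/eqP/complexI; rewrite -nrm_sq stZ -[X in phi X]scalerAl -scaleAr !linearZ /=.
rewrite nrm_sq exprMn mulrA [RHS](rmorphM (real_complex R)); congr (_ * _).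
rewrite mulrC [RHS](rmorphXn (real_complex R)) -[LHS]normCK normc_def.
by case: c.
Qed.

Lemma nrm1 : nrm 1 = 1.
Proof. by rewrite /nrm gns_st1 mulr1 phi1 /= sqrtr1. Qed.

(** Cauchy-Schwarz for b and a^* a b. It yields both the bound for the adjoint and the C*-identity
    of [op_norm]. *)
Lemma nrm_adj a b : nrm (a * b) ^+ 2 <= nrm b * nrm (st a * a * b).
Proof.
have := normc_Re_le (gns_CS b (st a * a * b)).
rewrite -mulrA mulrA -stM nrm_sq /= ger0_norm ?exprn_ge0 ?nrm_ge0 //.
Qed.

Definition op_bound a (M : R) := 0 <= M /\ forall b, nrm (a * b) <= M * nrm b.

Lemma op_boundD a b M M' : op_bound a M -> op_bound b M' -> op_bound (a + b) (M + M').
Proof.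
move=> [M0 aM] [M0' bM]; split=> [|c]; first by rewrite addr_ge0.
by rewrite !mulrDl; apply: le_trans (nrmD _ _) _; apply: lerD.
Qed.

Lemma op_boundZ (c : C) a M : op_bound a M -> op_bound (c *: a) (ComplexField.Normc.normc c * M).
Proof.
move=> [M0 aM]; split=> [|b]; first by rewrite mulr_ge0 ?normc_ge0.
by rewrite -scalerAl nrmZ -mulrA ler_wpM2l ?normc_ge0.
Qed.

Lemma op_boundM a b M M' : op_bound a M -> op_bound b M' -> op_bound (a * b) (M * M').
Proof.
move=> [M0 aM] [M0' bM]; split=> [|c]; first by rewrite mulr_ge0.
by rewrite -!mulrA; apply: le_trans (aM _) _; rewrite ler_wpM2l.
Qed.

Lemma op_bound0 : op_bound 0 0.
Proof.
split=> // b; rewrite !mul0r /nrm gns_st0 mul0r linear0 /= sqrtr0.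
by [].
Qed.

Lemma op_bound1 : op_bound 1 1.
Proof. by split=> // b; rewrite !mul1r. Qed.

Hypothesis bounded : forall a, exists M, op_bound a M.

Definition op_norm a : R := inf [set M | op_bound a M]%classic.

Lemma op_norm_le a M : op_bound a M -> op_norm a <= M.
Proof. by move=> aM; apply: ge_inf => //; exists 0 => x []. Qed.

Lemma op_norm_ge0 a : 0 <= op_norm a.
Proof. by apply: lb_le_inf => [|M []//]; have [M aM] := bounded a; exists M. Qed.

Lemma op_norm_bound a : op_bound a (op_norm a).
Proof.
split=> [|b]; first exact: op_norm_ge0.
have [b0|b0] := eqVneq (nrm b) 0.
  by have [M [_ aM]] := bounded a; have := aM b; rewrite b0 !mulr0.
have bp : 0 < nrm b by rewrite lt_def b0 nrm_ge0.
rewrite -ler_pdivrMr //; apply: lb_le_inf => [|M [_ aM]].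
  by have [M aM] := bounded a; exists M.
by rewrite ler_pdivrMr.
Qed.

Lemma op_normD a b : op_norm (a + b) <= op_norm a + op_norm b.
Proof. by apply/op_norm_le/op_boundD; apply: op_norm_bound. Qed.

Lemma op_normM a b : op_norm (a * b) <= op_norm a * op_norm b.
Proof. by apply/op_norm_le/op_boundM; apply: op_norm_bound. Qed.

Lemma op_normZ (c : C) a : op_norm (c *: a) = ComplexField.Normc.normc c * op_norm a.
Proof.
apply/le_anti/andP; split; first by apply/op_norm_le/op_boundZ/op_norm_bound.
have [->|c0] := eqVneq c 0.
  by rewrite (normc_real 0) normr0 mul0r op_norm_ge0.
have nc : ComplexField.Normc.normc c != 0.
  by apply: contra_neq c0 => /ComplexField.Normc.eq0_normc.
have ncp : 0 < ComplexField.Normc.normc c by rewrite lt_def nc normc_ge0.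
rewrite -ler_pdivlMl // -{1}[a]scale1r -(mulVf c0) -scalerA.
rewrite -ComplexField.Normc.normcV; exact/op_norm_le/op_boundZ/op_norm_bound.
Qed.

Lemma op_norm_st_le a : op_norm (st a) <= op_norm a.
Proof.
apply: op_norm_le; split=> [|b]; first exact: op_norm_ge0.
have [-> |n0] := eqVneq (nrm (st a * b)) 0.
  by rewrite mulr_ge0 ?op_norm_ge0 ?nrm_ge0.
have np : 0 < nrm (st a * b) by rewrite lt_def n0 nrm_ge0.
rewrite -(ler_pM2r np) -expr2; apply: le_trans (nrm_adj _ _) _.
rewrite stK -mulrA [op_norm a * _]mulrC -mulrA ler_wpM2l ?nrm_ge0 //.
by have [_] := op_norm_bound a; apply.
Qed.

Lemma op_norm_star a : op_norm (st a * a) = op_norm a ^+ 2.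
Proof.
apply/le_anti/andP; split.
  apply: le_trans (op_normM _ _) _; rewrite expr2 ler_wpM2r ?op_norm_ge0 //.
  exact: op_norm_st_le.
rewrite -[X in _ <= X]sqr_sqrtr ?op_norm_ge0 // ler_pXn2r ?nnegrE ?sqrtr_ge0 ?op_norm_ge0 //.
apply: op_norm_le; split=> [|b]; first exact: sqrtr_ge0.
rewrite -(ler_pXn2r (n := 2)) ?nnegrE ?nrm_ge0 ?mulr_ge0 ?sqrtr_ge0 ?nrm_ge0 //.
apply: le_trans (nrm_adj _ _) _; rewrite exprMn sqr_sqrtr ?op_norm_ge0 //.
rewrite mulrC expr2 mulrA ler_wpM2r ?nrm_ge0 //.
by have [_] := op_norm_bound (st a * a); apply.
Qed.

Lemma op_norm1_gt0 : 0 < op_norm 1.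
Proof.
apply: lt_le_trans ltr01 _; have [_ /(_ 1)] := op_norm_bound 1.
by rewrite mulr1 nrm1 mulr1.
Qed.

Lemma op_norm_phi a : `|phi a| <= (op_norm a)%:C%C.
Proof.
rewrite -[a]mul1r -gns_st1; apply: le_trans (gns_CS _ _) _; rewrite lecR nrm1 mul1r gns_st1 mul1r.
by have [_ /(_ 1)] := op_norm_bound a; rewrite mulr1 nrm1 mulr1.
Qed.

Definition gns_precstar : precstar R :=
  PreCStar scaleAr stK stD stZ stM op_normD op_normZ op_normM op_norm_star op_norm1_gt0.

End GNSNorm.

(** By Bernoulli's inequality the powers of a number above 1 are unbounded, also along exponents
    2^n. *)
Lemma pow2_bounded_le1 (R : realType) (q B : R) :
  (forall n, q ^+ (2 ^ n)%N <= B) -> q <= 1.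
Proof.
move=> qB; rewrite leNgt; apply/negP => q1.
have bern n : 1 + n%:R * (q - 1) <= q ^+ n.
  elim: n => [|n IH]; first by rewrite mul0r addr0 expr0.
  rewrite exprS; apply: le_trans (_ : q * (1 + n%:R * (q - 1)) <= _); last first.
    by rewrite ler_wpM2l // (le_trans ler01) // ltW.
  have : 0 <= n%:R * (q - 1) * (q - 1) by rewrite !mulr_ge0 // subr_ge0 ltW.
  by rewrite -natr1; lra.
have q0 : 0 < q - 1 by rewrite subr_gt0.
have [n nB] : exists n : nat, B / (q - 1) < n%:R.
  by exists (Num.truncn (B / (q - 1))).+1; rewrite truncnS_gt.
have := qB n; apply/negP; rewrite -ltNge; apply: lt_le_trans (bern _).
have : n%:R <= (2 ^ n)%:R :> R by rewrite ler_nat ltnW // ltn_expl.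
move: nB; rewrite ltr_pdivrMr // => nB n2.
have : n%:R * (q - 1) <= (2 ^ n)%:R * (q - 1) by rewrite ler_wpM2r // ltW.
lra.
Qed.

(** * From a positive functional of geometric growth to a C*-probability space *)

Section Realization.
Variables (R : realType) (I : Type).
Local Notation C := R[i].
Variables (A : lalgType C) (X : seq I -> A) (st : A -> A) (phi : {scalar A}).
Implicit Types (w u v : seq I) (p q : A) (c : C).
Hypothesis X_span : forall p, exists l : seq (C * seq I), p = \sum_(q <- l) q.1 *: X q.2.
Hypothesis X_nil : X [::] = 1.
Hypothesis X_mul : forall u c v, X u * (c *: X v) = c *: X (u ++ v).
Hypothesis stD : {morph st : p q / p + q}.
Hypothesis st_word : forall c w, st (c *: X w) = c^* *: X (rev w).
Hypothesis phi1 : phi 1 = 1.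
Hypothesis phi_psd : psd (fun u v => phi (X (rev u ++ v))).
Variable D : R.
Hypothesis D_ge1 : 1 <= D.
Hypothesis phi_growth : forall w, `|phi (X w)| <= (D%:C%C : C) ^+ size w.

Lemma word_ind (P : A -> Prop) : P 0 -> (forall p q, P p -> P q -> P (p + q)) ->
  (forall c w, P (c *: X w)) -> forall p, P p.
Proof. by move=> P0 PD PX p; have [l ->] := X_span p; apply: big_ind. Qed.

Lemma word_scaleAr c p q : c *: (p * q) = p * (c *: q).
Proof.
elim/word_ind: p => [|p p' IH IH'|d u]; first by rewrite !mul0r scaler0.
  by rewrite !mulrDl scalerDr IH IH'.
rewrite -!scalerAl scalerA mulrC -scalerA; congr (_ *: _).
elim/word_ind: q => [|q q' IH IH'|e v]; first by rewrite scaler0 mulr0 scaler0.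
  by rewrite mulrDr !scalerDr mulrDr IH IH'.
by rewrite X_mul !scalerA X_mul.
Qed.

Lemma XM u v : X u * X v = X (u ++ v).
Proof. by have := X_mul u 1 v; rewrite !scale1r. Qed.

Lemma word_st0 : st 0 = 0.
Proof. by apply: (addrI (st 0)); rewrite -stD !addr0. Qed.

Lemma word_stZ c p : st (c *: p) = c^* *: st p.
Proof.
elim/word_ind: p => [|p q IH IH'|d w]; first by rewrite scaler0 word_st0 scaler0.
  by rewrite scalerDr !stD scalerDr IH IH'.
by rewrite scalerA !st_word rmorphM scalerA.
Qed.

Lemma word_stK : involutive st.
Proof.
elim/word_ind => [|p q IH IH'|d w]; first by rewrite !word_st0.
  by rewrite !stD IH IH'.
by rewrite !st_word conjCK revK.
Qed.

Lemma word_stM p q : st (p * q) = st q * st p.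
Proof.
elim/word_ind: p => [|p p' IH IH'|c u]; first by rewrite mul0r word_st0 mulr0.
  by rewrite mulrDl !stD mulrDr IH IH'.
elim/word_ind: q => [|q q' IH IH'|d v]; first by rewrite mulr0 word_st0 mul0r.
  by rewrite mulrDr !stD mulrDl IH IH'.
rewrite -scalerAl X_mul scalerA !st_word -scalerAl X_mul scalerA.
by rewrite rev_cat rmorphM mulrC.
Qed.

Lemma st_X w : st (X w) = X (rev w).
Proof. by have := st_word 1 w; rewrite conjC1 !scale1r. Qed.

Lemma phi_form (l : seq (C * seq I)) (p : A) :
  let b := \sum_(q <- l) q.1 *: X q.2 in
  phi (st b * p * b) =
  \sum_(m <- l) \sum_(n <- l) m.1^* * n.1 * phi (X (rev m.2) * p * X n.2).
Proof.
rewrite /= (big_morph st stD word_st0) !mulr_suml linear_sum.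
apply: eq_bigr => m _; rewrite mulr_sumr linear_sum; apply: eq_bigr => n _ /=.
rewrite st_word -!scalerAl -word_scaleAr !linearZ /=; exact: mulrCA.
Qed.

Lemma phi_ge0 p : 0 <= phi (st p * p).
Proof.
have [l ->] := X_span p; have := phi_psd l; congr (0 <= _).
rewrite -[st _]mulr1 phi_form /kform; apply: eq_bigr => m _.
by apply: eq_bigr => n _; rewrite mulr1 XM.
Qed.

Local Notation nrm := (gns_seminorm st phi).
Local Notation op_bd := (op_bound st phi).
Let x i := X [:: i].

Lemma st_xn i n : st (x i ^+ n) = x i ^+ n.
Proof.
elim: n => [|n IH]; first by rewrite !expr0 (gns_st1 word_stK word_stM).
by rewrite exprS word_stM IH st_X -exprSr -exprS.
Qed.

Lemma nrm_x_double i n b :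
  nrm (x i ^+ n * b) ^+ 2 <= nrm b * nrm (x i ^+ (n + n) * b).
Proof.
have := nrm_adj word_scaleAr stD word_stZ word_stM phi_ge0 (x i ^+ n) b.
by rewrite st_xn exprD.
Qed.

Lemma xnE i n : x i ^+ n = X (nseq n i).
Proof. by elim: n => [|n IH]; rewrite ?expr0 ?X_nil // exprS IH XM. Qed.

Lemma nrm_x_growth i b : exists K : R, forall n, nrm (x i ^+ n * b) ^+ 2 <= K * D ^+ (n + n).
Proof.
have D0 : 0 <= D by apply: le_trans D_ge1.
have [l bE] := X_span b.
pose K : C := \sum_(m <- l) \sum_(n <- l)
  `|m.1| * `|n.1| * (D%:C%C ^+ size m.2 * D%:C%C ^+ size n.2).
exists (complex.Re K) => n.
have E : phi (st b * x i ^+ (n + n) * b) = (nrm (x i ^+ n * b) ^+ 2)%:C%C.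
  by rewrite -(nrm_sq phi_ge0) word_stM st_xn exprD !mulrA.
have Dc0 : 0 <= D%:C%C :> C by rewrite -[0 <= _]/((real_complex R 0) <= _) lecR.
have KR : K = (complex.Re K)%:C%C.
  have : 0 <= K.
    rewrite sumr_ge0 // => m _; rewrite sumr_ge0 // => n' _.
    by rewrite !mulr_ge0 ?normr_ge0 ?exprn_ge0.
  rewrite lecE /= => /andP[/eqP I0 _].
  by apply/eqP; rewrite eq_complex /= eqxx I0 eqxx.
have KE : (complex.Re K * D ^+ (n + n))%:C%C = K * D%:C%C ^+ (n + n) :> C.
  by rewrite [in RHS]KR -(rmorphXn (real_complex R)) -(rmorphM (real_complex R)).
rewrite -lecR -E KE.
apply: le_trans (_ : `|phi (st b * x i ^+ (n + n) * b)| <= _).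
  by rewrite E ger0_norm // -[0 <= _]/((real_complex R 0) <= _) lecR exprn_ge0 // nrm_ge0.
rewrite bE phi_form; apply: le_trans (ler_norm_sum _ _ _) _; rewrite /K mulr_suml.
apply: ler_sum => m _; apply: le_trans (ler_norm_sum _ _ _) _; rewrite mulr_suml.
apply: ler_sum => n' _; rewrite !normrM norm_conjC -[X in _ <= X]mulrA ler_wpM2l ?mulr_ge0 ?normr_ge0 //.
rewrite xnE !XM; apply: le_trans (phi_growth _) _.
rewrite !size_cat size_rev size_nseq !exprD le_eqVlt; apply/orP; left; apply/eqP; ring.
Qed.

(** A spectral radius argument. The growth bound on |x^n b| has a constant depending on b, but the
    normalized norms v n = |x^n b| / (|b| D^n) satisfy (v n)^2 <= v (2 n), so boundedness in n alone
    forces v 1 <= 1. *)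
Lemma x_bound i : op_bd (x i) D.
Proof.
have D0 : 0 < D by apply: lt_le_trans D_ge1.
split=> [|b]; first exact: ltW.
have [b0|b0] := eqVneq (nrm b) 0.
  have := nrm_x_double i 1 b; rewrite expr1 b0 mul0r mulr0 => E.
  by rewrite -(ler_pXn2r (n := 2)) ?nnegrE ?nrm_ge0 // expr0n.
have bp : 0 < nrm b by rewrite lt_def b0 nrm_ge0.
have [K KP] := nrm_x_growth i b.
pose v n := nrm (x i ^+ n * b) / (nrm b * D ^+ n).
have vp n : 0 <= v n by rewrite divr_ge0 ?mulr_ge0 ?nrm_ge0 ?exprn_ge0 // ltW.
have vE n : nrm (x i ^+ n * b) = v n * (nrm b * D ^+ n).
  by rewrite /v divfK // mulf_neq0 // expf_neq0 // gt_eqF.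
have v2 n : v n ^+ 2 <= v (n + n)%N.
  have := nrm_x_double i n b; rewrite !vE !exprMn exprD.
  have -> : nrm b * (v (n + n)%N * (nrm b * (D ^+ n * D ^+ n))) =
    v (n + n)%N * (nrm b ^+ 2 * (D ^+ n) ^+ 2) by ring.
  by rewrite ler_pM2r // mulr_gt0 ?exprn_gt0.
have vpow n : v 1%N ^+ (2 ^ n)%N <= v (2 ^ n)%N.
  elim: n => [|n IH]; first by rewrite expn0 expr1.
  rewrite expnS mulnC exprM muln2 -addnn; apply: le_trans (v2 _).
  by rewrite ler_pXn2r ?nnegrE ?exprn_ge0.
have vK n : v n ^+ 2 <= K / nrm b ^+ 2.
  have := KP n; rewrite vE !exprMn exprD -expr2 mulrA ler_pM2r ?exprn_gt0 //.
  by rewrite ler_pdivlMr ?exprn_gt0.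
have /pow2_bounded_le1 v1 : forall n, (v 1%N ^+ 2) ^+ (2 ^ n)%N <= K / nrm b ^+ 2.
  move=> n; rewrite exprAC; apply: le_trans (vK (2 ^ n)%N).
  by rewrite ler_pXn2r ?nnegrE ?exprn_ge0.
have {}v1 : v 1%N <= 1 by rewrite -(ler_pXn2r (n := 2)) ?nnegrE // expr1n.
have := vE 1%N; rewrite !expr1 => ->; rewrite [nrm b * D]mulrC -[X in _ <= X]mul1r.
by rewrite ler_wpM2r // mulr_ge0 ?nrm_ge0 // ltW.
Qed.

Lemma word_bounded p : exists M, op_bd p M.
Proof.
elim/word_ind: p => [|p q [M pM] [M' qM]|c w].
- by exists 0; apply: op_bound0 stD.
- by exists (M + M'); apply: (op_boundD word_scaleAr stD word_stZ phi_ge0).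
have [M wM] : exists M, op_bd (X w) M.
  elim: w => [|i w [M wM]]; first by exists 1; rewrite X_nil; apply: op_bound1.
  by exists (D * M); rewrite -[_ :: w]/([:: i] ++ w) -XM; apply: op_boundM => //; apply: x_bound.
by exists (ComplexField.Normc.normc c * M); apply: (op_boundZ word_scaleAr word_stZ phi_ge0).
Qed.

Lemma cstar_realization : exists (B : cstarAlgType R) (psi : {scalar B}) (y : I -> B),
  [/\ psi 1 = 1, forall a, 0 <= psi (star a * a), forall i, star (y i) = y i &
      forall w, psi (\prod_(i <- w) y i) = phi (X w)].
Proof.
pose P : precstar R :=
  gns_precstar word_scaleAr word_stK stD word_stZ word_stM phi1 phi_ge0 word_bounded.
pose phiP : {scalar P} := phi.
have phi_le (a : P) : `|phiP a| <= (pcN a)%:C%C.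
  exact: (op_norm_phi word_scaleAr word_stK stD word_stZ word_stM phi1 phi_ge0 word_bounded).
pose psi := cplt_functional phi_le.
have psiE a : psi (lim_of (fun=> a)) = phiP a by apply: cplt_state_cst.
exists (cplt P), psi, (fun i => lim_of (fun=> (x i : P))); split.
- by rewrite cplt_oneE psiE.
- by move=> a; apply: cplt_state_ge0 phi_le phi_ge0 _.
- move=> i; rewrite [LHS](cplt_starE (cauchy_cst _)).
  by apply: lim_ext => n; apply: st_X.
- move=> w; rewrite cplt_prod_cst psiE; congr (phi _).
  elim: w => [|i w IH]; first by rewrite big_nil.
  by rewrite big_cons IH; apply: XM.
Qed.

End Realization.

(** * The involution on noncommutative polynomials *)

Section PolynomialStar.
Variables (R : realType) (k : nat).
Local Notation C := R[i].
Local Notation A := (ncpoly R k).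
Implicit Types (w u v : seq 'I_k) (p : A) (c : C).
Local Notation X w := (\prod_(i <- w) ncX R i : A).

Lemma ncpoly_span p : exists l : seq (C * seq 'I_k), p = \sum_(q <- l) q.1 *: X q.2.
Proof.
exists [seq (p@_m, m : seq 'I_k) | m <- msupp p].
by rewrite big_map; exact: ncpoly_expand.
Qed.

Lemma scale_word c w : c *: X w = << c *g FMonom w >>.
Proof.
rewrite prod_ncX; apply/malgP => n; rewrite mcoeffZ !mcoeffU.
by case: eqP => _; rewrite ?mulr1 ?mulr0 ?mulr1n ?mulr0n.
Qed.

Lemma word_mul u c v : X u * (c *: X v) = c *: X (u ++ v).
Proof.
rewrite !scale_word prod_ncX malgM_def fgmulUU mul1r.
by congr (<< _ *g _ >>); apply/val_inj; rewrite /= fmM.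
Qed.

Definition ncstar p : A :=
  mmap (malgC \o Num.conj) (fun m : {fmonom 'I_k} => X (rev m)) p.

Lemma ncstarD : {morph ncstar : p q / p + q}.
Proof. exact: raddfD. Qed.

Lemma ncstar_word c w : ncstar (c *: X w) = c^* *: X (rev w).
Proof. by rewrite /ncstar scale_word mmapU /= mul_malgC. Qed.

End PolynomialStar.

Lemma psd_growth_in_Dc (R : realType) (k : nat) (rho : dalg R k) (D : R) :
  psd (fun u v => gser rho (rev u ++ v)) -> 1 <= D ->
  (forall w, `|gser rho w| <= (D%:C%C : R[i]) ^+ size w) -> in_Dc rho.
Proof.
move=> rho_psd D1 growth.
have [B [psi [y [psi1 psi0 ysa yE]]]] := cstar_realization (@ncpoly_span R k)
  (big_nil _ _ _ _) (@word_mul R k) (@ncstarD R k) (@ncstar_word R k) (dalg1 rho) rho_psd D1 growth.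
by exists B, psi, y; split=> // w; rewrite yE.
Qed.

Theorem corollary7p11 (R : realType) (k : nat) (k_ge1 : (1 <= k)%N)
    (nu : dalg R k) (nu_Dc : in_Dc nu) (t : R) (t_gt0 : 0 < t) :
  Phi (free_add nu (semicircular_family k t)) = BB t (Phi nu)
  /\ in_Dc (BB t (Phi nu)).
Proof.
have E := Phi_free_add_semicircular nu t_gt0; split=> //.
rewrite -E; set sigma := free_add _ _.
have sE : gser sigma = resolvent nu t (model_vac nu).
  have [|s sP] := @gser_surj R k (resolvent nu t (model_vac nu)).
    by rewrite resolvent_nil vac_nil.
  rewrite /sigma (free_add_semicircular _ sP) // => i; exact: sop_semicircular.
have [nu_psd [M M1 nu_gr]] := in_Dc_psd_growth nu_Dc.
have s_psd : psd (fun u v => gser sigma (rev u ++ v)).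
  by rewrite sE; apply: kS_psd (ltW t_gt0) nu_psd.
have s_gr w : `|gser sigma w| <= (2 * M + t%:C%C) ^+ size w.
  by rewrite sE; apply: sigma_growth (ltW t_gt0) M M1 nu_gr w.
have c0 : 0 <= t%:C%C :> R[i] by apply/c_ge0/ltW.
have M0 : 0 <= M by apply: le_trans M1.
have K0 : 0 <= 2 * M + t%:C%C by rewrite addr_ge0 ?mulr_ge0.
(* The bound M is a nonnegative complex number, while the realization wants a real constant; the
   summand 1 is the loss in [Phi_growth]. *)
pose D := complex.Re (2 * M + t%:C%C + 1).
have DE : D%:C%C = 2 * M + t%:C%C + 1.
  have : 0 <= 2 * M + t%:C%C + 1 by rewrite addr_ge0.
  by rewrite lecE => /andP[/eqP I0 _]; apply/eqP; rewrite eq_complex /= eqxx I0 eqxx.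
apply: (@psd_growth_in_Dc _ _ _ D).
- exact: Phi_psd.
- by rewrite -lecR DE lerDr.
- by move=> w; rewrite DE; apply: Phi_growth.
Qed.
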